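(* Let $\mathbb K$ be a Polish space, let $\lambda_0<\infty$, and let $\mathcal T$ be the family of (distributions of) stationary marked point processes $\Psi$ on $\mathbb R^d\times\mathbb K$ with intensities uniformly bounded by $\lambda_0$, i.e. $\mathbb E[\Psi(Q_1\times\mathbb K)]\le\lambda_0$. Then: (1) If $\mathbb K$ is locally compact, then $\mathcal T$ is tight as a family of probability measures on $\mathbb N_{\mathbb K}$. (2) The family $\mathcal T$ is closed with respect to (vague) convergence in distribution. (3) Assume $\Psi_n\to\Psi$ vaguely in distribution for $\Psi_n\in\mathcal T$, and denote by $\lambda_n,\lambda$ the (positive) intensities of $\Psi_n$ and $\Psi$, respectively. If $\lambda_n\to\lambda$, then $\Psi_n^0\to\Psi^0$ vaguely in distribution, where $\Psi_n^0,\Psi^0$ denote (random measures with) the respective Palm distributions.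
   Context: $Q_1=[-1/2,1/2]^d$. $\mathbb N_{\mathbb K}$ is here the space of boundedly finite Borel measures on $\mathbb R^d\times\mathbb K$ with the vague topology (generated by $\mu\mapsto\int f\,d\mu$ for continuous $f\ge0$ with bounded support); when $\mathbb K$ is locally compact, bounded sets are understood as relatively compact ones, so test functions are the continuous compactly supported ones. A random measure is a random element of $\mathbb N_{\mathbb K}$ with its Borel $\sigma$-algebra, and a marked point process is an integer-valued random measure $\Psi$ with $\Psi(B\times\mathbb K)<\infty$ a.s. for bounded Borel $B\subset\mathbb R^d$; it is stationary if its law is invariant under the shifts $S_y$ induced by $(x,k)\mapsto(x-y,k)$, $y\in\mathbb R^d$. $\Psi_n\to\Psi$ vaguely in distribution means weak convergence of the laws on $\mathbb N_{\mathbb K}$ with respect to the vague topology. For a stationary $\Psi$ with intensity $\lambda=\mathbb E[\Psi(Q_1\times\mathbb K)]\in(0,\infty)$, its Palm distribution is the probability measure on $\mathbb N_{\mathbb K}$ given by $A\mapsto\lambda^{-1}\,\mathbb E\big[\int\mathbf 1(x\in Q_1)\,\mathbf 1(S_x\Psi\in A)\,\Psi(dx\times\mathbb K)\big]$. *)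

(* Defs.v *)
(* MathComp-Analysis *)
From HB Require Import structures.
From mathcomp Require Import all_boot all_order all_algebra.
From mathcomp Require Import all_classical all_reals all_analysis.

Set Implicit Arguments.
Unset Strict Implicit.
Unset Printing Implicit Defensive.

Import Order.TTheory GRing.Theory Num.Theory.
Import numFieldNormedType.Exports.

Local Open Scope classical_set_scope.
Local Open Scope ring_scope.

(* With [separable], these are the Polish spaces together with a choice of a
   complete metric inducing the topology; the metric only matters for the
   notion of bounded set. *)
#[short(type="completeMetricType")]
HB.structure Definition CompleteMetric (R : numDomainType) :=
  {T of CompletePseudoMetric R T & Metric R T}.

Definition separable (T : topologicalType) : Prop :=
  exists2 D : set T, countable D & dense D.

Notation borel T := (g_sigma_algebraType (@open T)).

Section vague.
Context {R : realType} {d : nat} {K : completeMetricType R}.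

Local Notation E := 'rV[R]_d.
Local Notation X := ('rV[R]_d * K)%type.

(* Bounded sets are the relatively compact ones if K is locally compact, and the
   metrically bounded ones otherwise. *)
Definition bdd (A : set X) : Prop :=
  (locally_compact [set: K] -> precompact A) /\
  (~ locally_compact [set: K] -> exists z r, A `<=` ball z r).

(* A measure of the library is a function on all subsets; its irrelevant values
   outside the Borel sets are fixed to 0, so that two elements are equal as soon
   as they agree on Borel sets. *)
Record bfmeasure := BFMeasure {
  bfm :> {measure set (borel X) -> \bar R} ;
  bfm_fin : forall B : set (borel X), measurable B -> bdd B -> (bfm B < +oo)%E ;
  bfm_junk : forall B : set (borel X), ~ measurable B -> bfm B = 0%E
}.

Lemma bfmeasure_ext (m1 m2 : bfmeasure) :
  (forall B : set (borel X), measurable B -> m1 B = m2 B) -> m1 = m2.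
Proof.
case: m1 m2 => [m1 f1 j1] [m2 f2 j2] /= m12.
have em : m1 = m2.
  apply/eq_measure/funext => B.
  by have [/m12//|nB] := pselect (measurable B); rewrite j1 ?j2.
by move: f1 j1; rewrite em => f1 j1; congr BFMeasure; exact: Prop_irrelevance.
Qed.

Section restrict_to_borel.
Variable m : {measure set (borel X) -> \bar R}.

Definition mborel (B : set (borel X)) : \bar R :=
  if `[< measurable B >] then m B else 0%E.

Lemma mborelE B : measurable B -> mborel B = m B.
Proof. by move=> mB; rewrite /mborel; case: asboolP. Qed.

Let mborel0 : mborel set0 = 0%E.
Proof. by rewrite mborelE// measure0. Qed.

Let mborel_ge0 B : (0 <= mborel B)%E.
Proof. by rewrite /mborel; case: ifP. Qed.

Let mborel_sigma_additive : semi_sigma_additive mborel.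
Proof.
move=> F mF tF mUF; rewrite mborelE//.
under eq_fun do under eq_bigr do rewrite mborelE//.
exact: measure_semi_sigma_additive.
Qed.

HB.instance Definition _ := isMeasure.Build _ _ _
  mborel mborel0 mborel_ge0 mborel_sigma_additive.

Hypothesis m_fin :
  forall B : set (borel X), measurable B -> bdd B -> (m B < +oo)%E.

Let mborel_fin (B : set (borel X)) : measurable B -> bdd B -> (mborel B < +oo)%E.
Proof. by move=> mB; rewrite mborelE//; exact: m_fin. Qed.

Let mborel_junk (B : set (borel X)) : ~ measurable B -> mborel B = 0%E.
Proof. by rewrite /mborel; case: asboolP. Qed.

Definition to_bfmeasure : bfmeasure := BFMeasure mborel_fin mborel_junk.

End restrict_to_borel.

Let mzero_fin (B : set (borel X)) :
  measurable B -> bdd B -> (@mzero _ (borel X) R B < +oo)%E.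
Proof. by rewrite /mzero ltry. Qed.

HB.instance Definition _ := gen_eqMixin bfmeasure.
HB.instance Definition _ := gen_choiceMixin bfmeasure.
HB.instance Definition _ := isPointed.Build bfmeasure (to_bfmeasure mzero_fin).

(* Boundedness is required so that all integrals are finite; it follows from the
   other conditions when K is locally compact. *)
Definition test_fun (f : X -> R) : Prop :=
  [/\ continuous f, (forall z, 0 <= f z), bounded_fun f &
      bdd (closure [set z | f z != 0])].

(* the coarsest topology making mu |-> \int f dmu continuous for each test
   function f *)
HB.instance Definition _ := @isSubBaseTopological.Build bfmeasure
  ((X -> R) * set R)%type
  [set fU | test_fun fU.1 /\ open fU.2]
  (fun fU => [set mu : bfmeasure | fU.2 (\int[bfm mu]_z fU.1 z)]).

Definition shift_pt (y : E) (z : X) : X := (z.1 - y, z.2).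

Lemma continuous_shift_pt y : continuous (shift_pt y).
Proof.
move=> [u k]; rewrite /shift_pt.
have uy : (fun z : X => z.1 - y) @ (u, k) --> u - y.
  by apply: cvgB; [exact: cvg_fst|exact: cvg_cst].
exact: (cvg_pair uy cvg_snd).
Qed.

Lemma measurable_shift_pt y :
  measurable_fun setT (shift_pt y : borel X -> borel X).
Proof.
apply: (@measurability _ _ (borel X) (borel X) setT _ (@open X)) => //.
move=> _ [B oB <-]; rewrite setTI; apply: sub_gen_smallest.
by move/continuousP: (@continuous_shift_pt y); exact.
Qed.

Lemma bdd_shift_pt y B : bdd B -> bdd (shift_pt y @^-1` B).
Proof.
have sK z : shift_pt (- y) (shift_pt y z) = z.
  by case: z => u k; rewrite /shift_pt/= opprK subrK.
case=> Blc Bnlc; split => [/Blc|/Bnlc].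
- move=> [U BU [cU clU]]; exists (shift_pt y @^-1` U).
    by move=> z; exact: BU.
  split; last first.
    by apply: closed_comp clU => z _; exact: continuous_shift_pt.
  rewrite (_ : _ @^-1` U = shift_pt (- y) @` U).
    apply: continuous_compact cU; apply: continuous_subspaceT.
    exact: continuous_shift_pt.
  apply/seteqP; split=> [z Uz|_ [z Uz <-]]; first by exists (shift_pt y z).
  rewrite /= (_ : shift_pt y _ = z)//.
  by case: z {Uz} => u k; rewrite /shift_pt/= opprK addrK.
- move=> [[u k] [r Br]]; exists (u + y, k), r => z /Br[/= + ?].
  rewrite !mx_norm_ball /ball_ /= => zu; split => //=.
  by move: zu; rewrite mx_norm_ball /ball_ /= opprB addrA.
Qed.

Section shift_image.
Variables (y : E) (mu : bfmeasure).

Definition shift_image : set (borel X) -> \bar R :=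
  pushforward mu (shift_pt y : borel X -> borel X).

Let shift_image0 : shift_image set0 = 0%E.
Proof. by rewrite /shift_image /pushforward preimage_set0 measure0. Qed.

Let shift_image_ge0 B : (0 <= shift_image B)%E.
Proof. exact: (measure_ge0 (bfm mu)). Qed.

Let shift_image_sigma_additive : semi_sigma_additive shift_image.
Proof.
have mS (B : set (borel X)) : measurable B ->
    measurable (shift_pt y @^-1` B : set (borel X)).
  by move=> mB; rewrite -[X in measurable X]setTI; exact: measurable_shift_pt.
move=> F mF tF mUF; rewrite /shift_image /pushforward preimage_bigcup.
apply: measure_semi_sigma_additive.
- by move=> n; exact: mS.
- apply/trivIsetP => i j _ _ ij; rewrite -preimage_setI.
  by move/trivIsetP : tF => /(_ _ _ _ _ ij) ->//; rewrite preimage_set0.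
- by rewrite -preimage_bigcup; exact: mS.
Qed.

HB.instance Definition _ := isMeasure.Build _ _ _
  shift_image shift_image0 shift_image_ge0 shift_image_sigma_additive.

Let shift_image_fin (B : set (borel X)) :
  measurable B -> bdd B -> (shift_image B < +oo)%E.
Proof.
move=> mB bB; apply: bfm_fin; last exact: bdd_shift_pt.
by rewrite -[X in measurable X]setTI; exact: measurable_shift_pt.
Qed.

Definition shift : bfmeasure := to_bfmeasure shift_image_fin.

End shift_image.

Local Notation law := (probability (borel bfmeasure) R).

Definition integer_valued (mu : bfmeasure) : Prop :=
  forall B : set (borel X), measurable B -> bdd B ->
    exists n : nat, mu B = n%:R%:E.

(* A random measure enters the statement only through its law, a probability
   measure on the Borel sets of [bfmeasure]. *)
Definition marked_point_process (P : law) : Prop :=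
  {ae P, forall mu : borel bfmeasure, integer_valued mu} /\
  forall B : set (borel E), measurable B -> bounded_set (B : set E) ->
    {ae P, forall mu : borel bfmeasure, ((mu : bfmeasure) (B `*` setT) < +oo)%E}.

Definition stationary (P : law) : Prop :=
  forall (y : E) (A : set (borel bfmeasure)), measurable A ->
    P (shift y @^-1` A) = P A.

Definition Q1 : set E := [set x | forall i, `|x ord0 i| <= 2^-1].

Definition intensity (P : law) : \bar R :=
  (\int[P]_mu (mu : bfmeasure) (Q1 `*` setT))%E.

Definition stationary_mpp_le (lambda0 : R) : set law :=
  [set P | [/\ marked_point_process P, stationary P &
               (intensity P <= lambda0%:E)%E]].

(* The inner integral is that of 1(x \in Q1) 1(S_x mu \in A) against the measure
   mu(dx * K): its integrand does not depend on the mark z.2.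
   For P stationary with intensity in (0, +oo) this formula is a probability
   measure on the Borel sets of [bfmeasure]; no additivity is needed to
   write it down, hence the plain set function. *)
Definition palm (P : law) (A : set (borel bfmeasure)) : \bar R :=
  ((fine (intensity P))^-1%:E *
   \int[P]_mu \int[bfm mu]_z
     (\1_Q1 z.1 * \1_A (shift z.1 mu : borel bfmeasure))%:E)%E.

(* Weak convergence of laws, for the vague topology on [bfmeasure]. It is typed
   for set functions, as the integral of the library is, so as to apply to
   [palm]; only the values on measurable sets matter. *)
Definition cvg_in_law (P_ : nat -> set (borel bfmeasure) -> \bar R)
    (P : set (borel bfmeasure) -> \bar R) : Prop :=
  forall phi : bfmeasure -> R, continuous phi -> bounded_fun phi ->
    (\int[P_ n]_mu (phi mu)%:E)%E @[n --> \oo] --> (\int[P]_mu (phi mu)%:E)%E.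

Definition tight (F : set law) : Prop :=
  forall eps : R, 0 < eps -> exists2 C : set bfmeasure, compact C &
    forall P, F P -> (P (~` C) <= eps%:E)%E.

Definition closed_in_law (F : set law) : Prop :=
  forall (P_ : nat -> law) (P : law),
    (forall n, F (P_ n)) -> cvg_in_law P_ P -> F P.

End vague.

Arguments bfmeasure {R} d K.

(* Main.v *)
(* The finite maxima of rational multiples of tent functions on R^d x K form a
   countable family, from which every lower semicontinuous [f >= 0] is an
   increasing limit. Integrals against these maxima determine the vague topology,
   so that the indicator of an open set of measures is an increasing limit of
   continuous functions. Together with the joint continuity of [(y, mu) |-> S_y mu]
   this makes the functionals below measurable, and those built from open sets
   lower semicontinuous under convergence in law (portmanteau).

   Closedness: the integer-valued measures form a closed set; stationarity is
   tested on open sets of measures; and since stationarity makes the faces of the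
   cube null on average, the intensity is the mean mass of the open cube, a lower
   semicontinuous functional.

   Palm measures: for continuous [0 <= psi <= 1] the means of the integrals of
   [psi (S_x mu)] and [1 - psi (S_x mu)] over the open cube are both lower
   semicontinuous, and their sum is the intensity, which converges.

   Tightness: by Markov's inequality it suffices that the integer-valued measures
   with prescribed bounds on bounded sets form a compact set. Along an ultrafilter
   of such measures every bounded Borel set has an eventually constant mass; the
   least mass of a ball around [x] is the weight of [x] in the limit, which is the
   resulting sum of weighted Dirac measures. *)
Require Import Defs.
From HB Require Import structures.
From mathcomp Require Import all_boot all_order all_algebra.
From mathcomp Require Import all_classical all_reals all_analysis.
From mathcomp Require Import finmap measurable_realfun.
From mathcomp Require Import lra ring.

Set Implicit Arguments.
Unset Strict Implicit.
Unset Printing Implicit Defensive.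

Import Order.TTheory GRing.Theory Num.Theory.
Import numFieldNormedType.Exports.

Local Open Scope classical_set_scope.
Local Open Scope ring_scope.

(** The proof never metrizes the space of measures. Its one analytic tool is that the mean of an
    increasing limit of nonnegative continuous functionals is lower semicontinuous under convergence
    in law, so open sets and lower bounds appear everywhere. An upper bound is obtained as a lower
    bound for a complement: [chi - f] in the vague topology, [1 - psi] for Palm measures.

    The functional [mu |-> \int_Q1 phi (S_x mu) mu(dx)] has two defects: it jumps when atoms cross
    the boundary of the cube, and it is unbounded, so that means can drop in the limit. Stationarity
    removes the first, convergence of the intensities the second.

    Integer values make the compactness argument elementary. The eventual masses of balls along an
    ultrafilter are integers, hence constant for small radii, and the limit can be written down from
    its atoms instead of being represented from a functional. *)

HB.instance Definition _ (T U : ptopologicalType) := Pointed.on (T * U)%type.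

(** * Borel sets and measures *)

Section borel_sets.
Context {R : realType}.

Lemma open_borel (T : ptopologicalType) (A : set (borel T)) :
  open (A : set T) -> measurable A.
Proof. by move=> oA; apply: sub_gen_smallest. Qed.

Lemma closed_borel (T : ptopologicalType) (A : set (borel T)) :
  closed (A : set T) -> measurable A.
Proof.
move=> cA; rewrite -[A]setCK; apply: measurableC.
by apply: open_borel; rewrite openC.
Qed.

(** Open sets are stable under finite intersections, so Dynkin's theorem applies: unions need
    checking for disjoint families only, which is what additivity can handle. *)
Lemma borel_induction (T : ptopologicalType) (P : set T -> Prop) :
  (forall A, open A -> P A) ->
  (forall A : set (borel T), measurable A -> P A -> P (~` A)) ->
  (forall F : (set (borel T))^nat, (forall n, measurable (F n)) ->
     trivIset setT F -> (forall n, P (F n)) -> P (\bigcup_n F n)) ->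
  forall A : set (borel T), measurable A -> P A.
Proof.
move=> Po PC PU A mA.
apply: (@dynkin_induction _ (borel T) (@open T) P) => //.
- by move=> B C; exact: openI.
- by apply: Po; exact: openT.
Qed.

Lemma continuous_borel (T U : ptopologicalType) (f : T -> U) :
  continuous f -> measurable_fun setT (f : borel T -> borel U).
Proof.
move=> /continuousP cf.
apply: (@measurability _ _ (borel T) (borel U) setT _ (@open U)) => //.
by move=> _ [B oB <-]; rewrite setTI; apply: sub_gen_smallest; exact: cf.
Qed.

Lemma continuous_measurable_real (T : ptopologicalType) (f : T -> R) :
  continuous f -> measurable_fun setT (f : borel T -> R).
Proof.
move=> /continuousP cf.
apply: (measurability _ (RGenOpens.measurableE R)).
move=> _ [_ [a [b ->]] <-]; rewrite setTI; apply: sub_gen_smallest.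
by apply: cf; exact: interval_open.
Qed.

Lemma preimage_measurable (d1 d2 : measure_display) (T1 : measurableType d1)
    (T2 : measurableType d2) (f : T1 -> T2) (B : set T2) :
  measurable_fun setT f -> measurable B -> measurable (f @^-1` B).
Proof. by move=> mf mB; rewrite -[X in measurable X]setTI; exact: mf. Qed.

Lemma measurable_indic_preimage (d1 d2 : measure_display) (T1 : measurableType d1)
    (T2 : measurableType d2) (f : T1 -> T2) (B : set T2) :
  measurable_fun setT f -> measurable B ->
  measurable_fun setT (fun x => \1_B (f x) : R).
Proof.
move=> mf mB; apply: (@measurableT_comp _ _ _ _ _ _ (\1_B : T2 -> R)) => //.
Qed.

End borel_sets.

(** * Semicontinuity and monotone convergence for real functions *)

Section real_limits.
Context {R : realType}.

Lemma continuous_maxr (T : topologicalType) (f g : T -> R) :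
  continuous f -> continuous g -> continuous (fun x => Num.max (f x) (g x)).
Proof. by move=> cf cg x; exact: (continuous_max (cf x) (cg x)). Qed.

Lemma continuous_minr (T : topologicalType) (f g : T -> R) :
  continuous f -> continuous g -> continuous (fun x => Num.min (f x) (g x)).
Proof. by move=> cf cg x; exact: (continuous_min (cf x) (cg x)). Qed.

Lemma continuous_mulr (T : topologicalType) (f : T -> R) (c : R) :
  continuous f -> continuous (fun x => c * f x).
Proof. by move=> cf x; apply: cvgM; [exact: cst_continuous|exact: cf]. Qed.

Lemma continuous_subr (T : topologicalType) (f : T -> R) (c : R) :
  continuous f -> continuous (fun x => f x - c).
Proof. by move=> cf x; apply: cvgB; [exact: cf|exact: cst_continuous]. Qed.

Lemma distr_lt_half (a b c e : R) : b <= c + e / 2 -> c <= b + e / 2 ->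
  `|a - c| < e / 2 -> `|a - b| < e.
Proof.
by rewrite !ltr_norml => h1 h2 /andP[h3 h4]; apply/andP; split; lra.
Qed.

Lemma indic01 (T : Type) (A : set T) x : 0 <= (\1_A x : R) <= 1.
Proof. by rewrite indicE; case: (_ \in _); rewrite /= ?lexx ?ler01. Qed.

Lemma continuous_lsc (T : topologicalType) (f : T -> R) (x : T) (e : R) :
  continuous f -> 0 < e -> \forall y \near x, f x - e < f y.
Proof.
move=> cf e0; have /cvgrPdist_lt/(_ e e0) := cf x; apply: filterS => y.
by rewrite ltr_norml => /andP[_]; lra.
Qed.

Lemma nd_cvg_integral (dT : measure_display) (T : measurableType dT)
    (m : {measure set T -> \bar R}) (f_ : nat -> T -> R) (f : T -> R) :
  (forall n, measurable_fun setT (f_ n)) -> (forall n x, 0 <= f_ n x) ->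
  (forall x, {homo f_ ^~ x : a b / (a <= b)%N >-> a <= b}) ->
  (forall x, f_ n x @[n --> \oo] --> f x) ->
  (\int[m]_x (f_ n x)%:E @[n --> \oo] --> \int[m]_x (f x)%:E)%E.
Proof.
move=> mf f0 ndf fx.
have := @cvg_monotone_convergence _ T R m setT measurableT
  (fun n x => (f_ n x)%:E).
set g := (fun x => limn _).
have -> : g = EFin \o f.
  apply/funext => x; apply/cvg_lim => //.
  by apply: cvg_EFin; [exact: nearW|exact: fx].
apply.
- by move=> n; apply/measurable_EFinP; exact: mf.
- by move=> n x _; rewrite lee_fin.
- by move=> x _ a b ab; rewrite lee_fin; exact: ndf.
Qed.

End real_limits.

(** * Image measures with a density, and measurable families of measures *)

Section weighted_integral.
Context {R : realType} (dT dU : measure_display) (T : measurableType dT)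
  (U : measurableType dU) (m : {measure set T -> \bar R}).
Variables (w : T -> R) (p : T -> U).
Hypotheses (mw : measurable_fun setT w) (w0 : forall z, 0 <= w z)
  (mp : measurable_fun setT p).

Lemma measurable_weight (A : set U) : measurable A ->
  measurable_fun setT (fun z => w z * \1_A (p z)).
Proof. by move=> mA; apply: measurable_funM => //; exact: measurable_indic_preimage. Qed.

Lemma weight_ge0 (A : set U) z : 0 <= w z * \1_A (p z).
Proof. by rewrite mulr_ge0// indicE. Qed.

(** As a function of the set, this integral is the image under [p] of the measure with density [w].
    Its additivity is that of the Dirac mass at [p z], integrated in [z]. *)
Lemma weighted_integral_bigcup (F : (set U)^nat) :
  (forall n, measurable (F n)) -> trivIset setT F ->
  (\int[m]_z (w z * \1_(\bigcup_n F n) (p z))%:E =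
   \sum_(n <oo) \int[m]_z (w z * \1_(F n) (p z))%:E)%E.
Proof.
move=> mF tF; rewrite -integral_nneseries//; last 2 first.
- by move=> n; apply/measurable_EFinP; exact: measurable_weight.
- by move=> n z _; rewrite lee_fin weight_ge0.
apply: eq_integral => z _.
transitivity ((w z)%:E * \d_(p z) (\bigcup_n F n))%E.
  by rewrite diracE EFinM indicE.
rewrite measure_semi_bigcup//; last exact: bigcupT_measurable.
by rewrite -nneseriesZl.
Qed.

Lemma weighted_integral_setC (A : set U) : measurable A ->
  (\int[m]_z (w z)%:E = \int[m]_z (w z * \1_A (p z))%:E +
   \int[m]_z (w z * \1_(~` A) (p z))%:E)%E.
Proof.
move=> mA; rewrite -ge0_integralD//; last 4 first.
- by move=> z _; rewrite lee_fin weight_ge0.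
- by apply/measurable_EFinP; exact: measurable_weight.
- by move=> z _; rewrite lee_fin weight_ge0.
- by apply/measurable_EFinP; apply: measurable_weight; exact: measurableC.
apply: eq_integral => z _; rewrite -EFinD -mulrDr !indicE in_setC.
by case: (_ \in _); rewrite /= ?addr0 ?add0r mulr1.
Qed.

End weighted_integral.

(** The Borel sets whose mass is measurable in [s] form a Dynkin class. Finite total mass is what
    allows the mass of a complement to be written as a difference. *)
Lemma measurable_borel_family {R : realType} (dS : measure_display)
    (S : measurableType dS) (T : ptopologicalType) (V : S -> set T -> \bar R) :
  (forall O, open O -> measurable_fun setT (V ^~ O)) ->
  (forall s (A : set (borel T)), measurable A -> (0 <= V s A)%E) ->
  (forall s (A : set (borel T)), measurable A -> V s setT = (V s A + V s (~` A))%E) ->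
  (forall s, (V s setT < +oo)%E) ->
  (forall s (F : (set (borel T))^nat), (forall n, measurable (F n)) ->
     trivIset setT F -> V s (\bigcup_n F n) = (\sum_(n <oo) V s (F n))%E) ->
  forall A : set (borel T), measurable A -> measurable_fun setT (V ^~ A).
Proof.
move=> Vo V0 VC Vfin VU; apply: borel_induction => //.
- move=> A mA VA; rewrite (_ : V ^~ (~` A) = (fun s => V s setT - V s A)%E).
    by apply: emeasurable_funB => //; apply: Vo; exact: openT.
  apply/funext => s; rewrite (VC s A mA) addeAC subee ?add0e//.
  rewrite ge0_fin_numE ?V0//; apply: le_lt_trans (Vfin s).
  by rewrite (VC s A mA) leeDl// V0//; exact: measurableC.
- move=> F mF tF VF; rewrite (_ : V ^~ _ = (fun s => \sum_(n <oo) V s (F n))%E).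
    apply: (@ge0_emeasurable_sum _ _ R setT (fun n s => V s (F n)) xpredT) => //.
    by move=> n s _ _; exact: V0.
  by apply/funext => s; exact: VU.
Qed.

(** * Binary expansion of functions with values in [0, 1] *)

Section binary_expansion.
Context {R : realType}.

(** The part of [f] left after [n] binary digits, rescaled by [2 ^ n]. The remainder 1 reproduces
    itself with digit 1, so the value 1 expands as 0.111... and remainders stay in [0, 1]. *)
Fixpoint binary_rem (T : Type) (f : T -> R) (n : nat) x : R :=
  if n is n'.+1 then
    2 * binary_rem f n' x - (1 <= 2 * binary_rem f n' x)%R%:R
  else f x.

Definition binary_digit (T : Type) (f : T -> R) (n : nat) : set T :=
  [set x | 1 <= 2 * binary_rem f n x].

Section measurable_binary_expansion.
Context (dT : measure_display) (T : measurableType dT) (f : T -> R).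
Hypotheses (mf : measurable_fun setT f) (f01 : forall x, 0 <= f x <= 1).

Lemma binary_rem01 n x : 0 <= binary_rem f n x <= 1.
Proof.
elim: n => //= n /andP[h1 h2].
by case: (leP 1 (2 * binary_rem f n x)) => h /=; apply/andP; split; lra.
Qed.

Lemma measurable_binary_rem n : measurable_fun setT (binary_rem f n).
Proof.
elim: n => //= n ih; apply: measurable_funB; first exact: measurable_funM.
rewrite (_ : (fun x => _) = \1_(binary_digit f n)).
  apply: measurable_indic; rewrite -[binary_digit f n]setTI.
  rewrite (_ : binary_digit f n = (fun x => 2 * binary_rem f n x) @^-1` `[1, +oo[).
    by apply: measurable_funM => //; exact: measurable_itv.
  by apply/seteqP; split=> x; rewrite /binary_digit /= in_itv/= andbT.
apply/funext => x; rewrite indicE; congr (_%:R); congr nat_of_bool.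
by apply/idP/idP => [h|/set_mem//]; exact/mem_set.
Qed.

Lemma measurable_binary_digit n : measurable (binary_digit f n).
Proof.
rewrite (_ : binary_digit f n = (fun x => 2 * binary_rem f n x) @^-1` `[1, +oo[).
  apply: preimage_measurable => //; apply: measurable_funM => //.
  exact: measurable_binary_rem.
by apply/seteqP; split=> x; rewrite /binary_digit /= in_itv/= andbT.
Qed.

Lemma binary_partial n x : f x =
  \sum_(k < n) 2^-1 ^+ k.+1 * \1_(binary_digit f k) x + 2^-1 ^+ n * binary_rem f n x.
Proof.
elim: n => [|n ih]; first by rewrite big_ord0 expr0 mul1r add0r.
rewrite big_ord_recr /= {1}ih -addrA; congr (_ + _).
have -> : \1_(binary_digit f n) x = (1 <= 2 * binary_rem f n x)%R%:R :> R.
  rewrite indicE; congr (_%:R); congr nat_of_bool.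
  by apply/idP/idP => [/set_mem//|h]; exact/mem_set.
by rewrite exprS; field.
Qed.

(** A series of indicators with fixed nonnegative coefficients: it carries identities and
    measurability from sets to functions by countable additivity alone. *)
Lemma binary_series x :
  (f x)%:E = (\sum_(k <oo) (2^-1 ^+ k.+1 * \1_(binary_digit f k) x)%:E)%E.
Proof.
apply/esym/cvg_lim => //.
rewrite (_ : (fun n => _) = EFin \o (fun n =>
    \sum_(k < n) 2^-1 ^+ k.+1 * \1_(binary_digit f k) x)); last first.
  by apply/funext => n /=; rewrite -sumEFin big_mkord.
apply: cvg_EFin; first exact: nearW.
apply/cvgrPdist_le => e e0 /=.
have : (geometric 1 (2^-1 : R)) @ \oo --> 0.
  by apply: cvg_geometric; rewrite gtr0_norm ?invf_lt1 ?ltr1n.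
move/cvgrPdist_le => /(_ e e0); apply: filterS => n.
rewrite /geometric /= mul1r sub0r normrN ger0_norm ?exprn_ge0 ?invr_ge0//.
apply: le_trans; rewrite {1}(binary_partial n x) addrAC subrr add0r.
have /andP[h1 h2] := binary_rem01 n x.
by rewrite ger0_norm ?mulr_ge0 ?exprn_ge0 ?invr_ge0// ler_piMr ?exprn_ge0 ?invr_ge0.
Qed.

End measurable_binary_expansion.
End binary_expansion.

Section measure_bounds.
Context {R : realType} (dT : measure_display) (T : measurableType dT).
Variable m : {measure set T -> \bar R}.

Lemma le_measure_seq (I : eqType) (s : seq I) (F : I -> set T) (A : set T) :
  measurable A -> (forall i, measurable (F i)) ->
  (forall x, A x -> exists2 i, i \in s & F i x) ->
  (m A <= \sum_(i <- s) m (F i))%E.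
Proof.
move=> mA mF; elim: s A mA => [|i s ih] A mA As.
  rewrite big_nil (_ : A = set0) ?measure0//.
  by apply/seteqP; split=> // x /As[].
rewrite big_cons; apply: (@le_trans _ _ (m (F i) + m (A `\` F i))%E).
  apply: le_trans (measureU2 _ _ _) => //; last exact: measurableD.
  apply: le_measure; try apply/mem_set => //.
    by apply: measurableU => //; exact: measurableD.
  by move=> x Ax; have [|] := pselect (F i x); [left|right].
rewrite leeD2l//; apply: ih; first exact: measurableD.
move=> x [/As[j]]; rewrite in_cons => /orP[/eqP -> //|js Fjx _].
by exists j.
Qed.

(** If [m A] were positive, more than [m S / m A] of the copies would already outweigh [S]. *)
Lemma null_of_disjoint_copies (F : (set T)^nat) (S A : set T) :
  measurable S -> (m S < +oo)%E -> (forall n, measurable (F n)) ->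
  trivIset setT F -> (forall n, F n `<=` S) -> (forall n, m (F n) = m A) ->
  m A = 0%E.
Proof.
move=> mS Soo mF tF FS mFA; apply/eqP/negPn/negP => mA0.
have mA_gt0 : (0 < m A)%E by rewrite lt0e mA0 -(mFA 0) measure_ge0.
have SfinN : m S \is a fin_num by rewrite ge0_fin_numE.
have bnd n : (\sum_(0 <= i < n) m (F i) <= m S)%E.
  apply: le_trans (nneseries_lim_ge _ _) _ => //.
  rewrite -measure_semi_bigcup//; last exact: bigcupT_measurable.
  apply: le_measure; try apply/mem_set => //; first exact: bigcupT_measurable.
  by apply: bigcup_sub => i _.
have mAfin : m A \is a fin_num.
  rewrite ge0_fin_numE//; apply: le_lt_trans Soo.
  by rewrite -(mFA 0); apply: le_measure; try exact/mem_set.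
have [a a0 mAa] : exists2 a : R, 0 < a & m A = a%:E.
  by exists (fine (m A)); [apply: fine_gt0; rewrite mA_gt0 ltey_eq mAfin|rewrite fineK].
have := bnd (Num.truncn (fine (m S) / a)).+1.
under eq_bigr do rewrite mFA mAa.
rewrite sumEFin big_const_nat iter_addr_0 subn0.
by rewrite -(fineK SfinN) lee_fin -mulr_natr leNgt mulrC -ltr_pdivrMr// truncnS_gt.
Qed.

End measure_bounds.

(** * The vague topology *)

Section vague_topology.
Context {R : realType} {d : nat} {K : completeMetricType R}.

Local Notation E := 'rV[R]_d.
Local Notation X := ('rV[R]_d * K)%type.
Local Notation M := (bfmeasure d K).
Implicit Types (f g : X -> R) (mu : M).

Lemma bdd_subset (A B : set X) : A `<=` B -> bdd B -> bdd A.
Proof.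
move=> AB [Blc Bnlc]; split.
  by move=> /Blc; exact: precompact_subset.
by move=> /Bnlc[z [r Br]]; exists z, r; exact: subset_trans Br.
Qed.

Lemma measurable_test f : test_fun f -> measurable_fun setT (f : borel X -> R).
Proof. by case=> cf _ _ _; exact: continuous_measurable_real. Qed.

Lemma test_fun_bound f : test_fun f ->
  exists2 N : R, 0 < N & forall z, f z <= N.
Proof.
case=> _ _ [N [Nr fN]] _; exists (`|N| + 1); first by rewrite ltr_wpDl.
move=> z; apply: le_trans (ler_norm _) _; apply: (fN (`|N| + 1)) => //.
by rewrite (le_lt_trans (ler_norm N))// ltrDl.
Qed.

Lemma test_int_lty f mu : test_fun f -> (\int[mu]_z (f z)%:E < +oo)%E.
Proof.
move=> tf; have [N N0 fN] := test_fun_bound tf.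
have [cf f0 _ bf] := tf.
set S := closure [set z | f z != 0] in bf.
have mS : measurable (S : set (borel X)).
  by apply: closed_borel; exact: closed_closure.
apply: (@le_lt_trans _ _ (\int[mu]_z (N * \1_S z)%:E)%E).
  apply: ge0_le_integral => //=.
  - by move=> z _; rewrite lee_fin.
  - by apply/measurable_EFinP; exact: measurable_test.
  - by apply/measurable_EFinP; apply: measurable_funM.
  - move=> z _; rewrite lee_fin indicE; have [->|fz] := eqVneq (f z) 0.
      by rewrite mulr_ge0// ltW.
    by rewrite mem_set ?mulr1//; apply: subset_closure.
under eq_integral do rewrite EFinM.
rewrite ge0_integralZl ?lee_fin ?(ltW N0)//; last first.
  by apply/measurable_EFinP; exact: measurable_indic.
rewrite integral_indic// setIT.
by rewrite lte_mul_pinfty ?lee_fin ?(ltW N0)//; exact: bfm_fin.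
Qed.

Lemma test_intE f mu : test_fun f ->
  (\int[mu]_z (f z)%:E = (\int[mu]_z f z)%:E)%E.
Proof.
move=> tf; rewrite /Rintegral fineK// ge0_fin_numE ?test_int_lty//.
by apply: integral_ge0 => z _; rewrite lee_fin; have [_ + _ _] := tf; exact.
Qed.

Lemma test_Rint_ge0 f mu : test_fun f -> 0 <= \int[mu]_z f z.
Proof. by case=> _ f0 _ _; apply: Rintegral_ge0. Qed.

Lemma test_Rint_le f g mu : test_fun f -> test_fun g ->
  (forall z, f z <= g z) -> \int[mu]_z f z <= \int[mu]_z g z.
Proof.
move=> tf tg fg; rewrite -lee_fin -!test_intE//; apply: ge0_le_integral => //=.
- by move=> z _; rewrite lee_fin; have [_ + _ _] := tf; exact.
- by apply/measurable_EFinP; exact: measurable_test.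
- by apply/measurable_EFinP; exact: measurable_test.
- by move=> z _; rewrite lee_fin.
Qed.

Lemma test_RintD f g mu : test_fun f -> test_fun g ->
  \int[mu]_z (f z + g z) = \int[mu]_z f z + \int[mu]_z g z.
Proof.
move=> tf tg; rewrite /Rintegral.
under eq_integral do rewrite EFinD.
rewrite ge0_integralD//=.
- by rewrite !test_intE//.
- by move=> z _; rewrite lee_fin; have [_ + _ _] := tf; exact.
- by apply/measurable_EFinP; exact: measurable_test.
- by move=> z _; rewrite lee_fin; have [_ + _ _] := tg; exact.
- by apply/measurable_EFinP; exact: measurable_test.
Qed.

Lemma test_RintZ f mu (c : R) : 0 <= c -> test_fun f ->
  \int[mu]_z (c * f z) = c * \int[mu]_z f z.
Proof.
move=> c0 tf; rewrite /Rintegral.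
under eq_integral do rewrite EFinM.
rewrite ge0_integralZl//=.
- by rewrite !test_intE.
- by apply/measurable_EFinP; exact: measurable_test.
- by move=> z _; rewrite lee_fin; have [_ + _ _] := tf; exact.
Qed.

(** Boundedness and bounded support are inherited from a dominating test function, so that only
    continuity and sign remain to be checked. *)
Lemma test_fun_le f g : continuous f -> (forall z, 0 <= f z) ->
  (forall z, f z <= g z) -> test_fun g -> test_fun f.
Proof.
move=> cf f0 fg tg; have [N N0 gN] := test_fun_bound tg; case: tg => cg g0 bg sg.
split => //.
  exists N; split; first exact: num_real.
  move=> x Nx z _ /=; rewrite ger0_norm//.
  by rewrite (le_trans (fg z))// (le_trans (gN z))// ltW.
apply: bdd_subset sg; apply: closureS => z /= fz0.
by rewrite gt_eqF// (lt_le_trans _ (fg z))// lt_neqAle eq_sym fz0 f0.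
Qed.

Lemma test_funZ f (c : R) : 0 <= c -> test_fun f -> test_fun (fun z => c * f z).
Proof.
move=> c0 tf; have [N N0 fN] := test_fun_bound tf; have [cf f0 bf sf] := tf.
split => //.
- by move=> z; apply: cvgM; [exact: cvg_cst|exact: cf].
- by move=> z; rewrite mulr_ge0.
- exists (c * N); split; first exact: num_real.
  move=> x Nx z _ /=; rewrite ger0_norm ?mulr_ge0//.
  by rewrite (le_trans _ (ltW Nx))// ler_wpM2l.
- apply: bdd_subset sf; apply: closureS => z /=.
  by apply: contra_neq => ->; rewrite mulr0.
Qed.

Lemma test_funB f g : test_fun f -> test_fun g -> (forall z, g z <= f z) ->
  test_fun (fun z => f z - g z).
Proof.
move=> tf tg gf; have [cf f0 bf sf] := tf; have [cg g0 bg sg] := tg.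
apply: (@test_fun_le _ f) => //.
- by move=> z; apply: cvgB; [exact: cf|exact: cg].
- by move=> z; rewrite subr_ge0.
- by move=> z; rewrite lerBlDr lerDl.
Qed.

Lemma test_fun0 : test_fun ((fun=> 0) : X -> R).
Proof.
split => //.
- by move=> z; exact: cvg_cst.
- exists 0; split => // x x0 z _ /=; rewrite normr0; exact: ltW.
- rewrite (_ : [set _ | _] = set0) ?closure0.
    split => _; last by exists point, 1; exact: sub0set.
    by exists set0 => //; split; [exact: compact0|exact: closed0].
  by apply/seteqP; split => // z /=; rewrite eqxx.
Qed.

(** Kept general in the filter, since it serves neighbourhood filters, their images and
    ultrafilters. The converse unfolds a basic open set into a finite intersection of subbasic
    ones. *)
Lemma cvg_vagueP (F : set_system M) mu : Filter F ->
  F --> mu <->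
  forall f, test_fun f -> (\int[bfm nu]_z f z) @[nu --> F] --> \int[mu]_z f z.
Proof.
move=> FF; split=> [Fmu f tf|Fmu].
  move=> A; rewrite (nbhsE _) => -[B [oB Bmu] BA].
  apply: (filterS BA); apply: Fmu; rewrite nbhsE.
  exists [set nu : M | B (\int[bfm nu]_z f z)] => //; split => //.
  exists [set [set nu : M | B (\int[bfm nu]_z f z)]]; last first.
    by apply/seteqP; split=> [nu [_ ->]|nu ?]//; eexists.
  move=> _ ->; exists [fset (f, B)]%fset.
    by move=> p; rewrite /= in_fset1 => /eqP ->; apply/mem_set; split.
  apply/seteqP; split=> [nu /(_ (f, B))|nu Bnu p /=]; first by apply; rewrite /= in_fset1.
  by rewrite in_fset1 => /eqP ->.
move=> A; rewrite nbhsE => -[_ [[B sB <-] [C BC Cmu] sUBA]].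
rewrite nbhs_filterE; apply: filterS sUBA _; apply: (@filterS _ _ _ C).
  by move=> ? ?; exists C.
have /sB [D sD IDeC] := BC; rewrite -IDeC; apply: filter_bigI => -[f U] DfU.
have /set_mem[/= tf oU] := sD _ DfU.
apply: (Fmu f tf); apply: open_nbhs_nbhs; split => //.
by move: Cmu; rewrite -IDeC => /(_ _ DfU).
Qed.

Lemma continuous_test_int f : test_fun f ->
  continuous (fun mu : M => \int[mu]_z f z).
Proof. by move=> tf mu; move: f tf; apply/(@cvg_vagueP (nbhs mu)). Qed.

End vague_topology.

(** * The sup metric of the product and rational tents *)

Section product_distance.
Context {R : realType} {d : nat} {K : completeMetricType R}.

Local Notation E := 'rV[R]_d.
Local Notation X := ('rV[R]_d * K)%type.
Implicit Types z w : X.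

Definition pdist z w : R := Num.max `|z.1 - w.1| (mdist z.2 w.2).

Lemma pball z (r : R) : ball z r = [set w | pdist z w < r].
Proof.
apply/seteqP; split=> w; rewrite /ball/= /prod_ball /pdist mx_norm_ball /ball_ /=.
  by rewrite ballEmdist /= gt_max => -[-> ->].
by rewrite ballEmdist /= gt_max => /andP[].
Qed.

Lemma pdist_ge0 z w : 0 <= pdist z w.
Proof. by rewrite le_max normr_ge0. Qed.

Lemma pdistzz z : pdist z z = 0.
Proof. by rewrite /pdist subrr normr0 mdistxx maxxx. Qed.

Lemma pdist_sym z w : pdist z w = pdist w z.
Proof. by rewrite /pdist distrC metric_sym. Qed.

Lemma pdist_triangle w z v : pdist z v <= pdist z w + pdist w v.
Proof.
rewrite ge_max; apply/andP; split.
  rewrite (le_trans (ler_distD w.1 _ _))// lerD// le_max lexx//.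
by rewrite (le_trans (metric_triangle z.2 w.2 v.2))// lerD// le_max lexx orbT.
Qed.

Lemma pdist_neq z w : z <> w -> 0 < pdist z w.
Proof.
move=> zw; rewrite lt_neqAle pdist_ge0 andbT eq_sym; apply/eqP => zw0; apply: zw.
have /andP[/eqP h1 /eqP h2] : (`|z.1 - w.1| == 0) && (mdist z.2 w.2 == 0).
  have := lexx (0 : R); rewrite -{1}zw0 /pdist ge_max => /andP[h1 h2].
  by rewrite !eq_le h1 h2 normr_ge0 mdist_ge0.
case: z w h1 h2 {zw0} => [z1 z2] [w1 w2] /= /normr0_eq0/eqP.
by rewrite subr_eq0 => /eqP -> /mdist_positivity ->.
Qed.

Lemma nbhs_pdist z (A : set X) : nbhs z A <->
  exists2 r : R, 0 < r & forall w, pdist z w < r -> A w.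
Proof.
split=> [/nbhs_ballP[r /= r0 zA]|[r r0 zA]].
  by exists r => // w zw; apply: zA; rewrite pball.
by apply/nbhs_ballP; exists r => //= w; rewrite pball; exact: zA.
Qed.

Lemma open_pball z (r : R) : open [set w | pdist z w < r].
Proof.
rewrite openE => w /= zw; apply/nbhs_pdist; exists (r - pdist z w).
  by rewrite subr_gt0.
move=> v; rewrite ltrBrDl; apply: le_lt_trans; exact: pdist_triangle.
Qed.

(** The one-sided bound suffices because [z] and [w] can be exchanged. *)
Lemma lipschitz_continuous (f : X -> R) (L : R) :
  (forall z w, f z <= f w + L * pdist z w) -> continuous f.
Proof.
move=> fL z; apply/cvgrPdist_lt => e e0.
have L0 : 0 < `|L| + 1 by rewrite ltr_wpDl.
apply/nbhs_pdist; exists (e / (`|L| + 1)); first by rewrite divr_gt0.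
move=> w; rewrite ltr_pdivlMr// => zw.
have Lzw : L * pdist z w < e.
  apply: le_lt_trans zw; rewrite mulrC ler_wpM2l ?pdist_ge0//.
  by rewrite (le_trans (ler_norm _))// lerDl.
rewrite ltr_norml; apply/andP; split.
  by have := fL w z; rewrite pdist_sym; lra.
by have := fL z w; lra.
Qed.

Variable x_ : nat -> X.

(** The index [(n, a, b)] gives the centre [x_ n], the height [a] and the slope [|b|]. The absolute
    value and the maximum with 0 make every index admissible, so that the countable type of indices
    can be used as it stands. *)
Definition tent (i : nat * rat * rat) z : R :=
  Num.max 0 (ratr i.1.2 - `|ratr i.2| * pdist (x_ i.1.1) z).

Definition tents (s : seq (nat * rat * rat)) z : R :=
  \big[Num.max/0]_(i <- s) tent i z.

Lemma tents_nil z : tents [::] z = 0.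
Proof. by rewrite /tents big_nil. Qed.

Lemma tents_cons i s z : tents (i :: s) z = Num.max (tent i z) (tents s z).
Proof. by rewrite /tents big_cons. Qed.

Lemma tents_ge0 s z : 0 <= tents s z.
Proof.
elim: s => [|i s ih]; first by rewrite tents_nil.
by rewrite tents_cons le_max ih orbT.
Qed.

Lemma tents_cat s t z : tents (s ++ t) z = Num.max (tents s z) (tents t z).
Proof.
elim: s => [|i s ih]; first by rewrite tents_nil/= max_r// tents_ge0.
by rewrite /= !tents_cons ih maxA.
Qed.

Lemma tents1 i z : tents [:: i] z = tent i z.
Proof. by rewrite tents_cons tents_nil max_l// le_max lexx. Qed.

Lemma tents_lipschitz s : exists2 L : R, 0 <= L &
  forall z w, tents s z <= tents s w + L * pdist z w.
Proof.
elim: s => [|[[n a] b] s [L L0 ih]].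
  by exists 0 => // z w; rewrite !tents_nil mul0r addr0.
set b' : R := `|ratr b|.
have b'0 : 0 <= b' := normr_ge0 _.
exists (L + b'); first exact: addr_ge0.
move=> z w; rewrite !tents_cons.
have zw0 := pdist_ge0 z w.
have bzw0 : 0 <= b' * pdist z w by rewrite mulr_ge0.
have Lzw0 : 0 <= L * pdist z w by rewrite mulr_ge0.
rewrite mulrDl ge_max; apply/andP; split.
  have : tent (n, a, b) w <= Num.max (tent (n, a, b) w) (tents s w).
    by rewrite le_max lexx.
  suff : tent (n, a, b) z <= tent (n, a, b) w + b' * pdist z w by lra.
  rewrite /tent/= -/b' ge_max; apply/andP; split.
    by rewrite addr_ge0// le_max lexx.
  have : ratr a - b' * pdist (x_ n) w <=
      Num.max 0 (ratr a - b' * pdist (x_ n) w) by rewrite le_max lexx orbT.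
  have : b' * pdist (x_ n) w <= b' * (pdist (x_ n) z + pdist z w).
    by rewrite ler_wpM2l//; exact: pdist_triangle.
  rewrite mulrDr; lra.
have : tents s w <= Num.max (tent (n, a, b) w) (tents s w).
  by rewrite le_max lexx orbT.
by have := ih z w; lra.
Qed.

Lemma continuous_tents s : continuous (tents s).
Proof.
by have [L _ sL] := tents_lipschitz s; exact: lipschitz_continuous sL.
Qed.

Hypothesis x_dense : forall z (e : R), 0 < e -> exists n, pdist z (x_ n) < e.

Lemma ratr_between (a b : R) : a < b -> exists q : rat, a < ratr q < b.
Proof.
move=> ab; have := @dense_rat R `]a, b[%classic.
case=> [||r [/= + [q _ qr]]].
- by exists ((a + b) / 2); rewrite /= in_itv/=; apply/andP; split; lra.
- exact: interval_open.
by rewrite in_itv/= -qr => ab'; exists q.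
Qed.

(** On a ball of radius [r] around [z], [f] exceeds [f z - e / 2]. With a height [a] below this
    value and a slope [b] above [2 * a / r], the tent vanishes at distance [r / 2] from its centre.
    A centre within [r / 2] of [z] keeps it inside the ball, and one within [e / (4 * b)] costs at
    most [e / 4] at [z], on top of the [3 / 4 * e] conceded by the height. *)
Lemma tent_approx (f : X -> R) z (e : R) : 0 < e -> (forall w, 0 <= f w) ->
  (\forall w \near z, f z - e / 2 < f w) ->
  exists s, (forall w, tents s w <= f w) /\ f z - e < tents s z.
Proof.
move=> e0 f0 /nbhs_pdist[r r0 zf].
(* If [f z < e] the zero function serves; from then on [e <= f z], which makes the height [a]
   positive. *)
have [fze|fze] := ltP (f z) e.
  by exists [::]; split => [w|]; rewrite tents_nil// subr_lt0.
have [a /andP[az za]] : exists a : rat, f z - 3 / 4 * e < ratr a < f z - e / 2.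
  by apply: ratr_between; lra.
have a0 : 0 < ratr a :> R by lra.
have [b /andP[ab _]] : exists b : rat,
    2 * ratr a / r < ratr b < 2 * ratr a / r + 1 by apply: ratr_between; lra.
have b0 : 0 < ratr b :> R.
  by apply: lt_trans ab; rewrite divr_gt0// mulr_gt0.
have [n zn] : exists n, pdist z (x_ n) < Num.min (r / 2) (e / (4 * ratr b)).
  apply: x_dense; rewrite lt_min !divr_gt0//.
  by rewrite mulr_gt0.
exists [:: (n, a, b)]; split=> [w|]; rewrite tents1 /tent/= gtr0_norm//.
  rewrite ge_max f0/=.
  have [nw|nw] := lerP (r / 2) (pdist (x_ n) w).
    apply: le_trans (f0 w); rewrite subr_le0.
    apply: (@le_trans _ _ (ratr b * (r / 2))); last by rewrite ler_wpM2l// ltW.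
    by move: ab; rewrite ltr_pdivrMr//; lra.
  have zw : pdist z w < r.
    have := pdist_triangle (x_ n) z w.
    by move: zn; rewrite lt_min => /andP[]; lra.
  have bw0 : 0 <= ratr b * pdist (x_ n) w by rewrite mulr_ge0 ?pdist_ge0// ltW.
  by have := zf w zw; lra.
rewrite lt_max; apply/orP; right.
move: zn; rewrite lt_min pdist_sym => /andP[_].
rewrite invfM mulrA ltr_pdivlMr// => nz.
have -> : ratr b * pdist (x_ n) z = pdist (x_ n) z * ratr b by rewrite mulrC.
lra.
Qed.

(** Reads [n] as the code of a finite maximum of tents; a code that is invalid or not below [f]
    yields the empty maximum. Concatenating the first [n] lists, as [below] does, makes the sequence
    increasing. *)
Definition nth_below (f : X -> R) (n : nat) : seq (nat * rat * rat) :=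
  oapp (fun s => if `[< forall w, tents s w <= f w >] then s else [::]) [::]
    (choice.unpickle n).

Definition below (f : X -> R) (n : nat) : seq (nat * rat * rat) :=
  flatten [seq nth_below f i | i <- iota 0 n].

Lemma belowS (f : X -> R) n : below f n.+1 = below f n ++ nth_below f n.
Proof. by rewrite /below -addn1 iotaD map_cat flatten_cat /= cats0. Qed.

Lemma below_le (f : X -> R) n w : 0 <= f w -> tents (below f n) w <= f w.
Proof.
move=> f0; elim: n => [|n ih]; first by rewrite tents_nil.
rewrite belowS tents_cat ge_max ih /nth_below.
case: choice.unpickle => [s|/=]; last by rewrite tents_nil.
by rewrite /=; case: asboolP => // _; rewrite tents_nil.
Qed.

Lemma below_nd (f : X -> R) z :
  {homo (fun n => tents (below f n) z) : m n / (m <= n)%N >-> m <= n}.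
Proof.
apply/nondecreasing_seqP => n /=.
by rewrite belowS tents_cat le_max lexx.
Qed.

Lemma below_ge (f : X -> R) s z : (forall w, tents s w <= f w) ->
  tents s z <= tents (below f (choice.pickle s).+1) z.
Proof.
move=> sf; rewrite belowS tents_cat le_max /nth_below choice.pickleK /=.
by case: asboolP => // _; rewrite lexx orbT.
Qed.

(* Baire's theorem on lower semicontinuous functions. *)
Lemma below_cvg (f : X -> R) z : (forall w, 0 <= f w) ->
  (forall e : R, 0 < e -> \forall w \near z, f z - e < f w) ->
  tents (below f n) z @[n --> \oo] --> f z.
Proof.
move=> f0 lf; apply/cvgrPdist_lt => e e0.
have [|s [sf zs]] := @tent_approx f z e e0 f0; first by apply: lf; rewrite divr_gt0.
exists (choice.pickle s).+1 => // n /= sn.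
have h1 := below_ge z sf; have h2 := below_nd f z sn.
have h3 := @below_le f n z (f0 z).
by rewrite ltr_norml; apply/andP; split; lra.
Qed.

End product_distance.

(** * Bounded sets and a dense sequence *)

Section bounded_sets.
Context {R : realType} {d : nat} {K : completeMetricType R}.

Local Notation E := 'rV[R]_d.
Local Notation X := ('rV[R]_d * K)%type.

Lemma closedX (T U : topologicalType) (A : set T) (B : set U) :
  closed A -> closed B -> closed (A `*` B).
Proof.
move=> cA cB; rewrite (_ : A `*` B = fst @^-1` A `&` snd @^-1` B)//.
by apply: closedI; apply: closed_comp => // z _; [exact: cvg_fst|exact: cvg_snd].
Qed.

Lemma rV_closed_ball_compact (r : R) : compact [set x : E | `|x| <= r].
Proof.
apply: bounded_closed_compact.
  exists r; split; first exact: num_real.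
  by move=> s rs x /= xr; apply: le_trans xr (ltW rs).
rewrite (_ : [set _ | _] = (fun x : E => `|x|) @^-1` [set y | y <= r])//.
apply: closed_comp; last exact: closed_le.
by move=> x _; exact: norm_continuous.
Qed.

(** Shifts move positions and keep marks; a set of this form contains the support of a test function
    after every shift from a bounded set. *)
Lemma bdd_setX (A : set X) (B : set E) : bdd A -> bounded_set B ->
  bdd (B `*` (snd @` A)).
Proof.
move=> [Alc Anlc] [N [Nr NB]].
(* [bounded_set] gives a bound by every real above [N], whence the recurrent [N + 1]. *)
have {}NB x : B x -> `|x| <= N + 1 by apply: NB; rewrite ltrDl.
split=> [/Alc[U AU [cU clU]]|/Anlc[z [r zA]]].
- exists ([set x : E | `|x| <= N + 1] `*` (snd @` U)).
    by move=> [x k] /= [/NB ? [w /AU Uw <-]]; split => //; exists w.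
  have csU : compact (snd @` U).
    apply: continuous_compact cU; apply: continuous_subspaceT => w.
    exact: cvg_snd.
  split; first by apply: compact_setX => //; exact: rV_closed_ball_compact.
  apply: closedX; last by apply: compact_closed => //; exact: metric_hausdorff.
  by apply: compact_closed => //; exact: rV_closed_ball_compact.
- exists (0, z.2), (Num.max r (N + 2)) => -[x k] /= [/NB xN [w /zA]].
  rewrite !pball /= /pdist /= !gt_max !lt_max => /andP[_ zw] <-.
  rewrite zw/= andbT; apply/orP; right.
  by rewrite sub0r normrN; apply: le_lt_trans xN _; rewrite ltrD2l ltr1n.
Qed.

Lemma bdd_fst (A : set X) : bdd A -> bounded_set (fst @` A).
Proof.
move=> [Alc Anlc].
have [/Alc[U AU [cU _]]|/Anlc[z [r zA]]] := pselect (locally_compact [set: K]).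
  have [N [Nr NU]] : bounded_set (fst @` U).
    apply: compact_bounded; apply: continuous_compact cU.
    by apply: continuous_subspaceT => w; exact: cvg_fst.
  by exists N; split => // r /NU + _ [w /AU Uw <-]; apply; exists w.
exists (`|z.1| + r); split; first exact: num_real.
move=> s zs _ [w /zA + <-]; rewrite pball /= /pdist gt_max => /andP[zw _].
rewrite (le_trans _ (ltW zs))//.
have := ler_normB z.1 (z.1 - w.1); rewrite opprB addrCA subrr addr0.
by move/le_trans; apply; rewrite lerD2l ltW.
Qed.

Lemma test_fun_pball z (r : R) : 0 < r ->
  bdd [set w : X | pdist z w <= r] ->
  test_fun (fun w => Num.max 0 (r - pdist z w)).
Proof.
move=> r0 zr; split => //.
- apply: (@lipschitz_continuous _ _ _ _ 1) => u v; rewrite mul1r.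
  rewrite ge_max; apply/andP; split.
    by rewrite addr_ge0 ?pdist_ge0// le_max lexx.
  have := pdist_triangle u z v; have : r - pdist z v <= Num.max 0 (r - pdist z v).
    by rewrite le_max lexx orbT.
  by rewrite (pdist_sym u v); have := pdist_triangle u z v; have := pdist_triangle v z u;
    rewrite (pdist_sym v u); lra.
- by move=> w; rewrite le_max lexx.
- exists r; split; first exact: num_real.
  move=> s rs w _ /=; rewrite ger0_norm ?le_max ?lexx// (le_trans _ (ltW rs))//.
  by rewrite ge_max (ltW r0)/= gerBl pdist_ge0.
- apply: bdd_subset zr.
  have cz : closed [set w : X | pdist z w <= r].
    rewrite (_ : [set _ | _] = pdist z @^-1` [set y | y <= r])//.
    apply: closed_comp; last exact: closed_le.
    move=> w _; apply: (@lipschitz_continuous _ _ _ _ 1) => u v.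
    by rewrite mul1r (pdist_sym u); exact: pdist_triangle.
  rewrite [X in _ `<=` X](_ : _ = closure [set w : X | pdist z w <= r]); last first.
    by apply/closure_id.
  apply: closureS => w /= ; rewrite -subr_ge0; apply: contra_neqT.
  by rewrite -ltNge => rw; rewrite max_l// ltW.
Qed.

Lemma locally_compact_bdd z : locally_compact [set: K] ->
  exists2 r : R, 0 < r & bdd [set w : X | pdist z w <= r].
Proof.
move=> lcK; have := lcK z.2 I; rewrite withinET => -[V + [cV clV]].
move=> /nbhs_ballP[r /= r0 zV].
(* Half the radius turns the open ball inside [V] into a closed one. *)
exists (r / 2); first by rewrite divr_gt0.
split => // _; exists ([set x : E | `|x| <= `|z.1| + r] `*` V); last first.
  split; first by apply: compact_setX => //; exact: rV_closed_ball_compact.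
  apply: closedX => //.
  by apply: compact_closed => //; exact: rV_closed_ball_compact.
move=> [x k]; rewrite /= /pdist/= ge_max => /andP[zx zk]; split.
  have := ler_normB z.1 (z.1 - x); rewrite opprB addrCA subrr addr0.
  by move/le_trans; apply; rewrite lerD2l (le_trans zx)// ger_pMr// invf_le1// ler1n.
by apply: zV; rewrite ballEmdist /= (le_lt_trans zk)// gtr_pMr// invf_lt1// ltr1n.
Qed.

Lemma open_mball (k : K) (r : R) : open (ball k r).
Proof.
rewrite openE => l; rewrite ballEmdist /= => kl; apply/nbhs_ballP.
exists (r - mdist k l) => /=; first by rewrite subr_gt0.
move=> m; rewrite !ballEmdist /= ltrBrDl; apply: le_lt_trans.
exact: metric_triangle.
Qed.

Lemma dense_sequence : separable K ->
  exists x_ : nat -> X, forall z (e : R), 0 < e -> exists n, pdist z (x_ n) < e.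
Proof.
move=> [D /countable_injP[f injf] dD].
(* [g] inverts the injection of [D] into the integers; off its range [get] returns a default point,
   which does not affect density. *)
pose g (m : nat) : K := get [set k | D k /\ f k = m].
have gK k : D k -> g (f k) = k.
  move=> Dk; have [Dg fg] : [set k' | D k' /\ f k' = f k] (g (f k)).
    by apply: getPex; exists k.
  by apply: injf => //; exact/mem_set.
pose y_ (p : 'rV[rat]_d * nat) : X := (map_mx ratr p.1, g p.2).
exists (fun n => oapp y_ point (choice.unpickle n)) => z e e0.
have /choice[q qz] : forall i : 'I_d, exists q : rat,
    z.1 ord0 i - e < ratr q < z.1 ord0 i + e.
  by move=> i; apply: ratr_between; lra.
have [k [zk Dk]] : ball z.2 e `&` D !=set0.
  apply: dD; last by exact: open_mball.
  by exists z.2; exact: ballxx.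
exists (choice.pickle (\row_i q i : 'rV[rat]_d, f k)).
rewrite choice.pickleK /= /y_ /= gK// /pdist gt_max; apply/andP; split => /=.
  suff : ball z.1 e (map_mx ratr (\row_i q i)) by rewrite mx_norm_ball.
  split=> // i j; rewrite (ord1 i) !mxE; have /andP[h1 h2] := qz j.
  by rewrite /ball/= ltr_norml; apply/andP; split; lra.
by move: zk; rewrite ballEmdist.
Qed.

End bounded_sets.

(** * A countable base of the vague topology *)

Section vague_base.
Context {R : realType} {d : nat} {K : completeMetricType R}.

Local Notation E := 'rV[R]_d.
Local Notation X := ('rV[R]_d * K)%type.
Local Notation M := (bfmeasure d K).
Implicit Types (f g : X -> R) (mu nu : M).

Lemma bddU (A B : set X) : bdd A -> bdd B -> bdd (A `|` B).
Proof.
move=> [Alc Anlc] [Blc Bnlc]; split => lcK.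
  have [U AU [cU clU]] := Alc lcK; have [V BV [cV clV]] := Blc lcK.
  exists (U `|` V); last by split; [exact: compactU|exact: closedU].
  by move=> z [/AU|/BV]; [left|right].
have [z [r zA]] := Anlc lcK; have [w [s wB]] := Bnlc lcK.
exists z, (Num.max r (pdist z w + s)) => v; rewrite pball /= lt_max.
case=> [/zA|/wB]; rewrite pball /= => h; apply/orP; [by left|right].
by apply: (le_lt_trans (pdist_triangle w _ _)); rewrite ltrD2l.
Qed.

Lemma test_funD f g : test_fun f -> test_fun g -> test_fun (fun z => f z + g z).
Proof.
move=> tf tg; have [N N0 fN] := test_fun_bound tf.
have [L L0 gL] := test_fun_bound tg.
have [cf f0 bf sf] := tf; have [cg g0 bg sg] := tg; split.
- by move=> z; apply: cvgD; [exact: cf|exact: cg].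
- by move=> z; rewrite addr_ge0.
- exists (N + L); split; first exact: num_real.
  move=> x Nx z _ /=; rewrite ger0_norm ?addr_ge0// (le_trans _ (ltW Nx))//.
  by rewrite lerD.
- apply: bdd_subset (bddU sf sg); rewrite -closureU; apply: closureS => z /=.
  have [->|] := eqVneq (f z) 0; first by rewrite add0r; right.
  by left.
Qed.

Lemma test_fun_max f g : test_fun f -> test_fun g ->
  test_fun (fun z => Num.max (f z) (g z)).
Proof.
move=> tf tg; have [cf f0 _ _] := tf; have [cg g0 _ _] := tg.
apply: (test_fun_le _ _ _ (test_funD tf tg)).
- exact: continuous_maxr.
- by move=> z; rewrite le_max f0.
- by move=> z; rewrite ge_max lerDl g0 lerDr f0.
Qed.

Variable x_ : nat -> X.
Hypothesis x_dense : forall z (e : R), 0 < e -> exists n, pdist z (x_ n) < e.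

Lemma tents_test_le s f : (forall z, tents x_ s z <= f z) -> test_fun f ->
  test_fun (tents x_ s).
Proof.
move=> sf tf; apply: test_fun_le sf tf; first exact: continuous_tents.
by move=> z; exact: tents_ge0.
Qed.

(** If [K] is locally compact, finitely many open sets on which a tent maximum exceeds 1/2 cover the
    set, hence [C = 2]. Otherwise the set lies in a ball of radius [r] around [z], and one tent of
    slope 1 is enough: its centre is within 1 of [z] and its height exceeds [r + 2], so that it is
    at least 1 on the ball. *)
Lemma bdd_tents (A : set X) : bdd A -> exists s (C : R),
  [/\ test_fun (tents x_ s), 0 <= C & forall z, A z -> 1 <= C * tents x_ s z].
Proof.
move=> [Alc Anlc].
have [lcK|nlcK] := pselect (locally_compact [set: K]).
  have [U AU [cU _]] := Alc lcK.
  have /choice[s_ sP] : forall z : X, exists s,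
      test_fun (tents x_ s) /\ 1 / 2 < tents x_ s z.
    move=> z; have [r r0 zr] := locally_compact_bdd z lcK.
    pose f w := r^-1 * Num.max 0 (r - pdist z w).
    have tf : test_fun f.
      by apply: test_funZ; [rewrite invr_ge0 ltW|exact: test_fun_pball].
    have fz : f z = 1.
      by rewrite /f pdistzz subr0 max_r ?ltW// mulVf// gt_eqF.
    have [cf f0 _ _] := tf.
    have [||s [sf zs]] := @tent_approx _ _ _ x_ x_dense f z (1 / 2) _ f0.
    - by rewrite divr_gt0.
    - by apply: continuous_lsc => //; rewrite !divr_gt0.
    exists s; split; first exact: tents_test_le sf tf.
    by apply: le_lt_trans zs; rewrite fz; lra.
  move: cU; rewrite compact_cover => /(_ X setT
    (fun z => [set w | 1 / 2 < tents x_ (s_ z) w])).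
  case=> [z _|z _|D _ UD].
  - rewrite (_ : [set _ | _] = tents x_ (s_ z) @^-1` [set y | 1 / 2 < y])//.
    by apply: open_comp; [move=> w _; exact: continuous_tents|exact: open_gt].
  - by exists z => //; have [] := sP z.
  exists (flatten [seq s_ z | z <- D]), 2; split => //.
    elim: (D : seq X) => [|z t ih] /=.
      by rewrite (_ : tents _ _ = fun=> 0) ?funeqE => [|w];
        [exact: test_fun0|exact: tents_nil].
    rewrite (_ : tents _ _ = (fun w => Num.max (tents x_ (s_ z) w)
        (tents x_ (flatten [seq s_ z | z <- t]) w))).
      by apply: test_fun_max => //; have [] := sP z.
    by apply/funext => w; rewrite tents_cat.
  move=> w /AU/UD[z /= zD zw].
  suff : tents x_ (s_ z) w <= tents x_ (flatten [seq s_ z | z <- D]) w by lra.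
  have {}zD : z \in (D : seq X) by [].
  elim: (D : seq X) zD => [//|v t ih].
  rewrite in_cons => /orP[/eqP <-|/ih {}ih] /=.
    by rewrite tents_cat le_max lexx.
  by rewrite tents_cat le_max ih orbT.
have [z [r zA]] := Anlc nlcK.
have [n zn] := x_dense z ltr01.
have [a /andP[ra _]] : exists a : rat, r + 2 < ratr a < r + 3.
  by apply: ratr_between; lra.
exists [:: (n, a, 1)], 1; split => //.
  have ta : test_fun (fun w => Num.max 0 ((`|ratr a| + 1) - pdist (x_ n) w)).
    apply: test_fun_pball; first by rewrite ltr_wpDl.
    split => // _; exists (x_ n), (`|ratr a| + 2) => w /=; rewrite pball /= => h.
    by apply: le_lt_trans h _; rewrite ltrD2l ltr1n.
  apply: tents_test_le ta => w; rewrite tents1 /tent /= rmorph1 normr1 mul1r.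
  by rewrite ge_max le_max lexx/= le_max; apply/orP; right;
    have := ler_norm (ratr a : R); lra.
move=> w /zA; rewrite pball /= tents1 /tent/= rmorph1 normr1 !mul1r => zw.
rewrite le_max; apply/orP; right.
by have := pdist_triangle z (x_ n) w; rewrite (pdist_sym _ z); lra.
Qed.

Lemma below_int_cvg f mu : test_fun f ->
  \int[mu]_z tents x_ (below x_ f n) z @[n --> \oo] --> \int[mu]_z f z.
Proof.
move=> tf; have [cf f0 _ _] := tf.
have tn n : test_fun (tents x_ (below x_ f n)).
  by apply: tents_test_le tf => z; exact: below_le.
apply: fine_cvg; rewrite -test_intE//.
apply: nd_cvg_integral => [n|n z|z|z].
- by apply: measurable_test.
- exact: tents_ge0.
- exact: below_nd.
- by apply: below_cvg => // e e0; exact: continuous_lsc.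
Qed.

(** For every test function [g], a tent maximum below [g] with nearly the same integral against [mu]
    bounds the integrals of [g] from below along [F]. For the upper bound, [f] is dominated by a
    multiple [chi] of a tent maximum, whose integral converges by assumption, and the lower bound is
    applied to [chi - f]. *)
Lemma cvg_tentsP (F : set_system M) mu : Filter F ->
  (forall s, test_fun (tents x_ s) ->
    \int[bfm nu]_z tents x_ s z @[nu --> F] --> \int[mu]_z tents x_ s z) ->
  F --> mu.
Proof.
move=> FF Fs; apply/cvg_vagueP => f tf.
have lower g (e : R) : test_fun g -> 0 < e ->
    \forall nu \near F, \int[mu]_z g z - e < \int[bfm nu]_z g z.
  move=> tg e0; have e20 : 0 < e / 2 by rewrite divr_gt0.
  have /cvgrPdist_lt/(_ _ e20)[n _ /(_ n (leqnn n))/=] := @below_int_cvg g mu tg.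
  set s := below _ _ _; have sg z : tents x_ s z <= g z.
    by apply: below_le; have [] := tg.
  have ts := tents_test_le sg tg.
  rewrite ltr_norml => /andP[_ gs].
  have /cvgrPdist_lt/(_ _ e20) := Fs s ts; apply: filterS => nu.
  rewrite ltr_norml => /andP[_ snu].
  by have := test_Rint_le nu ts tg sg; lra.
have [N N0 fN] := test_fun_bound tf; have [cf f0 _ sf] := tf.
have [s [C [ts C0 sC]]] := bdd_tents sf.
have NC0 : 0 <= N * C by rewrite mulr_ge0// ltW.
(* On the support of [f], [f] is at most [N] and [C * tents x_ s] is at least 1. *)
pose chi z := N * C * tents x_ s z.
have tchi : test_fun chi by apply: test_funZ.
have fchi z : f z <= chi z.
  have [->|fz] := eqVneq (f z) 0; first by have [_ + _ _] := tchi; exact.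
  apply: (le_trans (fN z)); rewrite /chi -mulrA ler_peMr ?(ltW N0)//.
  by apply: sC; exact: subset_closure.
have tB := test_funB tchi tf fchi.
have chiE nu : \int[nu]_z chi z = \int[nu]_z f z + \int[nu]_z (chi z - f z).
  by rewrite -test_RintD//; congr Rintegral; apply/funext => z; rewrite addrC subrK.
have Fchi : \int[bfm nu]_z chi z @[nu --> F] --> \int[mu]_z chi z.
  rewrite test_RintZ//; under eq_fun do rewrite test_RintZ//.
  by apply: cvgM; [exact: cvg_cst|exact: Fs].
apply/cvgrPdist_lt => e e0; have e20 : 0 < e / 2 by rewrite divr_gt0.
have h1 := lower _ _ tf e0; have h2 := lower _ _ tB e20.
have /cvgrPdist_lt/(_ _ e20) h3 := Fchi.
near=> nu.
have n1 : \int[mu]_z f z - e < \int[bfm nu]_z f z by near: nu.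
have n2 : \int[mu]_z (chi z - f z) - e / 2 < \int[bfm nu]_z (chi z - f z).
  by near: nu.
have : `|\int[mu]_z chi z - \int[bfm nu]_z chi z| < e / 2 by near: nu.
rewrite !chiE !ltr_norml => /andP[n3 n4]; apply/andP; split; lra.
Unshelve. all: by end_near. Qed.

(* [(s, q, b)] stands for the open half-space of measures whose integral against
   [tents s] is above ([b = false]) or below ([b = true]) [q]; the finite
   intersections of half-spaces are a base of the vague topology. *)
Definition cell_index := (seq (nat * rat * rat) * rat * bool)%type.

(** A continuous function that is positive exactly on the half-space. An index whose tent maximum is
    not a test function is given the zero function, that is, the empty set. *)
Definition cell_side (i : cell_index) mu : R :=
  if `[< test_fun (tents x_ i.1.1) >] then
    Num.max 0 ((-1) ^+ i.2 * (\int[mu]_z tents x_ i.1.1 z - ratr i.1.2))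
  else 0.

Definition cell (l : seq cell_index) mu : R :=
  \big[Num.min/1]_(i <- l) cell_side i mu.

Lemma cell_side_ge0 i mu : 0 <= cell_side i mu.
Proof. by rewrite /cell_side; case: asboolP => // _; rewrite le_max lexx. Qed.

Lemma continuous_cell_side i : continuous (cell_side i).
Proof.
rewrite /cell_side; case: asboolP => [ti|_]; last exact: cst_continuous.
apply: continuous_maxr; first exact: cst_continuous.
apply: continuous_mulr; apply: continuous_subr; exact: continuous_test_int.
Qed.

Lemma continuous_cell l : continuous (cell l).
Proof.
elim: l => [|i l ih].
  rewrite (_ : cell [::] = fun=> 1); first exact: cst_continuous.
  by apply/funext => mu; rewrite /cell big_nil.
rewrite (_ : cell _ = (fun mu => Num.min (cell_side i mu) (cell l mu))).
  by apply: continuous_minr => //; exact: continuous_cell_side.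
by apply/funext => mu; rewrite /cell big_cons.
Qed.

Lemma cell_ge0 l mu : 0 <= cell l mu.
Proof.
elim: l => [|i l ih]; first by rewrite /cell big_nil.
by rewrite /cell big_cons le_min cell_side_ge0.
Qed.

Lemma cell_cat_gt0 l1 l2 mu : (0 < cell (l1 ++ l2) mu) =
  (0 < cell l1 mu) && (0 < cell l2 mu).
Proof.
elim: l1 => [|i l1 ih]; first by rewrite /cell/= big_nil ltr01.
by rewrite /cell/= !big_cons !lt_min -andbA; congr andb.
Qed.

(** The cells around [mu] generate a filter. Two rational half-spaces confine each tent integral, so
    this filter converges to [mu], and every open set around [mu] contains a cell. *)
Lemma open_cell (O : set M) mu : open O -> O mu ->
  exists l, 0 < cell l mu /\ forall nu, 0 < cell l nu -> O nu.
Proof.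
move=> oO Omu.
pose F : set_system M := filter_from [set l | 0 < cell l mu]
  (fun l => [set nu | 0 < cell l nu]).
have FF : Filter F.
  apply: filter_from_filter; first by exists [::]; rewrite /= /cell big_nil.
  move=> l1 l2 /= h1 h2; exists (l1 ++ l2); first by rewrite /= cell_cat_gt0 h1.
  by move=> nu; rewrite /= cell_cat_gt0 => /andP[].
have : F --> mu.
  apply: cvg_tentsP => s ts; apply/cvgrPdist_lt => e e0.
  set I0 := \int[mu]_z tents x_ s z.
  have [a /andP[a1 a2]] : exists a : rat, I0 - e < ratr a < I0.
    by apply: ratr_between; lra.
  have [b /andP[b1 b2]] : exists b : rat, I0 < ratr b < I0 + e.
    by apply: ratr_between; lra.
  have cE nu : 0 < cell [:: (s, a, false); (s, b, true)] nu <->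
      ratr a < \int[nu]_z tents x_ s z /\ \int[nu]_z tents x_ s z < ratr b.
    rewrite /cell !big_cons big_nil !lt_min ltr01 andbT /cell_side /=.
    case: asboolP => // _; rewrite !lt_max !ltxx/= expr0 expr1 mul1r mulN1r.
    rewrite opprB !subr_gt0; split; [by move/andP|by move=> [-> ->]].
  exists [:: (s, a, false); (s, b, true)]; first exact/cE.
  move=> nu /= /cE[h1 h2]; rewrite ltr_norml; apply/andP; split; lra.
move=> /(_ O); case; first by apply: open_nbhs_nbhs.
by move=> l /= lmu lO; exists l.
Qed.

Definition cell_in (O : set M) (l : seq cell_index) mu : R :=
  if `[< forall nu, 0 < cell l nu -> O nu >] then cell l mu else 0.

Fixpoint open_approx_max (O : set M) (n : nat) mu : R :=
  if n is n'.+1 then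
    Num.max (open_approx_max O n' mu)
            (oapp (cell_in O ^~ mu) 0 (choice.unpickle n'))
  else 0.

Lemma open_approx_max_ge0 O n mu : 0 <= open_approx_max O n mu.
Proof.
by elim: n => //= n ih; rewrite le_max ih.
Qed.

Lemma open_approx_maxS O n mu : open_approx_max O n.+1 mu =
  Num.max (open_approx_max O n mu)
          (oapp (cell_in O ^~ mu) 0 (choice.unpickle n)).
Proof. by []. Qed.

(** The factor [n] eventually lifts every positive value above 1 and the minimum caps it there, so
    the limit is the indicator of the union of the cells contained in [O]. *)
Definition open_approx (O : set M) (n : nat) mu : R :=
  Num.min 1 (n%:R * open_approx_max O n mu).

Lemma continuous_open_approx O n : continuous (open_approx O n).
Proof.
apply: continuous_minr; first exact: cst_continuous.
apply: continuous_mulr.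
elim: n => [|n ih].
  rewrite (_ : open_approx_max O 0 = fun=> 0); first exact: cst_continuous.
  by apply/funext.
rewrite (_ : open_approx_max O n.+1 = (fun mu => Num.max (open_approx_max O n mu)
          (oapp (cell_in O ^~ mu) 0 (choice.unpickle n)))).
  apply: continuous_maxr => //.
  case: choice.unpickle => [l|] /=; last exact: cst_continuous.
  rewrite /cell_in; case: asboolP => _; last exact: cst_continuous.
  exact: continuous_cell.
by apply/funext => mu; rewrite open_approx_maxS.
Qed.

Lemma open_approx_ge0 O n mu : 0 <= open_approx O n mu.
Proof. by rewrite le_min ler01 mulr_ge0// open_approx_max_ge0. Qed.

Lemma open_approx_le1 O n mu : open_approx O n mu <= 1.
Proof. by rewrite ge_min lexx. Qed.

Lemma open_approx_nd O mu :
  {homo open_approx O ^~ mu : m n / (m <= n)%N >-> m <= n}.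
Proof.
apply/nondecreasing_seqP => n; rewrite le_min open_approx_le1 /=.
rewrite /open_approx ge_min; apply/orP; right.
apply: ler_pM => //; rewrite ?open_approx_max_ge0 ?ler_nat//.
by rewrite le_max lexx.
Qed.

Lemma open_approx_cvg O mu : open O ->
  open_approx O n mu @[n --> \oo] --> (\1_O mu : R).
Proof.
move=> oO; rewrite indicE; have [/set_mem Omu|/negP nOmu] := boolP (mu \in O).
  have [l [lmu lO]] := open_cell oO Omu.
  set m := choice.pickle l.
  have mE n : (m < n)%N -> cell l mu <= open_approx_max O n mu.
    elim: n => // n ih; rewrite ltnS leq_eqVlt open_approx_maxS le_max.
    move=> /orP[/eqP <-|/ih ->//]; rewrite choice.pickleK /= /cell_in.
    by case: asboolP => // _; rewrite lexx orbT.
  apply: cvg_near_cst.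
  near=> n; apply/eqP; rewrite /open_approx min_l//.
  have mn : (m < n)%N by near: n; exists m.+1.
  have h : (cell l mu)^-1 <= n%:R by near: n; exact: nbhs_infty_ger.
  rewrite -[leLHS](mulVf (lt0r_neq0 lmu)); apply: ler_pM => //; last exact: mE.
    by rewrite invr_ge0 cell_ge0.
  exact: cell_ge0.
rewrite (_ : open_approx O ^~ mu = fun=> 0); first exact: cvg_cst.
apply/funext => n; rewrite /open_approx (_ : open_approx_max _ _ _ = 0).
  by rewrite mulr0 min_r.
elim: n => // n ih; rewrite open_approx_maxS ih.
case: choice.unpickle => [l|] /=; last by rewrite maxxx.
suff -> : cell_in O l mu = 0 by rewrite maxxx.
rewrite /cell_in; case: asboolP => // lO.
apply/eqP; rewrite eq_le cell_ge0 andbT leNgt; apply/negP => /lO Omu.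
by apply: nOmu; exact/mem_set.
Unshelve. all: by end_near. Qed.

End vague_base.

(** * Shifts of measures *)

Section vague_shift.
Context {R : realType} {d : nat} {K : completeMetricType R}.

Local Notation E := 'rV[R]_d.
Local Notation X := ('rV[R]_d * K)%type.
Local Notation M := (bfmeasure d K).
Local Notation shiftm := Defs.shift.
Implicit Types (f g : X -> R) (mu nu : M).

Lemma shiftE (y : E) mu (A : set (borel X)) : measurable A ->
  shiftm y mu A = mu (shift_pt y @^-1` A).
Proof. by move=> mA; rewrite /Defs.shift /= /mborel; case: asboolP. Qed.

Lemma ge0_integral_shift (y : E) mu (f : X -> \bar R) :
  measurable_fun setT (f : borel X -> \bar R) -> (forall z, (0 <= f z)%E) ->
  (\int[bfm (shiftm y mu)]_z f z = \int[mu]_z f (shift_pt y z))%E.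
Proof.
move=> mf f0.
transitivity (\int[pushforward mu (shift_pt y : borel X -> borel X)]_z f z)%E.
  apply: eq_measure_integral => [|mS A mA _]; first exact: measurable_shift_pt.
  exact: shiftE.
by rewrite ge0_integral_pushforward//; exact: measurable_shift_pt.
Qed.

Lemma test_fun_shift f (y : E) : test_fun f -> test_fun (fun z => f (shift_pt y z)).
Proof.
move=> tf; have [cf f0 [N [Nr fN]] sf] := tf; split => //.
- move=> z; apply: continuous_comp; [exact: continuous_shift_pt|exact: cf].
- by exists N; split => // x Nx z _; exact: (fN x Nx).
- apply: bdd_subset (bdd_shift_pt y sf).
  rewrite [X in _ `<=` X](_ : _ = closure (shift_pt y @^-1` closure [set z | f z != 0])).
    by apply: closureS => z /= fz; exact: subset_closure.
  apply/closure_id; apply: closed_comp; last exact: closed_closure.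
  by move=> z _; exact: continuous_shift_pt.
Qed.

Lemma Rint_shift f (y : E) mu : test_fun f ->
  \int[bfm (shiftm y mu)]_z f z = \int[mu]_z f (shift_pt y z).
Proof.
move=> tf; congr fine; apply: ge0_integral_shift.
  by apply/measurable_EFinP; exact: measurable_test.
by move=> z; rewrite lee_fin; have [_ + _ _] := tf.
Qed.

Lemma pdist_shift (y y' : E) (z : X) :
  pdist (shift_pt y z) (shift_pt y' z) = `|y' - y|.
Proof.
rewrite /pdist /shift_pt /= mdistxx max_l//.
by rewrite opprB addrC addrA subrK.
Qed.

Hypothesis hK : separable K.

Lemma bdd_test (A : set X) : bdd A ->
  exists2 chi, test_fun chi & forall z, A z -> 1 <= chi z.
Proof.
move=> bA; have [x_ x_dense] := dense_sequence (d := d) hK.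
have [s [C [ts C0 sA]]] := bdd_tents x_dense bA.
by exists (fun z => C * tents x_ s z) => //; exact: test_funZ.
Qed.

(* Tests are Lipschitz tents, hence [f (z - y)] varies by at most [L |y - y0|], and
   only where a fixed test function [chi] is at least 1. *)
Lemma continuous_shift_joint : continuous (fun p : E * M => shiftm p.1 p.2).
Proof.
move=> [y0 mu0]; have [x_ x_dense] := dense_sequence (d := d) hK.
apply: (cvg_tentsP x_dense) => s ts.
have [L L0 sL] := tents_lipschitz x_ s.
set f := tents x_ s in ts sL *.
have [_ f0 _ sf] := ts.
have [N [_ fN]] := bdd_fst sf.
(* If [|y - y0| <= 1] and [|z - y| <= N + 1], as holds on the support, then
   [|z| <= N + 1 + |y0| + 1]. *)
pose B : set E := [set x | `|x| <= N + `|y0| + 2].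
have [chi tchi chi1] : exists2 chi, test_fun chi &
    forall z, (B `*` (snd @` closure [set z | f z != 0])) z -> 1 <= chi z.
  apply: bdd_test; apply: bdd_setX => //.
  exists (N + `|y0| + 2); split; first exact: num_real.
  by move=> r Nr x /= /le_trans; apply; exact: ltW.
have [_ chi0 _ _] := tchi.
have key (y y' : E) z : `|y - y0| <= 1 -> `|y' - y0| <= 1 ->
    f (shift_pt y z) <= f (shift_pt y' z) + L * `|y' - y| * chi z.
  move=> yy0 y'y0; have [->|fz] := eqVneq (f (shift_pt y z)) 0.
    by rewrite addr_ge0 ?mulr_ge0.
  apply: (le_trans (sL _ (shift_pt y' z))); rewrite lerD2l pdist_shift.
  rewrite ler_peMr ?mulr_ge0//; apply: chi1.
  have Cz : closure [set z | f z != 0] (shift_pt y z) by exact: subset_closure.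
  split => /=; last by exists (shift_pt y z).
  have h1 : `|z.1 - y| <= N + 1.
    by apply: (fN (N + 1)); [rewrite ltrDl|exists (shift_pt y z)].
  have := ler_normD (z.1 - y) y; rewrite subrK.
  by have := ler_normD (y - y0) y0; rewrite subrK /B /=; lra.
suff H : (fun p : E * M => \int[bfm (shiftm p.1 p.2)]_z f z) @ (y0, mu0) -->
    \int[bfm (shiftm y0 mu0)]_z f z by exact: H.
rewrite Rint_shift// (_ : (fun p : E * M => _) =
  (fun p => \int[bfm p.2]_z f (shift_pt p.1 z))); last first.
  by apply/funext => p; rewrite Rint_shift.
apply/cvgrPdist_lt => e e0.
pose c := \int[mu0]_z chi z + 1.
have c0 : 0 < c by rewrite ltr_wpDl// test_Rint_ge0.
have [dl dl0 Ldl] : exists2 dl : R, 0 < dl & L * dl * c < e / 2.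
  (* [L + 1] stands in the denominator because [L] may vanish. *)
  exists (e / (4 * (L + 1) * c)); first by rewrite !divr_gt0// !mulr_gt0// ltr_wpDl.
  rewrite (_ : L * _ * c = (L / (L + 1)) * (e / 4)); last first.
    by field; rewrite !gt_eqF// ltr_wpDl.
  apply: (@le_lt_trans _ _ (1 * (e / 4))); last by lra.
  rewrite ler_wpM2r//; first by rewrite divr_ge0// ltW.
  by rewrite ler_pdivrMr ?ltr_wpDl// mul1r lerDl.
have ny : \forall p \near (y0, mu0), `|p.1 - y0| < Num.min 1 dl.
  have : (fun p : E * M => p.1) @ (y0, mu0) --> y0 by exact: cvg_fst.
  move/cvgrPdist_lt => /(_ (Num.min 1 dl)); rewrite lt_min ltr01 dl0 => /(_ isT).
  by apply: filterS => p; rewrite distrC.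
have nm1 : \forall p \near (y0, mu0), \int[bfm p.2]_z chi z < c.
  have : (fun p : E * M => \int[bfm p.2]_z chi z) @ (y0, mu0) -->
      \int[mu0]_z chi z.
    have h : (fun p : E * M => p.2) @ (y0, mu0) --> mu0 by exact: cvg_snd.
    exact: (cvg_comp _ _ h (@continuous_test_int _ _ _ _ tchi mu0)).
  move/cvgrPdist_lt => /(_ 1 ltr01); apply: filterS => p.
  by rewrite ltr_norml => /andP[+ _]; rewrite /c; lra.
have tf0 := test_fun_shift y0 ts.
have nm2 : \forall p \near (y0, mu0),
    `|\int[mu0]_z f (shift_pt y0 z) - \int[bfm p.2]_z f (shift_pt y0 z)| < e / 2.
  have : (fun p : E * M => \int[bfm p.2]_z f (shift_pt y0 z)) @ (y0, mu0) -->
      \int[mu0]_z f (shift_pt y0 z).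
    have h : (fun p : E * M => p.2) @ (y0, mu0) --> mu0 by exact: cvg_snd.
    exact: (cvg_comp _ _ h (@continuous_test_int _ _ _ _ tf0 mu0)).
  by move/cvgrPdist_lt; apply; rewrite divr_gt0.
near=> p; have py : `|p.1 - y0| < Num.min 1 dl by near: p.
have pchi : \int[bfm p.2]_z chi z < c by near: p.
have pf : `|\int[mu0]_z f (shift_pt y0 z) - \int[bfm p.2]_z f (shift_pt y0 z)|
  < e / 2 by near: p.
move: py; rewrite lt_min => /andP[py1 pyd].
have tfp := test_fun_shift p.1 ts.
have bnd (y y' : E) : `|y - y0| <= 1 -> `|y' - y0| <= 1 -> `|y' - y| < dl ->
    \int[bfm p.2]_z f (shift_pt y z) <= \int[bfm p.2]_z f (shift_pt y' z) + e / 2.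
  move=> yy0 y'y0 yy'; have Ly0 : 0 <= L * `|y' - y| by rewrite mulr_ge0.
  apply: (@le_trans _ _ (\int[bfm p.2]_z
    (f (shift_pt y' z) + L * `|y' - y| * chi z))).
    apply: test_Rint_le; first exact: test_fun_shift.
      by apply: test_funD; [exact: test_fun_shift|exact: test_funZ].
    by move=> z; exact: key.
  rewrite test_RintD; [|exact: test_fun_shift|exact: test_funZ].
  rewrite test_RintZ// lerD2l; apply: le_trans (ltW Ldl).
  apply: ler_pM => //; first exact: test_Rint_ge0.
    by rewrite ler_wpM2l// ltW.
  exact: ltW.
have p0 : `|y0 - y0| <= 1 by rewrite subrr normr0.
have h1 := bnd p.1 y0 (ltW py1) p0; rewrite distrC in pyd.
have h2 := bnd y0 p.1 p0 (ltW py1); rewrite distrC in h2.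
exact: distr_lt_half (h1 pyd) (h2 pyd) pf.
Unshelve. all: by end_near. Qed.

Lemma continuous_shift_phi (phi : M -> R) : continuous phi ->
  continuous (fun p : E * M => phi (shiftm p.1 p.2)).
Proof. by move=> cphi p; exact: (cvg_comp _ _ (@continuous_shift_joint p) (cphi _)). Qed.

(** [mu] enters both as the integrator and through [S_x mu]. Freezing the second occurrence at [mu0]
    leaves the integral of a fixed test function, which is continuous. The error of freezing is
    uniform in [x]: [g] confines [x] to a compact ball of [R^d], and joint continuity of the shift
    makes [phi (S_x mu)] uniformly close to [phi (S_x mu0)] there. *)
Lemma continuous_int_shift g (phi : M -> R) : test_fun g -> continuous phi ->
  (forall mu, 0 <= phi mu <= 1) ->
  continuous (fun mu : M => \int[mu]_z (g z * phi (shiftm z.1 mu))).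
Proof.
move=> tg cphi phi01 mu0; have [cg g0 _ sg] := tg.
have tH mu : test_fun (fun z => g z * phi (shiftm z.1 mu)).
  apply: (test_fun_le _ _ _ tg) => z.
  - apply: cvgM; first exact: cg.
    have h : (fun z : X => z.1) @ z --> z.1 by exact: cvg_fst.
    have {}h : (fun z' : X => (z'.1, mu)) @ z --> ((z.1, mu) : E * M).
      by have := cvg_pair h (cvg_cst mu); exact.
    exact: (cvg_comp _ _ h (@continuous_shift_phi _ cphi (z.1, mu))).
  - by rewrite mulr_ge0//; have /andP[] := phi01 (shiftm z.1 mu).
  - by rewrite ler_piMr//; have /andP[] := phi01 (shiftm z.1 mu).
have [N [_ gN]] := bdd_fst sg.
pose B : set E := [set x | `|x| <= N + 1].
have cB : compact B := @rV_closed_ball_compact R d (N + 1).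
apply/(@cvgrPdist_lt _ _ _ (nbhs (mu0 : M))) => e e0.
pose c := \int[mu0]_z g z + 1.
have c0 : 0 < c by rewrite ltr_wpDl// test_Rint_ge0.
have ec : 0 < e / (2 * c) by rewrite divr_gt0// mulr_gt0.
have near_phi : \forall mu \near mu0, B `<=`
    [set x | `|phi (shiftm x mu) - phi (shiftm x mu0)| < e / (2 * c)].
  move/compact_near_coveringP : cB => /(_ M (nbhs mu0)
    (fun mu x => `|phi (shiftm x mu) - phi (shiftm x mu0)| < e / (2 * c))).
  apply => x Bx.
  have h := @continuous_shift_phi _ cphi (x, mu0).
  (* At a nearby [x'], both [mu] and [mu0] are compared with the value at [(x, mu0)], hence half the
     tolerance. *)
  have ec2 : 0 < e / (2 * c) / 2 by rewrite divr_gt0.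
  move/cvgrPdist_lt : h => /(_ _ ec2)[[U V] /= [Ux Vmu] UV].
  exists (U, V) => //= -[x' mu] [/= Ux' Vmu'].
  have h1 := UV (x', mu) (conj Ux' Vmu').
  have h2 := UV (x', mu0) (conj Ux' (nbhs_singleton Vmu)).
  by move: h1 h2; rewrite /= !ltr_norml => /andP[? ?] /andP[? ?];
    apply/andP; split; lra.
have nm1 : \forall mu \near mu0, \int[bfm mu]_z g z < c.
  have /cvgrPdist_lt/(_ 1 ltr01) := @continuous_test_int _ _ _ _ tg mu0.
  by apply: filterS => mu; rewrite ltr_norml => /andP[+ _]; rewrite /c; lra.
have nm2 : \forall mu \near mu0, `|\int[mu0]_z (g z * phi (shiftm z.1 mu0)) -
    \int[bfm mu]_z (g z * phi (shiftm z.1 mu0))| < e / 2.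
  have /cvgrPdist_lt := @continuous_test_int _ _ _ _ (tH mu0) mu0.
  by apply; rewrite divr_gt0.
near=> mu.
have pphi : B `<=`
  [set x | `|phi (shiftm x mu) - phi (shiftm x mu0)| < e / (2 * c)] by near: mu.
have pg : \int[bfm mu]_z g z < c by near: mu.
have pH : `|\int[mu0]_z (g z * phi (shiftm z.1 mu0)) -
    \int[bfm mu]_z (g z * phi (shiftm z.1 mu0))| < e / 2 by near: mu.
have key z : `|g z * phi (shiftm z.1 mu) - g z * phi (shiftm z.1 mu0)|
    <= e / (2 * c) * g z.
  have [->|gz] := eqVneq (g z) 0; first by rewrite !mul0r mulr0 subrr normr0.
  rewrite -mulrBr normrM ger0_norm// mulrC ler_wpM2r// ltW//; apply: pphi.
  by apply: (gN (N + 1)); [rewrite ltrDl|exists z => //; exact: subset_closure].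
have te : test_fun (fun z => e / (2 * c) * g z) by apply: test_funZ => //; exact: ltW.
(* Both orders are needed, one for each side of the absolute value. *)
have bnd nu nu' : (nu = mu /\ nu' = mu0) \/ (nu = mu0 /\ nu' = mu) ->
    \int[bfm mu]_z (g z * phi (shiftm z.1 nu)) <=
    \int[bfm mu]_z (g z * phi (shiftm z.1 nu')) + e / 2.
  move=> nunu'; apply: (@le_trans _ _ (\int[bfm mu]_z
    (g z * phi (shiftm z.1 nu') + e / (2 * c) * g z))).
    apply: test_Rint_le; first exact: tH.
      by apply: test_funD.
    move=> z; have := key z; rewrite ler_norml => /andP[? ?].
    by case: nunu' => -[-> ->]; lra.
  rewrite test_RintD// test_RintZ ?(ltW ec)// lerD2l.
  apply: (@le_trans _ _ (e / (2 * c) * c)); first by rewrite ler_wpM2l// ltW.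
  by rewrite invfM mulrA -mulrA mulVf ?gt_eqF// mulr1.
have h1 := bnd mu mu0 (or_introl (conj erefl erefl)).
have h2 := bnd mu0 mu (or_intror (conj erefl erefl)).
exact: distr_lt_half h1 h2 pH.
Unshelve. all: by end_near. Qed.

End vague_shift.

(** * Measurability of integrals of shifted indicators *)

Section vague_measurability.
Context {R : realType} {d : nat} {K : completeMetricType R}.

Local Notation E := 'rV[R]_d.
Local Notation X := ('rV[R]_d * K)%type.
Local Notation M := (bfmeasure d K).
Local Notation shiftm := Defs.shift.
Implicit Types (f g : X -> R) (mu nu : M).

Hypothesis hK : separable K.

Lemma open_bfmeasure_approx (O : set M) : open O ->
  exists psi : nat -> M -> R, [/\ forall n, continuous (psi n),
    forall n mu, 0 <= psi n mu <= 1,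
    forall mu, {homo psi ^~ mu : m n / (m <= n)%N >-> m <= n} &
    forall mu, psi n mu @[n --> \oo] --> (\1_O mu : R)].
Proof.
move=> oO; have [x_ x_dense] := dense_sequence (d := d) hK.
exists (open_approx x_ O); split.
- exact: continuous_open_approx.
- by move=> n mu; rewrite open_approx_ge0 open_approx_le1.
- exact: open_approx_nd.
- by move=> mu; exact: open_approx_cvg.
Qed.

(** The indicator of an open set is lower semicontinuous, so the tent maxima below it converge to
    it. *)
Lemma open_X_approx (U : set X) : open U ->
  exists u : nat -> X -> R, [/\ forall n, continuous (u n),
    forall n z, 0 <= u n z <= 1,
    forall z, {homo u ^~ z : m n / (m <= n)%N >-> m <= n} &
    forall z, u n z @[n --> \oo] --> (\1_U z : R)].
Proof.
move=> oU; have [x_ x_dense] := dense_sequence (d := d) hK.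
have U0 z : 0 <= (\1_U z : R) by have /andP[] := @indic01 R _ U z.
exists (fun n => tents x_ (below x_ \1_U n)); split.
- by move=> n; exact: continuous_tents.
- move=> n z; rewrite tents_ge0 (le_trans (below_le _ _ (U0 z)))//.
- exact: below_nd.
- move=> z; apply: below_cvg => // e e0.
  have [Uz|nUz] := pselect (U z).
    have : nbhs z U by apply: open_nbhs_nbhs.
    apply: filterS => w Uw; rewrite !indicE !mem_set//=.
    by rewrite gtrBl.
  apply: (@filterS _ (nbhs z) _ setT) => [w _|]; last exact: filterT.
  apply: lt_le_trans (U0 w).
  by rewrite indicE memNset// subr_lt0.
Qed.

Lemma bdd_set1 (z : X) : bdd [set z].
Proof.
split=> [lcK|_]; last by exists z, 1 => _ ->; exact: ballxx.
have [r r0 [/(_ lcK) + _]] := locally_compact_bdd z lcK.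
by apply: precompact_subset => _ -> /=; rewrite pdistzz ltW.
Qed.

(** A substitute for an exhaustion by bounded sets that works for both notions of boundedness.
    Singletons are bounded, so at every point some tent maximum that is a test function is positive;
    the factor [n] and the cap 1 then give the limit 1. *)
Lemma test_exhaustion : exists b : nat -> X -> R, [/\ forall n, test_fun (b n),
    forall z, {homo b ^~ z : m n / (m <= n)%N >-> m <= n},
    forall n z, b n z <= 1 &
    forall z, b n z @[n --> \oo] --> (1 : R)].
Proof.
have [x_ x_dense] := dense_sequence (d := d) hK.
pose t n : seq (nat * rat * rat) := oapp (fun s =>
  if `[< test_fun (tents x_ s) >] then s else [::]) [::] (choice.unpickle n).
pose T n := flatten [seq t i | i <- iota 0 n].
have TS n : T n.+1 = T n ++ t n.
  by rewrite /T -addn1 iotaD map_cat flatten_cat /= cats0.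
have tnil : test_fun (tents x_ [::]).
  rewrite (_ : tents x_ [::] = fun=> 0); first exact: test_fun0.
  by apply/funext => z; exact: tents_nil.
have tT n : test_fun (tents x_ (T n)).
  elim: n => // n ih; rewrite TS (_ : tents _ _ = fun z =>
    Num.max (tents x_ (T n) z) (tents x_ (t n) z)); last first.
    by apply/funext => z; exact: tents_cat.
  apply: test_fun_max => //; rewrite /t.
  by case: choice.unpickle => [s|] //=; case: asboolP.
exists (fun n z => Num.min 1 (n%:R * tents x_ (T n) z)); split.
- move=> n; have tn : test_fun (fun z => n%:R * tents x_ (T n) z).
    exact: test_funZ.
  apply: (test_fun_le _ _ _ tn) => [|z|z].
  + by apply: continuous_minr; [exact: cst_continuous|have [] := tn].
  + by rewrite le_min ler01 mulr_ge0// tents_ge0.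
  + by rewrite ge_min lexx orbT.
- move=> z; apply/nondecreasing_seqP => n.
  rewrite le_min !ge_min lexx/=; apply/orP; right.
  apply: ler_pM; rewrite ?ler0n ?tents_ge0 ?ler_nat//.
  by rewrite TS tents_cat le_max lexx.
- by move=> n z; rewrite ge_min lexx.
- move=> z; have [s [C [ts C0 sz]]] := bdd_tents x_dense (bdd_set1 z).
  have {}sz : 0 < tents x_ s z.
    rewrite lt_neqAle tents_ge0 andbT eq_sym; apply/eqP => sz0.
    by have := sz z erefl; rewrite sz0 mulr0 ler10.
  apply: cvg_near_cst; near=> n; apply/eqP; rewrite min_l//.
  have mn : (choice.pickle s < n)%N by near: n; exists (choice.pickle s).+1.
  have h : (tents x_ s z)^-1 <= n%:R by near: n; exact: nbhs_infty_ger.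
  rewrite -[leLHS](mulVf (lt0r_neq0 sz)); apply: ler_pM => //.
  + by rewrite invr_ge0 tents_ge0.
  + exact: tents_ge0.
  elim: (n) mn => // k ih; rewrite ltnS leq_eqVlt TS tents_cat le_max.
  move=> /orP[/eqP <-|/ih ->//]; rewrite /t choice.pickleK /=.
  by case: asboolP => // _; rewrite lexx orbT.
Unshelve. all: by end_near. Qed.

Lemma continuous_shift_pos mu : continuous (fun z : X => shiftm z.1 mu).
Proof.
move=> z; have h : (fun z : X => z.1) @ z --> z.1 by exact: cvg_fst.
have {}h : (fun z' : X => (z'.1, mu)) @ z --> ((z.1, mu) : E * M).
  by have := cvg_pair h (cvg_cst mu); exact.
exact: (cvg_comp _ _ h (@continuous_shift_joint _ _ _ hK (z.1, mu))).
Qed.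

Lemma measurable_shift_pos mu :
  measurable_fun setT ((fun z : X => shiftm z.1 mu) : borel X -> borel M).
Proof. by apply: continuous_borel; exact: continuous_shift_pos. Qed.

(** Both indicators are approximated from below with the same index; each approximating integral is
    continuous in [mu], although [mu] also occurs inside the integrand. *)
Lemma measurable_int_open g (U : set X) (O : set M) : test_fun g ->
  open U -> open O ->
  measurable_fun setT (fun mu : borel M =>
    \int[bfm mu]_z (g z * \1_U z * \1_O (shiftm z.1 mu))%:E)%E.
Proof.
move=> tg oU oO; have [u [cu u01 ndu uU]] := open_X_approx oU.
have [psi [cpsi psi01 ndpsi psiO]] := open_bfmeasure_approx oO.
have [cg g0 _ _] := tg.
have tgu n : test_fun (fun z => g z * u n z).
  apply: (test_fun_le _ _ _ tg) => z; have /andP[? ?] := u01 n z.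
  - by apply: cvgM; [exact: cg|exact: cu].
  - exact: mulr_ge0.
  - by rewrite ler_piMr.
have tgupsi n mu : test_fun (fun z => g z * u n z * psi n (shiftm z.1 mu)).
  have tn := tgu n; have [cn n0 _ _] := tn.
  apply: (test_fun_le _ _ _ tn) => z; have /andP[? ?] := psi01 n (shiftm z.1 mu).
  - apply: cvgM; first exact: cn.
    exact: (cvg_comp _ _ (@continuous_shift_pos mu z) (cpsi n _)).
  - exact: mulr_ge0.
  - by rewrite ler_piMr.
apply: (@emeasurable_fun_cvg _ _ R setT (fun n (mu : borel M) =>
  \int[bfm mu]_z (g z * u n z * psi n (shiftm z.1 mu))%:E)%E).
  move=> n; rewrite (_ : (fun mu => _) = (EFin \o (fun mu : borel M =>
      \int[bfm mu]_z (g z * u n z * psi n (shiftm z.1 mu)))%R)); last first.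
    by apply/funext => mu; rewrite test_intE.
  apply/measurable_EFinP; apply: continuous_measurable_real.
  exact: continuous_int_shift.
move=> mu _; apply: nd_cvg_integral => [n|n z|z m n mn|z].
- exact: measurable_test.
- by have [_ + _ _] := tgupsi n mu; exact.
- have /andP[? ?] := u01 m z; have /andP[? ?] := psi01 m (shiftm z.1 mu).
  apply: ler_pM; rewrite ?mulr_ge0//; last exact: ndpsi.
  by rewrite ler_wpM2l//; exact: ndu.
- by apply: cvgM; [apply: cvgM; [exact: cvg_cst|exact: uU]|exact: psiO].
Qed.

(** Two Dynkin arguments in turn: in the set of points for an open set of measures, then in the set
    of measures. The test function [g] keeps all masses finite, as complements require. *)
Lemma measurable_int_indic g (B : set (borel X)) (A : set (borel M)) :
  test_fun g -> measurable B -> measurable A ->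
  measurable_fun setT (fun mu : borel M =>
    \int[bfm mu]_z (g z * \1_B z * \1_A (shiftm z.1 mu))%:E)%E.
Proof.
move=> tg mB mA; have [cg g0 _ _] := tg; have mg := measurable_test tg.
have i0 (T : Type) (C : set T) x : 0 <= \1_C x :> R by rewrite indicE.
have gfin (w : X -> R) mu : measurable_fun setT (w : borel X -> R) ->
    (forall z, 0 <= w z <= 1) -> (\int[bfm mu]_z (g z * w z)%:E < +oo)%E.
  move=> mw w01; apply: le_lt_trans (test_int_lty mu tg).
  apply: ge0_le_integral => //.
  - by move=> z _; rewrite lee_fin mulr_ge0//; have /andP[] := w01 z.
  - by apply/measurable_EFinP; exact: measurable_funM.
  - exact/measurable_EFinP.
  - by move=> z _; rewrite lee_fin ler_piMr//; have /andP[] := w01 z.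
have i01 := @indic01 R.
have mS (C : set (borel M)) mu : measurable C ->
    measurable_fun setT (fun z : borel X => \1_C (shiftm z.1 mu) : R).
  by move=> mC; apply: measurable_indic_preimage mC; exact: measurable_shift_pos.
have step (O : set M) : open O -> measurable_fun setT (fun mu : borel M =>
    \int[bfm mu]_z (g z * \1_B z * \1_O (shiftm z.1 mu))%:E)%E.
  move=> oO; have mO := open_borel oO.
  pose V (mu : borel M) (C : set (borel X)) :=
    (\int[bfm mu]_z (g z * \1_O (shiftm z.1 mu) * \1_C z)%:E)%E.
  suff : measurable_fun setT (V ^~ B).
    by congr measurable_fun; apply/funext => mu; apply: eq_integral => z _;
      rewrite mulrAC.
  have mw mu : measurable_fun setT (fun z : borel X => g z * \1_O (shiftm z.1 mu)).
    by apply: measurable_funM => //; exact: mS.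
  have w0 mu z : 0 <= g z * \1_O (shiftm z.1 mu) by rewrite mulr_ge0.
  have VT mu : V mu setT = (\int[bfm mu]_z (g z * \1_O (shiftm z.1 mu))%:E)%E.
    by apply: eq_integral => z _; rewrite indicT mulr1.
  apply: (@measurable_borel_family R _ _ X V) => //.
  - move=> U oU; have := measurable_int_open tg oU oO.
    by congr measurable_fun; apply/funext => mu; apply: eq_integral => z _;
      rewrite mulrAC.
  - by move=> mu C mC; apply: integral_ge0 => z _; rewrite lee_fin mulr_ge0.
  - move=> mu C mC; rewrite VT.
    by apply: (@weighted_integral_setC _ _ _ _ _ _ _ id) => //; exact: measurable_id.
  - by move=> mu; rewrite VT; apply: gfin => //; exact: mS.
  - by move=> mu F mF tF; apply: (@weighted_integral_bigcup _ _ _ _ _ _ _ id).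
pose V (mu : borel M) (C : set (borel M)) :=
  (\int[bfm mu]_z (g z * \1_B z * \1_C (shiftm z.1 mu))%:E)%E.
have mw : measurable_fun setT (fun z : borel X => g z * \1_B z).
  exact: measurable_funM.
have w0 z : 0 <= g z * \1_B z by rewrite mulr_ge0.
have VT mu : V mu setT = (\int[bfm mu]_z (g z * \1_B z)%:E)%E.
  by apply: eq_integral => z _; rewrite indicT mulr1.
apply: (@measurable_borel_family R _ (borel M) M V) => //.
- by move=> mu C mC; apply: integral_ge0 => z _; rewrite lee_fin mulr_ge0.
- move=> mu C mC; rewrite VT.
  apply: (@weighted_integral_setC _ _ _ _ (borel M) _ _
    (fun z : borel X => shiftm z.1 mu)) => //.
  exact: measurable_shift_pos.
- by move=> mu; rewrite VT; exact: gfin.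
- move=> mu F mF tF.
  apply: (@weighted_integral_bigcup _ _ _ _ (borel M) _ _
    (fun z : borel X => shiftm z.1 mu)) => //.
  exact: measurable_shift_pos.
Qed.

(** The weight [g] is removed by monotone convergence along an exhaustion by test functions. *)
Lemma measurable_int_shift (B : set (borel X)) (A : set (borel M)) :
  measurable B -> measurable A ->
  measurable_fun setT (fun mu : borel M =>
    \int[bfm mu]_z (\1_B z * \1_A (shiftm z.1 mu))%:E)%E.
Proof.
move=> mB mA; have [b [tb ndb b1 bcvg]] := test_exhaustion.
have b0 n z : 0 <= b n z by have [_ + _ _] := tb n.
have i0 (T : Type) (C : set T) x : 0 <= \1_C x :> R by rewrite indicE.
apply: (@emeasurable_fun_cvg _ _ R setT (fun n (mu : borel M) =>
  \int[bfm mu]_z (b n z * \1_B z * \1_A (shiftm z.1 mu))%:E)%E).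
  by move=> n; exact: measurable_int_indic.
move=> mu _; apply: nd_cvg_integral => [n|n z|z m n mn|z].
- apply: measurable_funM; last first.
    by apply: measurable_indic_preimage mA; exact: measurable_shift_pos.
  by apply: measurable_funM => //; exact: measurable_test.
- by rewrite !mulr_ge0.
- by rewrite !ler_wpM2r//; exact: ndb.
- rewrite -[X in _ --> X]mul1r mulrA.
  by apply: cvgM; [apply: cvgM; [exact: bcvg|exact: cvg_cst]|exact: cvg_cst].
Qed.

Lemma measurable_eval (B : set (borel X)) : measurable B ->
  measurable_fun setT (fun mu : borel M => bfm mu B).
Proof.
move=> mB; have := measurable_int_shift mB (@measurableT _ (borel M)).
congr measurable_fun; apply/funext => mu.
under eq_integral do rewrite indicT mulr1.
by rewrite integral_indic// setIT.
Qed.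

End vague_measurability.

(** * Laws of random measures *)

Section laws.
Context {R : realType} {d : nat} {K : completeMetricType R}.

Local Notation E := 'rV[R]_d.
Local Notation X := ('rV[R]_d * K)%type.
Local Notation M := (bfmeasure d K).
Local Notation shiftm := Defs.shift.
Local Notation law := (probability (borel M) R).
Implicit Types (f g : X -> R) (mu nu : M) (P : law).

(** The half of the portmanteau theorem for lower semicontinuous functionals, here possibly
    infinite. Convergence in law only tests bounded functions, so [f_ m] is capped by [m]; the
    capped sequence still increases to [f], and one of its members has a mean above [r]. *)
Lemma cvg_in_law_lsc (P_ : nat -> law) P (f_ : nat -> M -> R) (f : M -> \bar R)
    (r : R) :
  cvg_in_law P_ P -> (forall n, continuous (f_ n)) ->
  (forall n mu, 0 <= f_ n mu) ->
  (forall mu, {homo f_ ^~ mu : a b / (a <= b)%N >-> a <= b}) ->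
  (forall mu, (f_ n mu)%:E @[n --> \oo] --> f mu) ->
  (r%:E < \int[P]_mu f mu)%E -> \forall n \near \oo, (r%:E < \int[P_ n]_mu f mu)%E.
Proof.
move=> PP cf f0 ndf ff rP.
pose h m mu := Num.min (f_ m mu) m%:R.
have ch m : continuous (h m) by apply: continuous_minr => //; exact: cst_continuous.
have h0 m mu : 0 <= h m mu by rewrite le_min f0 ler0n.
have ndh mu : {homo h ^~ mu : a b / (a <= b)%N >-> a <= b}.
  move=> a b ab; rewrite le_min !ge_min ndf//= ler_nat ab orbT//.
have f_f n mu : ((f_ n mu)%:E <= f mu)%E.
  rewrite -(cvg_lim _ (ff mu))//; apply: lime_ge.
    by apply/cvg_ex; exists (f mu); exact: ff.
  by exists n => // k /= nk; rewrite lee_fin; exact: ndf.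
have hf mu : (h n mu)%:E @[n --> \oo] --> f mu.
  have ndhE : nondecreasing_seq (fun n => (h n mu)%:E).
    by move=> a b ab; rewrite lee_fin; exact: ndh.
  have hsup := ereal_nondecreasing_cvgn ndhE.
  suff <- : ereal_sup (range (fun n => (h n mu)%:E)) = f mu by [].
  apply/eqP; rewrite eq_le; apply/andP; split.
    apply: ge_ereal_sup => _ [n _ <-]; apply: le_trans (f_f n mu).
    by rewrite lee_fin ge_min lexx.
  rewrite -(cvg_lim _ (ff mu))//; apply: lime_le.
    by apply/cvg_ex; exists (f mu); exact: ff.
  apply: nearW => k; apply: le_ereal_sup_tmp.
  (* [m] is large enough for the cap to lie above [f_ k mu]. *)
  pose m := maxn k (Num.truncn (f_ k mu)).+1.
  exists (h m mu)%:E; first by exists m.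
  rewrite lee_fin le_min ndf ?leq_maxl//=.
  apply: le_trans (ltW (truncnS_gt _)) _ => //.
  by rewrite ler_nat leq_maxr.
have mh m : measurable_fun setT (h m : borel M -> R).
  exact: continuous_measurable_real.
have cvgP : (\int[P]_mu (h n mu)%:E @[n --> \oo] --> \int[P]_mu f mu)%E.
  have := @cvg_monotone_convergence _ (borel M) R P setT measurableT (fun n mu => (h n mu)%:E).
  set g := (fun x => limn _).
  have -> : g = f by apply/funext => mu; exact/cvg_lim.
  apply.
  - by move=> n; exact/measurable_EFinP.
  - by move=> n mu _; rewrite lee_fin.
  - by move=> mu _ a b ab; rewrite lee_fin; exact: ndh.
have [m rm] : exists m, (r%:E < \int[P]_mu (h m mu)%:E)%E.
  apply: contrapT => /forallNP nr; move: rP; apply/negP; rewrite -leNgt.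
  rewrite -(cvg_lim _ cvgP)//; apply: lime_le; first by apply/cvg_ex; eexists; exact: cvgP.
  by apply: nearW => m; rewrite leNgt; exact/negP/nr.
have bh : bounded_fun (h m).
  exists m%:R; split; first exact: num_real.
  by move=> x mx mu _ /=; rewrite ger0_norm// (le_trans _ (ltW mx))// ge_min lexx orbT.
have /(_ _ (open_nbhs_nbhs _)) := PP (h m) (ch m) bh.
move=> /(_ [set x | r%:E < x]%E); case.
  by split => //; exact: open_ereal_gt_ereal.
move=> N _ NP; exists N => // n /NP /= /lt_le_trans; apply.
have mf : measurable_fun setT (f : borel M -> \bar R).
  by apply: (@emeasurable_fun_cvg _ (borel M) R setT (fun n mu => (h n mu)%:E)) => // k;
    exact/measurable_EFinP.
apply: ge0_le_integral => //.
- by move=> mu _; rewrite lee_fin.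
- exact/measurable_EFinP.
- by move=> mu _; apply: le_trans (f_f m mu); rewrite lee_fin ge_min lexx.
Qed.

Lemma cvg_in_law_le (P_ : nat -> law) P (f_ : nat -> M -> R) (f : M -> \bar R)
    (c : \bar R) :
  cvg_in_law P_ P -> (forall n, continuous (f_ n)) ->
  (forall n mu, 0 <= f_ n mu) ->
  (forall mu, {homo f_ ^~ mu : a b / (a <= b)%N >-> a <= b}) ->
  (forall mu, (f_ n mu)%:E @[n --> \oo] --> f mu) ->
  (forall n, (\int[P_ n]_mu f mu <= c)%E) -> (\int[P]_mu f mu <= c)%E.
Proof.
move=> PP cf f0 ndf ff fc; rewrite leNgt; apply/negP => cf1.
have f_ge0 mu : (0 <= f mu)%E.
  rewrite -(cvg_lim _ (ff mu))//; apply: lime_ge.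
    by apply/cvg_ex; exists (f mu); exact: ff.
  by apply: nearW => n; rewrite lee_fin.
have c0 : (0 <= c)%E by apply: le_trans (fc 0); exact: integral_ge0.
have cfin : c \is a fin_num by rewrite ge0_fin_numE// (lt_le_trans cf1)// leey.
rewrite -(fineK cfin) in cf1 fc.
have [N _ /(_ N (leqnn N))/=] := cvg_in_law_lsc PP cf f0 ndf ff cf1.
by rewrite ltNge fc.
Qed.

Lemma Q1E : @Q1 R d = [set x : E | `|x| <= 2^-1].
Proof.
apply/seteqP; split=> x /=.
  move=> Qx; rewrite /Num.norm/= mx_normrE; apply/bigmax_leP; split => //.
  by move=> [i j] _ /=; rewrite ord1.
move=> xQ i; apply: le_trans xQ; rewrite /Num.norm/= mx_normrE.
exact: (le_bigmax _ (fun ij : 'I_1 * 'I_d => `|x ij.1 ij.2|) (ord0, i)).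
Qed.

Lemma closed_fst_le (r : R) : closed [set z : X | `|z.1| <= r].
Proof.
rewrite (_ : [set _ | _] = (fun z : X => `|z.1|) @^-1` [set y | y <= r])//.
apply: closed_comp; last exact: closed_le.
move=> z _; apply: (@cvg_comp _ _ _ fst (fun x : E => `|x|) _ (nbhs z.1)).
  exact: cvg_fst.
exact: norm_continuous.
Qed.

Definition Q1X : set (borel X) := @Q1 R d `*` setT.

Definition openQ1X : set (borel X) := [set z : X | `|z.1| < 2^-1].

Lemma Q1XE : Q1X = [set z : X | `|z.1| <= 2^-1].
Proof. by rewrite /Q1X Q1E; apply/seteqP; split=> [z []|z]. Qed.

Lemma measurable_Q1X : measurable Q1X.
Proof. by rewrite Q1XE; apply: closed_borel; exact: closed_fst_le. Qed.

Lemma open_openQ1X : open (openQ1X : set X).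
Proof.
rewrite (_ : openQ1X = ~` [set z : X | 2^-1 <= `|z.1|]).
  rewrite openC (_ : [set _ | _] = (fun z : X => `|z.1|) @^-1` [set y | 2^-1 <= y])//.
  apply: closed_comp; last exact: closed_ge.
  move=> z _; apply: (@cvg_comp _ _ _ fst (fun x : E => `|x|) _ (nbhs z.1)).
    exact: cvg_fst.
  exact: norm_continuous.
by apply/seteqP; split=> z; rewrite /openQ1X /= ltNge => /negP.
Qed.

Lemma measurable_openQ1X : measurable openQ1X.
Proof. by apply: open_borel; exact: open_openQ1X. Qed.

Hypothesis hK : separable K.

Lemma continuous_shift_fixed (y : E) : continuous (shiftm y : M -> M).
Proof.
move=> mu; have h : (fun mu' : M => (y, mu')) @ mu --> ((y, mu) : E * M).
  have h1 : (fun _ : M => y) @ mu --> y by exact: cst_continuous.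
  have h2 : (fun mu' : M => mu') @ mu --> mu by exact: cvg_id.
  by have := cvg_pair h1 h2; exact.
exact: (cvg_comp _ _ h (@continuous_shift_joint _ _ _ hK (y, mu))).
Qed.

Lemma measurable_shift (y : E) : measurable_fun setT (shiftm y : borel M -> borel M).
Proof.
by apply: continuous_borel; exact: continuous_shift_fixed.
Qed.

Lemma stationary_integral P (f : M -> \bar R) (y : E) : stationary P ->
  measurable_fun setT (f : borel M -> \bar R) -> (forall mu, (0 <= f mu)%E) ->
  (\int[P]_mu f (shiftm y mu) = \int[P]_mu f mu)%E.
Proof.
move=> sP mf f0.
have mS := measurable_shift y.
rewrite -(@ge0_integral_pushforward _ _ (borel M) (borel M) R (shiftm y) mS P setT f)//.
by apply: eq_measure_integral => A mA _; exact: sP.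
Qed.

(* [H] does not occur in the body: sigma-additivity needs separability, and the
   argument lets the measure structure be attached to this constant. *)
Definition mean_measure (H : separable K) P (C : set (borel X)) : \bar R :=
  (\int[P]_mu (mu : M) C)%E.

Section mean_measure_instance.
Variable P : law.

Let mean0 : mean_measure hK P set0 = 0%E.
Proof. by apply: integral0_eq => mu _; rewrite measure0. Qed.

Let mean_ge0 C : (0 <= mean_measure hK P C)%E.
Proof. exact: integral_ge0. Qed.

Let mean_sigma_additive : semi_sigma_additive (mean_measure hK P).
Proof.
move=> F mF tF mUF.
have -> : mean_measure hK P (\bigcup_n F n) =
    (\sum_(n <oo) mean_measure hK P (F n))%E.
  rewrite /mean_measure -integral_nneseries//; last first.
    by move=> n; exact: measurable_eval.
  by apply: eq_integral => mu _; rewrite measure_semi_bigcup.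
by apply: is_cvg_nneseries.
Qed.

HB.instance Definition _ := isMeasure.Build _ _ _
  (mean_measure hK P) mean0 mean_ge0 mean_sigma_additive.

End mean_measure_instance.

Lemma intensityE P : intensity P = mean_measure hK P Q1X.
Proof. by []. Qed.

Lemma mean_shift P (y : E) (C : set (borel X)) : stationary P -> measurable C ->
  mean_measure hK P (shift_pt y @^-1` C) = mean_measure hK P C.
Proof.
move=> sP mC; rewrite /mean_measure.
rewrite -[RHS](stationary_integral y sP)//; last exact: measurable_eval.
by apply: eq_integral => mu _; rewrite shiftE.
Qed.

(** [N] counts unit cubes covering the ball and does not depend on the law. This uniformity yields
    the bounds for tightness and the finiteness of the intensity of a limit. *)
Lemma mean_bounded (r : R) : exists N : nat, forall P, stationary P ->
  (mean_measure hK P [set z : X | `|z.1| <= r]%R <= N%:R%:E * intensity P)%E.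
Proof.
have := @rV_closed_ball_compact R d r.
rewrite compact_cover => /(_ E setT (fun y => [set x : E | `|x - y| < 2^-1])).
case=> [y _|x _|D _ rD].
- rewrite (_ : [set _ | _] = ball y 2^-1); first exact: ball_open.
  by apply/seteqP; split=> x; rewrite mx_norm_ball /ball_ /= distrC.
- by exists x => //=; rewrite subrr normr0.
exists (size (D : seq E)) => P sP.
have mF (y : E) : measurable (shift_pt y @^-1` Q1X : set (borel X)).
  apply: preimage_measurable measurable_Q1X; exact: measurable_shift_pt.
apply: (@le_trans _ _ (\sum_(y <- (D : seq E))
    mean_measure hK P (shift_pt y @^-1` Q1X))%E).
  apply: (@le_measure_seq R _ (borel X) (mean_measure hK P)) => //.
    by apply: closed_borel; exact: closed_fst_le.
  move=> z /= /rD[y /= yD zy]; exists y => //.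
  by rewrite Q1XE /= ltW.
rewrite (eq_bigr (fun=> intensity P)); last first.
  by move=> y _; rewrite mean_shift//; exact: measurable_Q1X.
rewrite big_const_seq count_predT; elim: (size _) => [|n ih].
  by rewrite /= mul0e.
rewrite iterS -addn1 natrD EFinD ge0_muleDl ?lee_fin//.
by rewrite mul1e addeC leeD2r.
Qed.

Lemma mean_bounded_lty P (r : R) : stationary P -> (intensity P < +oo)%E ->
  (mean_measure hK P [set z : X | `|z.1| <= r]%R < +oo)%E.
Proof.
move=> sP Ioo; have [N /(_ P sP) hN] := mean_bounded r.
apply: le_lt_trans hN _; rewrite lte_mul_pinfty ?lee_fin//.
Qed.

Definition face (p : 'I_d * bool) : set (borel X) :=
  [set z : X | Q1 z.1 /\ z.1 ord0 p.1 = (-1) ^+ p.2 * 2^-1].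

Lemma measurable_face p : measurable (face p).
Proof.
rewrite (_ : face p = Q1X `&` ((fun z : X => z.1 ord0 p.1) @^-1` [set (-1) ^+ p.2 * 2^-1])).
  apply: measurableI; first exact: measurable_Q1X.
  apply: closed_borel; apply: closed_comp; last exact: closed_eq.
  move=> z _; apply: (@cvg_comp _ _ _ fst (fun x : E => x ord0 p.1) _ (nbhs z.1)).
    exact: cvg_fst.
  exact: coord_continuous.
by apply/seteqP; split=> [z [? ?]|z [[? _] ?]].
Qed.

(* The inward translates of a face of the cube are disjoint subsets of it. *)
Lemma face_null P p : stationary P -> (intensity P < +oo)%E ->
  mean_measure hK P (face p) = 0%E.
Proof.
case: p => i b sP Ioo.
set s : R := (-1) ^+ b.
have s1 : `|s| = 1 by rewrite /s normrX normrN1 expr1n.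
(* The denominators start at 2, so a face moves inward by at most 1/2 and stays in the cube. *)
pose t (n : nat) : E := (- (s * n.+2%:R^-1)) *: delta_mx ord0 i.
have mS n : measurable (shift_pt (t n) @^-1` face (i, b) : set (borel X)).
  by apply: preimage_measurable (measurable_face _); exact: measurable_shift_pt.
apply: (@null_of_disjoint_copies R _ (borel X) (mean_measure hK P)
   (fun n => shift_pt (t n) @^-1` face (i, b)) Q1X).
- exact: measurable_Q1X.
- by [].
- by [].
- have fi n z : (shift_pt (t n) @^-1` face (i, b)) z ->
      z.1 ord0 i = s * 2^-1 - s * n.+2%:R^-1.
    by move=> [_ /=]; rewrite !mxE !eqxx mulr1 => <-; rewrite opprK addrK.
  apply/trivIsetP => n m _ _ nm; apply/seteqP; split=> // z [/fi zn /fi zm].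
  move: nm => /negP; apply; move: zn; rewrite zm.
  have s0 : s != 0 by rewrite -normr_gt0 s1.
  move/addrI/oppr_inj/(mulfI s0)/invr_inj/eqP.
  by rewrite eqr_nat !eqSS eq_sym.
- move=> n z [Qz /= zi]; split => // j; have := Qz j; move: zi.
  rewrite !mxE /= eqxx; have [->|ji] := eqVneq j i; last first.
    by rewrite mulr0 subr0.
  rewrite mulr1 opprK => zi _.
  have -> : z.1 ord0 i = s * (2^-1 - n.+2%:R^-1).
    by rewrite mulrBr -/s -zi addrK.
  rewrite normrM s1 mul1r ger0_norm ?gerBl//.
  by rewrite subr_ge0 lef_pV2 ?posrE// ler_nat.
- by move=> n; apply: mean_shift => //; exact: measurable_face.
Qed.

(** A point of the closed cube outside the open one has norm 1/2, attained at some coordinate whose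
    sign selects a face; the faces are finitely many and null. *)
Lemma mean_openQ1X P : stationary P -> (intensity P < +oo)%E ->
  mean_measure hK P openQ1X = intensity P.
Proof.
move=> sP Ioo; apply/eqP; rewrite eq_le; apply/andP; split.
  apply: (@le_measure _ _ _ (mean_measure hK P)).
  - by apply/mem_set; exact: measurable_openQ1X.
  - by apply/mem_set; exact: measurable_Q1X.
  - by rewrite -/Q1X Q1XE => z /= /ltW.
rewrite intensityE.
have -> : mean_measure hK P openQ1X = (mean_measure hK P openQ1X +
    \sum_(p <- enum {: 'I_d * bool}) mean_measure hK P (face p))%E.
  by rewrite big1 ?adde0// => p _; rewrite face_null.
(* In the covering family, [None] stands for the open cube and [Some p] for a face. *)
have := @le_measure_seq R _ (borel X) (mean_measure hK P) _
  (None :: map Some (enum {: 'I_d * bool}))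
  (fun o => if o is Some p then face p else openQ1X) Q1X.
rewrite big_cons big_map; apply.
- exact: measurable_Q1X.
- by case=> [p|]; [exact: measurable_face|exact: measurable_openQ1X].
- move=> z; rewrite Q1XE /= => zQ.
  have [zlt|zge] := ltP `|z.1| 2^-1; first by exists None; rewrite ?in_cons.
  have z1 : `|z.1| = 2^-1 by apply/eqP; rewrite eq_le zQ zge.
  have : mx_norm z.1 != 0 by rewrite -[mx_norm _]/(`|z.1|) z1 gt_eqF.
  move=> /mx_norm_neq0[[i j]] /= zij; rewrite (ord1 i) in zij.
  have {}zij : `|z.1 ord0 j| = 2^-1 by rewrite -zij -z1.
  exists (Some (j, z.1 ord0 j < 0)).
    by rewrite in_cons /= map_f// mem_enum.
  split; first by have [] : Q1X z by rewrite Q1XE.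
  rewrite /= -zij; have [?|?] := ltP (z.1 ord0 j) 0.
    by rewrite ltr0_norm// expr1 mulN1r opprK.
  by rewrite ger0_norm// expr0 mul1r.
Qed.

End laws.

(** * Palm measures *)

Section palm_measure.
Context {R : realType} {d : nat} {K : completeMetricType R}.

Local Notation E := 'rV[R]_d.
Local Notation X := ('rV[R]_d * K)%type.
Local Notation M := (bfmeasure d K).
Local Notation shiftm := Defs.shift.
Local Notation law := (probability (borel M) R).
Implicit Types (f g : X -> R) (mu nu : M) (P : law).

Hypothesis hK : separable K.

(** With [B] the cylinder over the cube, the mean of this functional is the intensity times the Palm
    mean of [phi], if the intensity is positive and finite. *)
Definition int_shift (B : set (borel X)) (phi : M -> R) mu : \bar R :=
  (\int[bfm mu]_z (\1_B z * phi (shiftm z.1 mu))%:E)%E.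

Lemma int_shift_ge0 B (phi : M -> R) mu :
  (forall nu, 0 <= phi nu) -> (0 <= int_shift B phi mu)%E.
Proof. by move=> p0; apply: integral_ge0 => z _; rewrite lee_fin mulr_ge0 ?indicE. Qed.

Lemma measurable_int_shift_integrand (B : set (borel X)) (phi : M -> R) mu :
  measurable B -> measurable_fun setT (phi : borel M -> R) ->
  measurable_fun setT (fun z : borel X => \1_B z * phi (shiftm z.1 mu)).
Proof.
move=> mB mphi; apply: measurable_funM => //.
exact: (measurableT_comp mphi (measurable_shift_pos hK mu)).
Qed.

(** Reduces [phi] to indicators of Borel sets of measures, for which measurability in [mu] is
    known. *)
Lemma int_shift_series (B : set (borel X)) (phi : M -> R) mu :
  measurable B -> measurable_fun setT (phi : borel M -> R) ->
  (forall nu, 0 <= phi nu <= 1) ->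
  (int_shift B phi mu = \sum_(k <oo) (2^-1 ^+ k.+1)%:E *
     int_shift B \1_(binary_digit phi k : set M) mu)%E.
Proof.
move=> mB mphi phi01; rewrite /int_shift.
have c0 k : 0 <= 2^-1 ^+ k.+1 :> R by rewrite exprn_ge0// invr_ge0.
have mD k := measurable_binary_digit mphi k.
have mI k : measurable_fun setT (fun z : borel X =>
    \1_B z * \1_(binary_digit phi k : set M) (shiftm z.1 mu) : R).
  by apply: measurable_int_shift_integrand => //; exact: measurable_indic.
transitivity (\int[bfm mu]_z \sum_(k <oo) (2^-1 ^+ k.+1)%:E *
    (\1_B z * \1_(binary_digit phi k : set M) (shiftm z.1 mu))%:E)%E.
  apply: eq_integral => z _; rewrite EFinM (@binary_series R _ (borel M) phi phi01).
  rewrite -nneseriesZl; last by move=> k _; rewrite lee_fin mulr_ge0 ?indicE.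
  by apply: eq_eseriesr => k _; rewrite -!EFinM mulrCA.
rewrite integral_nneseries//.
- apply: eq_eseriesr => k _; rewrite ge0_integralZl//.
  + by apply/measurable_EFinP.
- by move=> k; apply: measurable_funeM; apply/measurable_EFinP.
Qed.

Lemma measurable_int_shift_fun (B : set (borel X)) (phi : M -> R) :
  measurable B -> measurable_fun setT (phi : borel M -> R) ->
  (forall nu, 0 <= phi nu <= 1) ->
  measurable_fun setT (int_shift B phi : borel M -> \bar R).
Proof.
move=> mB mphi phi01; rewrite (_ : int_shift B phi = (fun mu : M =>
  \sum_(k <oo) (2^-1 ^+ k.+1)%:E * int_shift B \1_(binary_digit phi k : set M) mu)%E).
  apply: (@ge0_emeasurable_sum _ (borel M) R setT (fun k mu => (2^-1 ^+ k.+1)%:E *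
     int_shift B \1_(binary_digit phi k : set M) mu)%E xpredT).
    move=> k mu _ _; rewrite mule_ge0 ?lee_fin ?exprn_ge0 ?invr_ge0//.
    by apply: int_shift_ge0 => nu; rewrite indicE.
  move=> k _; apply: measurable_funeM; apply: measurable_int_shift => //.
  exact: measurable_binary_digit.
by apply/funext => mu; exact: int_shift_series.
Qed.

(* The argument [H] plays the same role as in [mean_measure]. *)
Definition palm_measure (H : separable K) P (A : set (borel M)) : \bar R :=
  palm P A.

Lemma indic_Q1X (z : X) : \1_(@Q1X R d K) z = \1_(@Q1 R d) z.1 :> R.
Proof.
rewrite !indicE; congr (nat_of_bool _)%:R.
by apply/idP/idP => [/set_mem[? _]|/set_mem ?]; apply/mem_set.
Qed.

Lemma palmE P (A : set (borel M)) :
  palm P A = ((fine (intensity P))^-1%:E * \int[P]_mu int_shift (@Q1X R d K) \1_A mu)%E.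
Proof.
rewrite /palm; apply: (f_equal (mule _)); apply: eq_integral => mu _.
by apply: eq_integral => z _; rewrite indic_Q1X.
Qed.

Lemma intensity_ge0 P : (0 <= intensity P)%E.
Proof. exact: integral_ge0. Qed.

Lemma invr_intensity_ge0 P : 0 <= (fine (intensity P))^-1.
Proof. by rewrite invr_ge0 fine_ge0// intensity_ge0. Qed.

Section palm_measure_instance.
Variable P : law.

Let palm0 : palm_measure hK P set0 = 0%E.
Proof.
rewrite /palm_measure palmE integral0_eq ?mule0// => mu _.
by apply: integral0_eq => z _; rewrite indic0 mulr0.
Qed.

Let palm_ge0 A : (0 <= palm_measure hK P A)%E.
Proof.
rewrite /palm_measure palmE mule_ge0 ?lee_fin ?invr_intensity_ge0//.
apply: integral_ge0 => mu _; apply: int_shift_ge0 => nu; by rewrite indicE.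
Qed.

Let palm_sigma_additive : semi_sigma_additive (palm_measure hK P).
Proof.
move=> F mF tF mUF.
have -> : palm_measure hK P (\bigcup_n F n) =
    (\sum_(n <oo) palm_measure hK P (F n))%E.
  rewrite /palm_measure palmE.
  transitivity ((fine (intensity P))^-1%:E *
    \sum_(n <oo) \int[P]_mu int_shift (@Q1X R d K) \1_(F n) mu)%E; last first.
    rewrite -nneseriesZl; last first.
      move=> n _; apply: integral_ge0 => mu _; apply: int_shift_ge0 => nu.
      by rewrite indicE.
    by apply: eq_eseriesr => n _; rewrite palmE.
  congr (_ * _)%E; rewrite -integral_nneseries//; last 2 first.
  - by move=> n; apply: measurable_int_shift => //; exact: measurable_Q1X.
  - by move=> n mu _; apply: int_shift_ge0 => nu; rewrite indicE.
  apply: eq_integral => mu _.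
  apply: (@weighted_integral_bigcup _ _ _ _ (borel M) _ _
    (fun z : borel X => shiftm z.1 mu)) => //.
  - by apply: measurable_indic; exact: measurable_Q1X.
  - exact: measurable_shift_pos.
by apply: is_cvg_nneseries.
Qed.

HB.instance Definition _ := isMeasure.Build _ _ _
  (palm_measure hK P) palm0 palm_ge0 palm_sigma_additive.

End palm_measure_instance.

Lemma palm_measureE P A : palm_measure hK P A = palm P A.
Proof. by []. Qed.

Local Opaque palm_measure.

(* Binary expansion of [phi] reduces integrals over [palm P] to its values on
   sets. *)
Lemma palm_integral P (phi : M -> R) :
  measurable_fun setT (phi : borel M -> R) -> (forall nu, 0 <= phi nu <= 1) ->
  (\int[palm_measure hK P]_mu (phi mu)%:E =
   (fine (intensity P))^-1%:E * \int[P]_mu int_shift (@Q1X R d K) phi mu)%E.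
Proof.
move=> mphi phi01; have mQ := @measurable_Q1X R d K.
have mD k := measurable_binary_digit mphi k.
have c0 k : 0 <= 2^-1 ^+ k.+1 :> R by rewrite exprn_ge0// invr_ge0.
have i0 k mu : (0 <= int_shift (@Q1X R d K) \1_(binary_digit phi k : set M) mu)%E.
  by apply: int_shift_ge0 => nu; rewrite indicE.
have mi k : measurable_fun setT
    (int_shift (@Q1X R d K) \1_(binary_digit phi k : set M) : borel M -> \bar R).
  by apply: measurable_int_shift.
transitivity (\sum_(k <oo) (2^-1 ^+ k.+1)%:E * palm_measure hK P (binary_digit phi k))%E.
  transitivity (\int[palm_measure hK P]_mu
      \sum_(k <oo) (2^-1 ^+ k.+1)%:E * (\1_(binary_digit phi k : set M) mu)%:E)%E.
    apply: eq_integral => mu _; rewrite (@binary_series R _ (borel M) phi phi01).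
    by apply: eq_eseriesr => k _; rewrite EFinM.
  rewrite integral_nneseries//.
  - apply: eq_eseriesr => k _; rewrite ge0_integralZl//.
    + congr (_ * _)%E.
      rewrite (@integral_indic _ (borel M) R (palm_measure hK P) setT measurableT _ (mD k)).
      by rewrite setIT.
    + by apply/measurable_EFinP; exact: measurable_indic.
  - by move=> k; apply: measurable_funeM; apply/measurable_EFinP; exact: measurable_indic.
transitivity ((fine (intensity P))^-1%:E * \sum_(k <oo) (2^-1 ^+ k.+1)%:E *
    \int[P]_mu int_shift (@Q1X R d K) \1_(binary_digit phi k : set M) mu)%E.
  rewrite -nneseriesZl; last first.
    by move=> k _; rewrite mule_ge0 ?lee_fin//; apply: integral_ge0.
  by apply: eq_eseriesr => k _; rewrite palm_measureE palmE muleCA.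
congr (_ * _)%E.
under [RHS]eq_integral do rewrite (int_shift_series _ mQ mphi phi01).
rewrite integral_nneseries//.
- by apply: eq_eseriesr => k _; rewrite ge0_integralZl.
- by move=> k; apply: measurable_funeM.
- by move=> k mu _; rewrite mule_ge0 ?lee_fin.
Qed.

End palm_measure.

(** * Limits of stationary marked point processes *)

Section integer_limits.
Context {R : realType}.

(** If [r] differed from an integer [n] within 1/4 of it, an integer within half of [|r - n|] would
    be less than 1 away from [n], hence equal to [n], which is absurd. *)
Lemma nat_of_approx (r : R) :
  (forall e : R, 0 < e -> exists n : nat, `|r - n%:R| <= e) ->
  exists n : nat, r = n%:R.
Proof.
move=> ra; have [|n rn] := ra (1 / 4); first by rewrite divr_gt0.
exists n; apply/eqP/negPn/negP => rNn.
have rn0 : 0 < `|r - n%:R| / 2 by rewrite divr_gt0// normr_gt0 subr_eq0.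
have [m rm] := ra _ rn0.
have nm : `|n%:R - m%:R| < 1 :> R.
  have := ler_normB (r - m%:R) (r - n%:R).
  by rewrite opprB addrC -addrA (addrA (- r)) addNr add0r addrC; lra.
have [nm1|nm1|nm1] := ltngtP n m.
- have : n.+1%:R <= m%:R :> R by rewrite ler_nat.
  by rewrite -natr1; move: nm; rewrite ltr_norml => /andP[]; lra.
- have : m.+1%:R <= n%:R :> R by rewrite ler_nat.
  by rewrite -natr1; move: nm; rewrite ltr_norml => /andP[]; lra.
- by move: rm; rewrite -nm1; lra.
Qed.

Lemma nat_of_series (a : nat -> nat) :
  (\sum_(k <oo) (a k)%:R%:E < +oo :> \bar R)%E ->
  exists n : nat, (\sum_(k <oo) (a k)%:R%:E = n%:R%:E :> \bar R)%E.
Proof.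
move=> soo; set s := limn _ in soo *.
have a0 k : (0 <= (a k)%:R%:E :> \bar R)%E by rewrite lee_fin.
have sfin : s \is a fin_num.
  by rewrite ge0_fin_numE//; apply: nneseries_ge0 => n _ _; exact: a0.
have scvg : (\sum_(0 <= k < n) (a k)%:R%:E)%E @[n --> \oo] --> (fine s)%:E.
  rewrite fineK//.
  exact: (@is_cvg_nneseries R (fun k => (a k)%:R%:E) xpredT 0 (fun n _ _ => a0 n)).
have [n sn] : exists n : nat, fine s = n%:R.
  apply: nat_of_approx => e e0.
  have h : (fine \o (fun n => \sum_(0 <= k < n) (a k)%:R%:E)%E) @ \oo --> fine s.
    exact: fine_cvg scvg.
  have /cvgrPdist_le/(_ e e0)[N _ /(_ N (leqnn N))/=] := h.
  by rewrite sumEFin /= -natr_sum => h'; eexists; exact: h'.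
by exists n; rewrite -sn fineK.
Qed.

End integer_limits.

Section closedness.
Context {R : realType} {d : nat} {K : completeMetricType R}.

Local Notation E := 'rV[R]_d.
Local Notation X := ('rV[R]_d * K)%type.
Local Notation M := (bfmeasure d K).
Local Notation shiftm := Defs.shift.
Local Notation law := (probability (borel M) R).
Implicit Types (f g : X -> R) (mu nu : M) (P : law).

Hypothesis hK : separable K.

Lemma test_le_measure mu f (V : set (borel X)) : test_fun f -> measurable V ->
  (forall z, f z <= \1_V z) -> ((\int[mu]_z f z)%:E <= mu V)%E.
Proof.
move=> tf mV fV; rewrite -test_intE//; have [_ f0 _ _] := tf.
rewrite -[X in (_ <= mu X)%E]setIT -(@integral_indic _ _ R mu setT)//.
apply: ge0_le_integral => //.
- by move=> z _; rewrite lee_fin.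
- by apply/measurable_EFinP; exact: measurable_test.
- by apply/measurable_EFinP; exact: measurable_indic.
- by move=> z _; rewrite lee_fin.
Qed.

Lemma measure_le_test mu f (V : set (borel X)) : test_fun f -> measurable V ->
  (forall z, \1_V z <= f z) -> (mu V <= (\int[mu]_z f z)%:E)%E.
Proof.
move=> tf mV Vf; rewrite -test_intE//; have [_ f0 _ _] := tf.
rewrite -[X in (mu X <= _)%E]setIT -(@integral_indic _ _ R mu setT)//.
apply: ge0_le_integral => //.
- by apply/measurable_EFinP; exact: measurable_indic.
- by apply/measurable_EFinP; exact: measurable_test.
- by move=> z _; rewrite lee_fin.
Qed.

Lemma indic_le (T : Type) (V : set T) (f : T -> R) :
  (forall z, 0 <= f z) -> (forall z, V z -> 1 <= f z) ->
  forall z, \1_V z <= f z.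
Proof.
move=> f0 f1 z; rewrite indicE; have [/set_mem|] := boolP (z \in V); [exact: f1|].
by move=> _; exact: f0.
Qed.

Lemma le_indic (T : Type) (V : set T) (f : T -> R) :
  (forall z, f z <= 1) -> (forall z, ~ V z -> f z <= 0) ->
  forall z, f z <= \1_V z.
Proof.
move=> f1 f0 z; rewrite indicE; have [_|/negP zV] := boolP (z \in V); first exact: f1.
by apply: f0 => Vz; apply: zV; exact/mem_set.
Qed.

(* For [u] between 0 and 1 and 1_U, with [\int u] close to [mu U], the integral of
   [g = max 0 (2 u - 1)] is also close to [mu U], and the nearby integer-valued
   measures have the integer mass of [1/2 < u] between those of [g] and
   [min 1 (2 u)]. *)
Lemma integer_open_limit mu (U : set X) :
  closure [set nu : M | integer_valued nu] mu -> open U -> bdd U ->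
  exists n : nat, mu U = n%:R%:E.
Proof.
move=> clmu oU bU; have mU := open_borel oU.
have Ufin : mu U \is a fin_num by rewrite ge0_fin_numE// bfm_fin.
suff [n Un] : exists n : nat, fine (mu U) = n%:R by exists n; rewrite -Un fineK.
apply: nat_of_approx => e e0.
(* Replacing [1_U] by [g] costs at most twice the defect of [u], which is below [e / 3]; passing
   from [mu] to [nu] costs another third. *)
have e30 : 0 < e / 3 by rewrite divr_gt0.
have [u [cu u01 ndu uU]] := open_X_approx hK oU.
have [chi tchi chi1] := bdd_test hK bU.
have [_ chi0 _ _] := tchi.
have u_le1 n z : u n z <= 1 by have /andP[] := u01 n z.
have u_ge0 n z : 0 <= u n z by have /andP[] := u01 n z.
have u_U n z : u n z <= \1_U z.
  rewrite -(cvg_lim _ (uU z))//; apply: (nondecreasing_cvgn_le (ndu z)).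
  by apply/cvg_ex; exists (\1_U z); exact: uU.
have u_out n z : ~ U z -> u n z = 0.
  move=> Uz; apply/eqP; rewrite eq_le u_ge0 andbT (le_trans (u_U n z))//.
  by rewrite indicE memNset.
have testU f : continuous f -> (forall z, 0 <= f z) -> (forall z, f z <= \1_U z) ->
    test_fun f.
  move=> cf f0 fU; apply: (test_fun_le cf f0 _ tchi) => z.
  by apply: le_trans (fU z) _; exact: indic_le.
have tu n : test_fun (u n) by apply: testU.
have : (\int[mu]_z (u n z)%:E @[n --> \oo] --> \int[mu]_z (\1_U z)%:E)%E.
  apply: nd_cvg_integral => // n; exact: continuous_measurable_real.
rewrite integral_indic// setIT -(fineK Ufin) => /fine_cvg/cvgrPdist_lt/(_ _ e30).
case=> m _ /(_ m (leqnn m)) /=; rewrite -/(Rintegral _ _ _) ltr_norml => /andP[_ um].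
pose g z := Num.max 0 (2 * u m z - 1).
pose h z := Num.min 1 (2 * u m z).
have tg : test_fun g.
  apply: testU => [|z|].
  - apply: continuous_maxr; first exact: cst_continuous.
    by apply: continuous_subr; apply: continuous_mulr.
  - by rewrite le_max lexx.
  - apply: le_indic => z; rewrite /g ge_max; first by rewrite ler01/=; have := u_le1 m z; lra.
    by move=> Uz; rewrite u_out// mulr0 sub0r lexx/= lerN10.
have th : test_fun h.
  apply: testU => [|z|].
  - by apply: continuous_minr; [exact: cst_continuous|apply: continuous_mulr].
  - by rewrite le_min ler01 mulr_ge0.
  - by apply: le_indic => z; rewrite /h ge_min ?lexx// => Uz; rewrite u_out// mulr0 lexx orbT.
pose V := [set z | 1 / 2 < u m z].
have oV : open V.
  rewrite (_ : V = u m @^-1` [set y | 1 / 2 < y])//.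
  by apply: open_comp; [move=> w _; exact: cu|exact: open_gt].
have mV := open_borel oV.
have VU : V `<=` U.
  by move=> z; rewrite /V /= => zV; apply: contrapT => /u_out uz; move: zV; rewrite uz; lra.
have hmu : \int[mu]_z h z <= fine (mu U).
  rewrite -lee_fin (fineK Ufin); apply: (test_le_measure mu th mU).
  by apply: le_indic => z; rewrite /h ge_min ?lexx// => Uz; rewrite u_out// mulr0 lexx orbT.
have gmu : 2 * \int[mu]_z u m z <= \int[mu]_z g z + fine (mu U).
  rewrite -test_RintZ// -lee_fin EFinD -!test_intE//; last exact: test_funZ.
  rewrite fineK// -[X in (_ <= _ + mu X)%E]setIT -(@integral_indic _ _ R mu setT)//.
  rewrite -ge0_integralD//.
  - apply: ge0_le_integral => //.
    + by move=> z _; rewrite lee_fin mulr_ge0.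
    + by apply/measurable_EFinP; apply: measurable_test; exact: test_funZ.
    + apply: emeasurable_funD; apply/measurable_EFinP; first exact: measurable_test.
      exact: measurable_indic.
    + move=> z _; rewrite -EFinD lee_fin /g indicE.
      have [/set_mem Uz|/negP Uz] := boolP (z \in U).
        by rewrite -lerBlDr le_max lexx orbT.
      by rewrite u_out ?mulr0 ?addr0 ?le_max ?lexx// => Uz'; apply: Uz; exact/mem_set.
  - by move=> z _; rewrite lee_fin le_max lexx.
  - by apply/measurable_EFinP; exact: measurable_test.
  - by apply/measurable_EFinP; exact: measurable_indic.
have := clmu [set nu : M | `|\int[mu]_z g z - \int[bfm nu]_z g z| < e / 3 /\
  `|\int[mu]_z h z - \int[bfm nu]_z h z| < e / 3].
case.
  apply: filterI.
    by have /cvgrPdist_lt := @continuous_test_int _ _ _ _ tg mu; apply.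
  by have /cvgrPdist_lt := @continuous_test_int _ _ _ _ th mu; apply.
move=> nu [/(_ V mV (bdd_subset VU bU))[n nuV] []].
have gn : \int[bfm nu]_z g z <= n%:R.
  rewrite -lee_fin -nuV; apply: test_le_measure => //.
  apply: le_indic => z; rewrite /g ge_max; first by rewrite ler01/=; have := u_le1 m z; lra.
  by rewrite /V /= => /negP; rewrite -leNgt lexx/=; lra.
have hn : n%:R <= \int[bfm nu]_z h z.
  rewrite -lee_fin -nuV; apply: measure_le_test => //.
  apply: indic_le => z; first by rewrite le_min ler01 mulr_ge0.
  by rewrite /V /= /h le_min lexx/=; lra.
rewrite !ltr_norml => /andP[g1 g2] /andP[h1 h2]; exists n.
move: um gmu hmu gn hn g1 g2 h1 h2; rewrite -/(Rintegral _ _ _).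
move: (fine _) (Rintegral _ _ _) (Rintegral _ _ _) (Rintegral _ _ _).
move: (Rintegral _ _ _) (Rintegral _ _ _).
move=> {}mU I1 I2 I3 I4 I5 *; rewrite ler_norml; apply/andP; split; lra.
Qed.

(** A bounded open set [G] around [B], the positivity set of a test function, localizes the Dynkin
    argument: masses inside [G] are finite, so complements are differences of integers and disjoint
    unions are finite sums of series of integers. *)
Lemma closed_integer_valued : closed [set mu : M | integer_valued mu].
Proof.
move=> mu clmu B mB bB.
have [chi tchi chi1] := bdd_test hK bB; have [cchi chi0 _ schi] := tchi.
pose G := [set z | 0 < chi z].
have oG : open G.
  rewrite (_ : G = chi @^-1` [set y | 0 < y])//.
  by apply: open_comp; [move=> w _; exact: cchi|exact: open_gt].
have mG := open_borel oG.
have bG : bdd G.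
  apply: bdd_subset schi => z Gz; apply: subset_closure => /=.
  by rewrite gt_eqF.
have BG : B `<=` G by move=> z /chi1; exact: lt_le_trans.
have Gfin : (mu G < +oo)%E by exact: bfm_fin.
suff : exists n : nat, mu (B `&` G) = n%:R%:E by rewrite setIidl.
move: B mB {bB chi1 BG}; apply: borel_induction.
- move=> A oA; apply: integer_open_limit => //; first exact: openI.
  by apply: bdd_subset bG => z [].
- move=> A mA [a Aa].
  have [n Gn] : exists n : nat, mu G = n%:R%:E by exact: integer_open_limit.
  have : mu G = (mu (A `&` G) + mu (~` A `&` G))%E.
    rewrite -measureU//; first by rewrite -setIUl setUv setTI.
    + exact: measurableI.
    + by apply: measurableI => //; exact: measurableC.
    + by rewrite setIACA setICr set0I.
  rewrite Gn Aa => nax; exists (n - a)%N.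
  have xfin : mu (~` A `&` G) \is a fin_num.
    rewrite ge0_fin_numE//; apply: le_lt_trans Gfin.
    apply: le_measure; try apply/mem_set => //.
      by apply: measurableI => //; exact: measurableC.
    by move=> z [].
  move: nax; rewrite -(fineK xfin) -EFinD => -[nax].
  have an : (a <= n)%N.
    by rewrite -(ler_nat R) nax lerDl fine_ge0.
  by rewrite natrB// nax addrAC subrr add0r.
- move=> F mF tF /choice[a Fa].
  have mFG n : measurable (F n `&` G) by exact: measurableI.
  have E0 : mu (\bigcup_n F n `&` G) = (\sum_(n <oo) (a n)%:R%:E)%E.
    rewrite setI_bigcupl measure_semi_bigcup//.
    + by apply: eq_eseriesr => n _; rewrite Fa.
    + apply/trivIsetP => i j _ _ ij; move/trivIsetP : tF => /(_ i j I I ij).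
      by rewrite setIACA => ->; rewrite set0I.
    + exact: bigcupT_measurable.
  rewrite E0; apply: nat_of_series; rewrite -E0; apply: le_lt_trans Gfin.
  apply: le_measure; try apply/mem_set => //.
    by apply: measurableI => //; exact: bigcupT_measurable.
  by move=> z [].
Qed.

(** For [psi n] approximating an open set, the means of [psi n] and of its composition with the
    shift agree along the sequence. Both functions are bounded and continuous, so the means agree in
    the limit too. *)
Lemma stationary_closed (P_ : nat -> law) P :
  (forall n, stationary (P_ n)) -> cvg_in_law P_ P -> stationary P.
Proof.
move=> sP PP y; have mS := measurable_shift hK y.
have mSA (A : set (borel M)) : measurable A -> measurable (shiftm y @^-1` A : set (borel M)).
  by move=> mA; exact: preimage_measurable mA.
apply: borel_induction.
- move=> O oO; have [psi [cpsi psi01 ndpsi psiO]] := open_bfmeasure_approx hK oO.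
  have psi0 n mu : 0 <= psi n mu by have /andP[] := psi01 n mu.
  have mpsi n : measurable_fun setT (psi n : borel M -> R).
    exact: continuous_measurable_real.
  have cS n : continuous (fun mu : M => psi n (shiftm y mu)).
    move=> mu; exact: (cvg_comp _ _ (@continuous_shift_fixed _ _ _ hK y mu) (cpsi n _)).
  have bpsi n : bounded_fun (psi n).
    exists 1; split; first exact: num_real.
    move=> x x1 mu _ /=; rewrite ger0_norm// (le_trans _ (ltW x1))//.
    by have /andP[] := psi01 n mu.
  have bS n : bounded_fun (fun mu : M => psi n (shiftm y mu)).
    exists 1; split; first exact: num_real.
    move=> x x1 mu _ /=; rewrite ger0_norm// (le_trans _ (ltW x1))//.
    by have /andP[] := psi01 n (shiftm y mu).
  have e n : (\int[P]_mu (psi n (shiftm y mu))%:E = \int[P]_mu (psi n mu)%:E)%E.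
    have h1 := PP _ (cpsi n) (bpsi n); have h2 := PP _ (cS n) (bS n).
    apply: (cvg_unique _ h2); first exact: ereal_hausdorff.
    suff <- : (fun k => \int[P_ k]_mu (psi n mu)%:E)%E =
              (fun k => \int[P_ k]_mu (psi n (shiftm y mu))%:E)%E by [].
    apply/funext => k; rewrite -(stationary_integral hK y (sP k) (f := EFin \o psi n))//.
      exact/measurable_EFinP.
    by move=> mu; rewrite lee_fin.
  have c1 : (\int[P]_mu (psi n mu)%:E @[n --> \oo] --> P O)%E.
    rewrite -[X in _ --> P X]setIT -integral_indic//; last exact: open_borel.
    exact: nd_cvg_integral.
  have c2 : (\int[P]_mu (psi n (shiftm y mu))%:E @[n --> \oo] --> P (shiftm y @^-1` O))%E.
    have mO := mSA _ (open_borel oO).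
    rewrite -[shiftm y @^-1` O]setIT -integral_indic//.
    apply: nd_cvg_integral => [n|n mu|mu|mu] //.
    + by apply: continuous_measurable_real; exact: cS.
  apply: (cvg_unique _ c2); first exact: ereal_hausdorff.
  by move: c1; under eq_fun do rewrite -e.
- move=> A mA PA; rewrite preimage_setC !probability_setC//; last exact: mSA.
  by rewrite PA.
- move=> F mF tF PF; rewrite preimage_bigcup !measure_semi_bigcup//.
  + by apply: eq_eseriesr => n _; exact: PF.
  + exact: bigcupT_measurable.
  + by move=> n; exact: mSA.
  + apply/trivIsetP => i j _ _ ij; move/trivIsetP : tF => /(_ i j I I ij).
    by move=> Fij; rewrite -(preimage_setI (shiftm y)) Fij preimage_set0.
  + by apply: bigcupT_measurable => n; exact: mSA.
Qed.

Lemma open_test_approx (U : set X) : open U ->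
  exists u : nat -> X -> R, [/\ forall n, test_fun (u n),
    forall z, {homo u ^~ z : m n / (m <= n)%N >-> m <= n} &
    forall z, u n z @[n --> \oo] --> (\1_U z : R)].
Proof.
move=> oU; have [u [cu u01 ndu uU]] := open_X_approx hK oU.
have [b [tb ndb b1 bcvg]] := test_exhaustion (d := d) hK.
have u0 n z : 0 <= u n z by have /andP[] := u01 n z.
have b0 n z : 0 <= b n z by have [_ + _ _] := tb n.
exists (fun n z => b n z * u n z); split.
- move=> n; apply: (test_fun_le _ _ _ (tb n)) => z.
  + by apply: cvgM; [have [cb _ _ _] := tb n; exact: cb|exact: cu].
  + by rewrite mulr_ge0.
  + by rewrite ler_piMr//; have /andP[] := u01 n z.
- by move=> z m n mn; apply: ler_pM => //; [exact: ndb|exact: ndu].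
- move=> z; rewrite -[X in _ --> X]mul1r.
  by apply: cvgM; [exact: bcvg|exact: uU].
Qed.

Lemma test_int_cvg (u : nat -> X -> R) (f : X -> R) mu :
  (forall n, test_fun (u n)) ->
  (forall z, {homo u ^~ z : m n / (m <= n)%N >-> m <= n}) ->
  (forall z, u n z @[n --> \oo] --> f z) ->
  ((\int[mu]_z u n z)%:E @[n --> \oo] --> \int[mu]_z (f z)%:E)%E.
Proof.
move=> tu ndu uf; under eq_fun do rewrite -test_intE//.
apply: nd_cvg_integral => // n; first exact: measurable_test.
by move=> z; have [_ + _ _] := tu n.
Qed.

Lemma mean_open_le (P_ : nat -> law) P (U : set X) (c : \bar R) :
  cvg_in_law P_ P -> open U ->
  (forall n, (mean_measure hK (P_ n) U <= c)%E) -> (mean_measure hK P U <= c)%E.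
Proof.
move=> PP oU; have [u [tu ndu uU]] := open_test_approx oU.
apply: (cvg_in_law_le (f_ := fun n mu => \int[bfm mu]_z u n z)) => //.
- by move=> n; exact: continuous_test_int.
- by move=> n mu; exact: test_Rint_ge0.
- by move=> mu m n mn; apply: test_Rint_le => // z; exact: ndu.
- move=> mu; rewrite -[U in mu U]setIT -integral_indic//; last exact: open_borel.
  exact: test_int_cvg.
Qed.

Lemma open_fst_lt (r : R) : open [set z : X | `|z.1| < r].
Proof.
rewrite (_ : [set _ | _] = (fun z : X => `|z.1|) @^-1` [set y | y < r])//.
apply: open_comp; last exact: open_lt.
move=> z _; apply: (@cvg_comp _ _ _ fst (fun x : E => `|x|) _ (nbhs z.1)).
  exact: cvg_fst.
exact: norm_continuous.
Qed.

(** The intensity of the limit is the mean mass of the open cube only once it is known to be finite.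
    Finiteness comes first, from the cruder bound on the open ball of radius 1; the exact constant
    follows. *)
Lemma intensity_closed (P_ : nat -> law) P (c : R) :
  (forall n, stationary (P_ n)) -> (forall n, (intensity (P_ n) <= c%:E)%E) ->
  cvg_in_law P_ P -> (intensity P <= c%:E)%E.
Proof.
move=> sP Pc PP; have sPP := stationary_closed sP PP.
have Plty n : (intensity (P_ n) < +oo)%E by apply: le_lt_trans (Pc n) _; rewrite ltry.
have Ioo : (intensity P < +oo)%E.
  have [N hN] := mean_bounded (d := d) hK 1.
  apply: (@le_lt_trans _ _ (mean_measure hK P [set z : X | `|z.1| < 1]%R)).
    rewrite (intensityE hK); apply: le_measure; try apply/mem_set.
    - exact: measurable_Q1X.
    - by apply: open_borel; exact: open_fst_lt.
    - by rewrite Q1XE => z /= /le_lt_trans; apply; rewrite invf_lt1 ?ltr1n.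
  apply: (@le_lt_trans _ _ (N%:R%:E * c%:E)%E); last by rewrite -EFinM ltry.
  apply: (mean_open_le PP); first exact: open_fst_lt.
  move=> n; apply: (@le_trans _ _ (mean_measure hK (P_ n) [set z : X | `|z.1| <= 1]%R)).
    apply: le_measure; try apply/mem_set.
    - by apply: open_borel; exact: open_fst_lt.
    - by apply: closed_borel; exact: closed_fst_le.
    - by move=> z /= /ltW.
  by apply: le_trans (hN _ (sP n)) _; rewrite lee_wpmul2l ?lee_fin.
rewrite -(mean_openQ1X hK sPP Ioo); apply: (mean_open_le PP).
  exact: open_openQ1X.
by move=> n; rewrite mean_openQ1X.
Qed.

Lemma integer_valued_closed (P_ : nat -> law) P :
  (forall n, {ae P_ n, forall mu : borel M, integer_valued mu}) ->
  cvg_in_law P_ P -> {ae P, forall mu : borel M, integer_valued mu}.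
Proof.
move=> iP PP.
have oN : open (~` [set mu : M | integer_valued mu]).
  by rewrite openC; exact: closed_integer_valued.
have mN := open_borel oN.
have [psi [cpsi psi01 ndpsi psiO]] := open_bfmeasure_approx hK oN.
exists (~` [set mu : M | integer_valued mu]); split => //.
apply/eqP; rewrite eq_le measure_ge0 andbT.
rewrite -[X in (P X <= _)%E]setIT -(@integral_indic _ _ R P setT)//.
apply: (cvg_in_law_le PP cpsi
  (f := fun mu => (\1_(~` [set mu : M | integer_valued mu]) mu)%:E)).
- by move=> n mu; have /andP[] := psi01 n mu.
- exact: ndpsi.
- by move=> mu; apply: cvg_EFin; [exact: nearW|exact: psiO].
move=> n; rewrite integral_indic// setIT.
by have [B [mB PB /le_measure h]] := iP n; rewrite -PB; apply: h; exact/mem_set.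
Qed.

(** The cylinder over [B] need not be bounded, so [bfm_fin] does not apply; a finite mean gives
    almost sure finiteness instead. *)
Lemma ae_finite_cylinder P (B : set (borel E)) : stationary P ->
  (intensity P < +oo)%E -> measurable B -> bounded_set (B : set E) ->
  {ae P, forall mu : borel M, ((mu : M) (B `*` setT) < +oo)%E}.
Proof.
move=> sP Ioo mB [N [Nr NB]].
have mBX : measurable (B `*` setT : set (borel X)).
  rewrite (_ : B `*` setT = (fst : borel X -> borel E) @^-1` B); last first.
    by apply/seteqP; split=> [z []|z].
  apply: preimage_measurable mB; apply: continuous_borel => z; exact: cvg_fst.
have fin : (mean_measure hK P (B `*` setT) < +oo)%E.
  apply: le_lt_trans (mean_bounded_lty hK (N + 1) sP Ioo).
  apply: le_measure; try apply/mem_set => //.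
    by apply: closed_borel; exact: closed_fst_le.
  by move=> z [Bz _] /=; apply: (NB (N + 1)) => //; rewrite ltrDl.
have int : P.-integrable setT (fun mu : borel M => (mu : M) (B `*` setT)).
  apply/integrableP; split; first exact: measurable_eval.
  by under eq_integral do rewrite gee0_abs//.
have := integrable_ae measurableT int; apply: filterS => mu /(_ Logic.I).
by rewrite ge0_fin_numE.
Qed.

Lemma stationary_mpp_le_closed (c : R) : closed_in_law (@stationary_mpp_le R d K c).
Proof.
move=> P_ P FP PP.
have sP : stationary P by apply: stationary_closed PP => n; have [] := FP n.
have Pc : (intensity P <= c%:E)%E.
  by apply: intensity_closed PP => n; have [] := FP n.
split => //; split.
  by apply: integer_valued_closed PP => n; have [[]] := FP n.
move=> B mB bB; apply: ae_finite_cylinder => //.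
by apply: le_lt_trans Pc _; rewrite ltry.
Qed.

End closedness.

(** * Convergence of Palm measures *)

(** The primed values are those of the open cube. Equal sums force [a' = a] and [b' = b], and then
    limsup [a_] is at most [c] minus liminf [b_], hence at most [c - b = a]. *)
Lemma cvg_of_lsc_summands {R : realType} (a_ b_ c_ : nat -> \bar R) (a b a' b' c : \bar R) :
  (forall n, 0 <= a_ n)%E -> (forall n, 0 <= b_ n)%E -> (0 <= a')%E -> (0 <= b')%E ->
  (forall n, a_ n + b_ n = c_ n)%E -> (forall n, c_ n < +oo)%E ->
  (a + b = c)%E -> (a' + b' = c)%E -> (c < +oo)%E -> (a' <= a)%E -> (b' <= b)%E ->
  (forall r : R, r%:E < a' -> \forall n \near \oo, r%:E < a_ n)%E ->
  (forall r : R, r%:E < b' -> \forall n \near \oo, r%:E < b_ n)%E ->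
  c_ n @[n --> \oo] --> c -> a_ n @[n --> \oo] --> a.
Proof.
move=> a_0 b_0 a'0 b'0 abn c_oo ab ab' coo a'a b'b hA hB hC.
have fin_sum (x y z : \bar R) : (0 <= x -> 0 <= y -> x + y = z -> z < +oo ->
    [/\ x \is a fin_num, y \is a fin_num & z \is a fin_num])%E.
  move=> x0 y0 xyz zoo.
  have zf : z \is a fin_num by rewrite ge0_fin_numE// -xyz adde_ge0.
  by move: (zf); rewrite -{1}xyz fin_numD => /andP[].
have a_f n : a_ n \is a fin_num by have [] := fin_sum _ _ _ (a_0 n) (b_0 n) (abn n) (c_oo n).
have b_f n : b_ n \is a fin_num by have [] := fin_sum _ _ _ (a_0 n) (b_0 n) (abn n) (c_oo n).
have c_f n : c_ n \is a fin_num by have [] := fin_sum _ _ _ (a_0 n) (b_0 n) (abn n) (c_oo n).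
have [a'f b'f cf] := fin_sum _ _ _ a'0 b'0 ab' coo.
have [af bf _] := fin_sum _ _ _ (le_trans a'0 a'a) (le_trans b'0 b'b) ab coo.
move: ab ab' a'a b'b hA hB hC.
rewrite -(fineK af) -(fineK bf) -(fineK a'f) -(fineK b'f) -(fineK cf).
move: (fine a) (fine b) (fine a') (fine b') (fine c) => {af bf a'f b'f cf a'0 b'0 coo}.
move=> {}a {}b {}a' {}b' {}c; rewrite -!EFinD !lee_fin => -[ab] [ab'] a'a b'b.
have [-> ->] : a' = a /\ b' = b by lra.
move=> hA hB /fine_cvg hC; apply/fine_cvgP; split; first exact: nearW.
apply/cvgrPdist_lt => e e0; have e20 : 0 < e / 2 by rewrite divr_gt0.
have {}hA := hA (a - e / 2); have {}hB := hB (b - e / 2).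
rewrite !lte_fin !ltrBlDr !ltrDl in hA hB.
have {}hA := hA e20; have {}hB := hB e20.
move/cvgrPdist_lt : hC => /(_ _ e20) hC.
near=> n.
have : ((a - e / 2)%:E < a_ n)%E by near: n.
have : ((b - e / 2)%:E < b_ n)%E by near: n.
have : `|c - (fine \o c_) n| < e / 2 by near: n.
have := abn n; rewrite /= -(fineK (a_f n)) -(fineK (b_f n)) -(fineK (c_f n)).
rewrite -EFinD !lte_fin => -[]; rewrite !ltr_norml /=.
move: (fine _) (fine _) (fine _) => x y z *.
apply/andP; split; lra.
Unshelve. all: by end_near.
Qed.

Section palm_convergence.
Context {R : realType} {d : nat} {K : completeMetricType R}.

Local Notation E := 'rV[R]_d.
Local Notation X := ('rV[R]_d * K)%type.
Local Notation M := (bfmeasure d K).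
Local Notation shiftm := Defs.shift.
Local Notation law := (probability (borel M) R).
Local Notation Q := (@Q1X R d K).
Local Notation Qo := (@openQ1X R d K).
Implicit Types (f g : X -> R) (mu nu : M) (P : law) (phi psi : M -> R).

Hypothesis hK : separable K.

Let onem01 psi : (forall nu, 0 <= psi nu <= 1) ->
  forall nu, 0 <= 1 - psi nu <= 1.
Proof. by move=> h nu; have /andP[? ?] := h nu; lra. Qed.

Let continuous_onem psi : continuous psi -> continuous (fun nu => 1 - psi nu).
Proof.
move=> cpsi nu; have h1 : (fun _ : M => 1 : R) @ nu --> (1 : R) by exact: cst_continuous.
exact: cvgB h1 (cpsi nu).
Qed.

Lemma int_shift_le (B C : set (borel X)) psi mu : measurable B -> measurable C ->
  measurable_fun setT (psi : borel M -> R) -> (forall nu, 0 <= psi nu) ->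
  B `<=` C -> (int_shift B psi mu <= int_shift C psi mu)%E.
Proof.
move=> mB mC mpsi psi0 BC; apply: ge0_le_integral => //.
- by move=> z _; rewrite lee_fin mulr_ge0 ?indicE.
- by apply/measurable_EFinP; apply: measurable_int_shift_integrand.
- by apply/measurable_EFinP; apply: measurable_int_shift_integrand.
- move=> z _; rewrite lee_fin ler_wpM2r// !indicE ler_nat.
  by have [/set_mem/BC/mem_set ->|] := boolP (z \in B).
Qed.

Lemma int_shift_onem (B : set (borel X)) psi mu : measurable B ->
  measurable_fun setT (psi : borel M -> R) -> (forall nu, 0 <= psi nu <= 1) ->
  (int_shift B psi mu + int_shift B (fun nu => 1 - psi nu)%R mu = mu B)%E.
Proof.
move=> mB mpsi psi01; have psi0 nu : 0 <= psi nu by have /andP[] := psi01 nu.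
have cpsi0 nu : 0 <= 1 - psi nu by have /andP[] := onem01 psi01 nu.
have mc : measurable_fun setT ((fun nu => 1 - psi nu) : borel M -> R).
  by apply: measurable_funB.
rewrite /int_shift -ge0_integralD//.
- rewrite -[in RHS](setIT B) -(@integral_indic _ _ R mu setT)//.
  by apply: eq_integral => z _; rewrite -EFinD -mulrDr addrC subrK mulr1.
- by move=> z _; rewrite lee_fin mulr_ge0 ?indicE.
- by apply/measurable_EFinP; apply: measurable_int_shift_integrand.
- by move=> z _; rewrite lee_fin mulr_ge0 ?indicE.
- by apply/measurable_EFinP; exact: (measurable_int_shift_integrand hK mu mB mc).
Qed.

Lemma mean_int_shift_onem P (B : set (borel X)) psi : measurable B ->
  measurable_fun setT (psi : borel M -> R) -> (forall nu, 0 <= psi nu <= 1) ->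
  (\int[P]_mu int_shift B psi mu +
   \int[P]_mu int_shift B (fun nu => 1 - psi nu)%R mu = mean_measure hK P B)%E.
Proof.
move=> mB mpsi psi01; have psi0 nu : 0 <= psi nu by have /andP[] := psi01 nu.
have cpsi0 nu : 0 <= 1 - psi nu by have /andP[] := onem01 psi01 nu.
have mc : measurable_fun setT ((fun nu => 1 - psi nu) : borel M -> R).
  by apply: measurable_funB.
rewrite -ge0_integralD//.
- by apply: eq_integral => mu _; rewrite int_shift_onem.
- by move=> mu _; exact: int_shift_ge0.
- exact: measurable_int_shift_fun.
- by move=> mu _; exact: int_shift_ge0.
- by apply: measurable_int_shift_fun => //; exact: onem01.
Qed.

Lemma mean_int_shift_le P psi :
  measurable_fun setT (psi : borel M -> R) -> (forall nu, 0 <= psi nu <= 1) ->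
  (\int[P]_mu int_shift Qo psi mu <= \int[P]_mu int_shift Q psi mu)%E.
Proof.
move=> mpsi psi01; have psi0 nu : 0 <= psi nu by have /andP[] := psi01 nu.
apply: ge0_le_integral => //.
- by move=> mu _; exact: int_shift_ge0.
- by apply: measurable_int_shift_fun => //; exact: measurable_openQ1X.
- by apply: measurable_int_shift_fun => //; exact: measurable_Q1X.
- move=> mu _; apply: int_shift_le => //.
  + exact: measurable_openQ1X.
  + exact: measurable_Q1X.
  + by rewrite Q1XE => z /= /ltW.
Qed.

(** The open cube is the lower semicontinuous one and stands on the side of the limit; along the
    sequence it is enlarged to the closed cube of the Palm formula. *)
Lemma mean_int_shift_lsc (P_ : nat -> law) P psi (r : R) :
  cvg_in_law P_ P -> continuous psi -> (forall nu, 0 <= psi nu <= 1) ->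
  (r%:E < \int[P]_mu int_shift Qo psi mu)%E ->
  \forall n \near \oo, (r%:E < \int[P_ n]_mu int_shift Q psi mu)%E.
Proof.
move=> PP cpsi psi01 rP; have psi0 nu : 0 <= psi nu by have /andP[] := psi01 nu.
have mpsi : measurable_fun setT (psi : borel M -> R).
  exact: continuous_measurable_real.
have [u [tu ndu uQ]] := open_test_approx (d := d) hK (@open_openQ1X R d K).
have u0 n z : 0 <= u n z by have [_ + _ _] := tu n.
have tup n mu : test_fun (fun z => u n z * psi (shiftm z.1 mu)).
  apply: (test_fun_le _ _ _ (tu n)) => z.
  - apply: cvgM; first by have [cu _ _ _] := tu n; exact: cu.
    exact: (cvg_comp _ _ (@continuous_shift_pos _ _ _ hK mu z) (cpsi _)).
  - by rewrite mulr_ge0.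
  - by rewrite ler_piMr//; have /andP[] := psi01 (shiftm z.1 mu).
have ndup mu m n z : (m <= n)%N ->
    u m z * psi (shiftm z.1 mu) <= u n z * psi (shiftm z.1 mu).
  by move=> mn; rewrite ler_wpM2r//; exact: ndu.
have := @cvg_in_law_lsc _ _ _ P_ P
  (fun n mu => \int[bfm mu]_z (u n z * psi (shiftm z.1 mu))) (int_shift Qo psi) r.
move=> /(_ PP) h; have {}h := h _ _ _ _ rP.
apply: (filterS _ (h _ _ _ _)) => [n /lt_le_trans|n|n mu|mu m n mn|mu].
- by apply; exact: mean_int_shift_le.
- exact: continuous_int_shift.
- exact: test_Rint_ge0.
- by apply: test_Rint_le => // z; exact: ndup.
- apply: test_int_cvg => // [z m n mn|z]; first exact: ndup.
  by apply: cvgMl; exact: uQ.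
Qed.

(* Lower semicontinuity holds for both [psi] and [1 - psi], whose integrals sum
   to the intensity; as the intensities converge, so do the two integrals. *)
Lemma mean_int_shift_cvg (P_ : nat -> law) P psi :
  cvg_in_law P_ P -> (forall n, intensity (P_ n) < +oo)%E ->
  stationary P -> (intensity P < +oo)%E ->
  intensity (P_ n) @[n --> \oo] --> intensity P ->
  continuous psi -> (forall nu, 0 <= psi nu <= 1) ->
  (\int[P_ n]_mu int_shift Q psi mu @[n --> \oo] --> \int[P]_mu int_shift Q psi mu)%E.
Proof.
move=> PP Poo sP Ioo IP cpsi psi01.
have psi0 nu : 0 <= psi nu by have /andP[] := psi01 nu.
have mpsi : measurable_fun setT (psi : borel M -> R).
  exact: continuous_measurable_real.
pose psi' nu := 1 - psi nu.
have cpsi' : continuous psi' by exact: continuous_onem.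
have psi01' : forall nu, 0 <= psi' nu <= 1 by exact: onem01.
have psi0' nu : 0 <= psi' nu by have /andP[] := psi01' nu.
have mpsi' : measurable_fun setT (psi' : borel M -> R).
  exact: continuous_measurable_real.
have ge0 P' (B : set (borel X)) phi : (forall nu, 0 <= phi nu) ->
    (0 <= \int[P']_mu int_shift B phi mu)%E.
  by move=> phi0; apply: integral_ge0 => mu _; exact: int_shift_ge0.
have sumQ P' : (\int[P']_mu int_shift Q psi mu + \int[P']_mu int_shift Q psi' mu =
    intensity P')%E by exact: (mean_int_shift_onem P' (@measurable_Q1X R d K) mpsi psi01).
have sumQo : (\int[P]_mu int_shift Qo psi mu + \int[P]_mu int_shift Qo psi' mu =
    intensity P)%E.
  rewrite -(mean_openQ1X hK sP Ioo).
  exact: (mean_int_shift_onem P (@measurable_openQ1X R d K) mpsi psi01).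
apply: (cvg_of_lsc_summands _ _ _ _ (fun n => sumQ (P_ n)) Poo (sumQ P) sumQo Ioo
  (mean_int_shift_le P mpsi psi01) (mean_int_shift_le P mpsi' psi01') _ _ IP).
- by move=> n; exact: ge0.
- by move=> n; exact: ge0.
- exact: ge0.
- exact: ge0.
- by move=> r; exact: mean_int_shift_lsc.
- by move=> r; exact: mean_int_shift_lsc.
Qed.

Lemma palm_cvg01 (P_ : nat -> law) P psi :
  cvg_in_law P_ P -> (forall n, intensity (P_ n) < +oo)%E ->
  stationary P -> (0 < intensity P)%E -> (intensity P < +oo)%E ->
  intensity (P_ n) @[n --> \oo] --> intensity P ->
  continuous psi -> (forall nu, 0 <= psi nu <= 1) ->
  (\int[palm_measure hK (P_ n)]_mu (psi mu)%:E @[n --> \oo] -->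
   \int[palm_measure hK P]_mu (psi mu)%:E)%E.
Proof.
move=> PP Poo sP I0 Ioo IP cpsi psi01.
have mpsi : measurable_fun setT (psi : borel M -> R).
  exact: continuous_measurable_real.
have If : intensity P \is a fin_num by rewrite ge0_fin_numE// ltW.
rewrite palm_integral//; under eq_fun do rewrite palm_integral//.
have c1 := mean_int_shift_cvg PP Poo sP Ioo IP cpsi psi01.
apply: cvgeM => //.
- rewrite mule_def_fin//.
  rewrite ge0_fin_numE; last first.
    apply: integral_ge0 => mu _; apply: int_shift_ge0 => nu.
    by have /andP[] := psi01 nu.
  apply: le_lt_trans Ioo.
  rewrite (intensityE hK) -(mean_int_shift_onem P (@measurable_Q1X R d K) mpsi psi01).
  apply: leeDl; apply: integral_ge0 => mu _; apply: int_shift_ge0 => nu.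
  by have /andP[] := onem01 psi01 nu.
- apply: cvg_EFin; first exact: nearW.
  apply: cvgV; first by rewrite gt_eqF// fine_gt0// I0.
  by move: IP; rewrite -(fineK If) => /fine_cvg.
Qed.

Lemma palm_measure_setT P : (0 < intensity P)%E -> (intensity P < +oo)%E ->
  palm_measure hK P setT = 1%E.
Proof.
move=> I0 Ioo; rewrite palm_measureE palmE.
have -> : (\int[P]_mu int_shift Q \1_setT mu)%E = intensity P.
  apply: eq_integral => mu _; rewrite /int_shift.
  rewrite -[in RHS](setIT (@Q1 R d `*` setT)) -(@integral_indic _ _ R mu setT)//; last first.
    exact: measurable_Q1X.
  by apply: eq_integral => z _; rewrite indicT mulr1.
have If : intensity P \is a fin_num by rewrite ge0_fin_numE// ltW.
by rewrite -{2}(fineK If) -EFinM mulVf// gt_eqF// fine_gt0// I0.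
Qed.

(** Carries convergence from [0, 1]-valued to bounded functions by rescaling. The constant [b]
    integrates to itself because the Palm measure has total mass 1. *)
Lemma palm_integral_affine P phi psi (a b : R) :
  (0 < intensity P)%E -> (intensity P < +oo)%E ->
  measurable_fun setT (psi : borel M -> R) -> (forall nu, 0 <= psi nu <= 1) ->
  (forall nu, phi nu = a * psi nu + b) ->
  (\int[palm P]_mu (phi mu)%:E = a%:E * \int[palm_measure hK P]_mu (psi mu)%:E + b%:E)%E.
Proof.
move=> I0 Ioo mpsi psi01 phiE; have T1 := palm_measure_setT I0 Ioo.
have int1 : (palm_measure hK P).-integrable setT (fun mu : borel M => (psi mu)%:E).
  apply/integrableP; split; first exact/measurable_EFinP.
  apply: (@le_lt_trans _ _ (\int[palm_measure hK P]_mu (cst 1%E) mu)%E); last first.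
    by rewrite integral_cst// mul1e [X in (X < _)%E]T1 ltry.
  apply: ge0_le_integral => //.
  - by apply: measurableT_comp => //; exact/measurable_EFinP.
  - move=> mu _; have /andP[? ?] := psi01 mu.
    by rewrite /cst/= lee_fin ger0_norm.
have int2 : (palm_measure hK P).-integrable setT (fun mu : borel M => b%:E).
  apply: (@measurable_bounded_integrable _ _ R (palm_measure hK P) (fun=> b) setT) => //.
    by rewrite -ge0_fin_numE// [X in X \is a _]T1.
  by exists `|b|; split; [exact: num_real|move=> x bx y _; exact: ltW].
transitivity (\int[palm_measure hK P]_mu (a%:E * (psi mu)%:E + b%:E))%E.
  transitivity (\int[palm_measure hK P]_mu (phi mu)%:E)%E; first by [].
  by apply: eq_integral => mu _; rewrite phiE.
rewrite integralD//; last exact: integrableZl.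
rewrite integralZl// integral_cst//; congr (_ + _)%E.
by rewrite -[RHS]mule1; congr (_ * _)%E; exact: T1.
Qed.

Theorem palm_cvg_in_law (P_ : nat -> law) P :
  cvg_in_law P_ P ->
  (forall n, 0 < intensity (P_ n))%E -> (forall n, intensity (P_ n) < +oo)%E ->
  stationary P -> (0 < intensity P)%E -> (intensity P < +oo)%E ->
  intensity (P_ n) @[n --> \oo] --> intensity P ->
  cvg_in_law (fun n => palm (P_ n)) (palm P).
Proof.
move=> PP P0 Poo sP I0 Ioo IP phi cphi [N [Nr Nphi]].
pose B := `|N| + 1.
have B0 : 0 < B by rewrite ltr_wpDl.
have phiB nu : `|phi nu| <= B.
  by apply: Nphi => //; rewrite /B (le_lt_trans (ler_norm _))// ltrDl.
pose psi nu := (2 * B)^-1 * (phi nu - - B).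
have psi01 nu : 0 <= psi nu <= 1.
  have := phiB nu; rewrite ler_norml => /andP[h1 h2].
  rewrite /psi opprK mulrC divr_ge0 ?mulr_ge0 ?(ltW B0)//=; last by lra.
  by rewrite ler_pdivrMr ?mulr_gt0// mul1r; lra.
have cpsi : continuous psi.
  by apply: continuous_mulr; exact: continuous_subr.
have phiE nu : phi nu = 2 * B * psi nu + - B.
  by rewrite /psi mulrA mulfV ?mulf_neq0 ?gt_eqF// mul1r opprK addrK.
have mpsi : measurable_fun setT (psi : borel M -> R).
  exact: continuous_measurable_real.
rewrite (palm_integral_affine I0 Ioo mpsi psi01 phiE).
under eq_fun do rewrite (palm_integral_affine (P0 _) (Poo _) mpsi psi01 phiE).
have := palm_cvg01 PP Poo sP I0 Ioo IP cpsi psi01.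
move=> h; have Bfin : (2 * B)%:E \is a fin_num by [].
have h2 : (fun=> (- B)%:E) @ \oo --> (- B)%:E by exact: cvg_cst.
by apply: (cvgeD _ (cvgeZl Bfin h) h2); rewrite fin_num_adde_defl.
Qed.

End palm_convergence.

(** * Tightness *)

Section ultrafilter_limit.
Context {R : realType} {d : nat} {K : completeMetricType R}.

Local Notation E := 'rV[R]_d.
Local Notation X := ('rV[R]_d * K)%type.
Local Notation M := (bfmeasure d K).
Local Notation pball z r := [set w : X | pdist z w < r].
Implicit Types (f g : X -> R) (mu : M) (x y z w : X).

Hypothesis lcK : locally_compact [set: K].
Variable U : set_system M.
Context {UU : UltraFilter U}.
Hypothesis U_integer : \forall mu \near U, integer_valued mu.
Hypothesis U_bounded : forall V : set (borel X), measurable V -> bdd V ->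
  exists n : nat, \forall mu \near U, (bfm mu V <= n%:R%:E)%E.

Let UF : ProperFilter U. Proof. exact: ultra_proper. Qed.
Local Existing Instance UF.

Lemma measurable_pball z (r : R) : measurable (pball z r : set (borel X)).
Proof. by apply: open_borel; exact: open_pball. Qed.

(** An ultrafilter selects one of the finitely many possible values: either the largest one is taken
    eventually, or it is excluded eventually and the bound drops by one. *)
Lemma eventual_mass (V : set (borel X)) : measurable V -> bdd V ->
  exists n : nat, \forall mu \near U, (bfm mu V = n%:R%:E)%E.
Proof.
move=> mV bV; have [N] := U_bounded mV bV.
elim: N => [|N ih] UN.
  exists 0%N; near=> mu; apply/eqP; rewrite eq_le measure_ge0 andbT.
  by near: mu.
have [h|h] := @in_ultra_setVsetC _ U [set mu : M | (mu V = N.+1%:R%:E)%E] UU.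
  by exists N.+1.
apply: ih; near=> mu.
have [k muk] : exists k : nat, mu V = k%:R%:E.
  by have : integer_valued mu by [near: mu|]; apply.
have : (mu V <= N.+1%:R%:E)%E by near: mu.
have : ~ (mu V = N.+1%:R%:E)%E by near: mu.
rewrite muk !lee_fin !ler_nat leq_eqVlt => kN /orP[/eqP kN1|//].
by rewrite kN1 in kN.
Unshelve. all: by end_near.
Qed.

(** [p.1] is the weight at [x] and [p.2] a radius. Eventual masses can only drop as the radius
    shrinks, so below a radius realizing the least one they are constant. *)
Lemma atom_exists x : exists p : nat * R, [/\ 0 < p.2,
  bdd [set w : X | pdist x w <= p.2] &
  forall s, 0 < s <= p.2 -> \forall mu \near U, bfm mu (pball x s) = p.1%:R%:E].
Proof.
have [r0 r00 br0] := locally_compact_bdd x lcK.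
have bs s : s <= r0 -> bdd (pball x s).
  by move=> sr; apply: bdd_subset br0 => w /= /ltW /le_trans; apply.
pose Q (n : nat) := `[< exists s, [/\ 0 < s, s <= r0 &
  \forall mu \near U, bfm mu (pball x s) = n%:R%:E] >].
have exQ : exists n, Q n.
  have [n Un] := eventual_mass (measurable_pball x r0) (bs r0 (lexx _)).
  by exists n; apply/asboolP; exists r0.
case: (ex_minnP exQ) => a /asboolP[s [s0 sr Us]] amin.
exists (a, s); split => //=.
  by apply: bdd_subset br0 => w /= /le_trans; apply.
move=> t /andP[t0 ts].
have [n Un] := eventual_mass (measurable_pball x t) (bs t (le_trans ts sr)).
suff -> : a = n by [].
apply/eqP; rewrite eqn_leq; apply/andP; split.
  by apply: amin; apply/asboolP; exists t; split => //; exact: le_trans sr.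
(* The two eventual values are compared on a single measure having both; one exists because the
   filter is proper. *)
near U => mu; rewrite -(ler_nat R) -lee_fin.
have <- : mu (pball x t) = n%:R%:E by near: mu.
have <- : mu (pball x s) = a%:R%:E by near: mu.
apply: le_measure; try (apply/mem_set; exact: measurable_pball).
by move=> w /= /lt_le_trans; apply.
Unshelve. all: by end_near.
Qed.

Section atoms.
Variables (a : X -> nat) (r : X -> R).
Hypothesis r_gt0 : forall x, 0 < r x.
Hypothesis r_bdd : forall x, bdd [set w : X | pdist x w <= r x].
Hypothesis atomP : forall x s, 0 < s <= r x ->
  \forall mu \near U, bfm mu (pball x s) = (a x)%:R%:E.

(** The ball of radius [r x] has the same eventual mass as the smaller balls around [x], which
    leaves no mass for a ball around [y] disjoint from one of them. *)
Lemma atom_isolated x y : 0 < pdist x y -> pdist x y < r x -> a y = 0%N.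
Proof.
(* The three bounds make [atomP] apply at [y], separate the two small balls, and place the one
   around [y] inside the large ball. *)
move=> xy0 xyr; pose s := Num.min (r y) (Num.min (pdist x y / 2) (r x - pdist x y)).
have s0 : 0 < s by rewrite !lt_min r_gt0 divr_gt0// subr_gt0.
have [sy sxy sx] : [/\ s <= r y, s <= pdist x y / 2 & s <= r x - pdist x y].
  by rewrite /s !ge_min !lexx !orbT.
have s1 : 0 < s <= r y by rewrite s0 sy.
have s2 : 0 < s <= r x by rewrite s0; lra.
have s3 : 0 < r x <= r x by rewrite r_gt0 lexx.
near U => mu.
have m1 : mu (pball y s) = (a y)%:R%:E by near: mu; exact: atomP.
have m2 : mu (pball x s) = (a x)%:R%:E by near: mu; exact: atomP.
have m3 : mu (pball x (r x)) = (a x)%:R%:E by near: mu; exact: atomP.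
have : (mu (pball y s `|` pball x s) <= mu (pball x (r x)))%E.
  apply: le_measure; try apply/mem_set.
  - by apply: measurableU; exact: measurable_pball.
  - exact: measurable_pball.
  - move=> w /= [yw|xw]; last by rewrite (lt_le_trans xw)//; lra.
    by apply: le_lt_trans (pdist_triangle y x w) _; lra.
have -> : mu (pball y s `|` pball x s) = ((a y)%:R%:E + (a x)%:R%:E)%E; last first.
  rewrite m3 -EFinD -natrD lee_fin ler_nat -[leqRHS]add0n leq_add2r.
  by rewrite leqn0 => /eqP.
rewrite -m1 -m2; apply: measureU; [exact: measurable_pball|exact: measurable_pball|].
apply/seteqP; split => // w [/= yw xw].
have := pdist_triangle w x y; rewrite (pdist_sym w y); lra.
Unshelve. all: by end_near.
Qed.

Definition atomic (A : set (borel X)) : \bar R := \esum_(x in A) (a x)%:R%:E.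

Let atomic0 : atomic set0 = 0%E. Proof. exact: esum_set0. Qed.

Let atomic_ge0 A : (0 <= atomic A)%E. Proof. exact: esum_ge0. Qed.

Let atomic_sigma_additive : semi_sigma_additive atomic.
Proof.
move=> F mF tF mUF.
have -> : atomic (\bigcup_n F n) = (\sum_(n <oo) atomic (F n))%E.
  rewrite /atomic esum_bigcupT// nneseries_esum; last by move=> n _; exact: esum_ge0.
  by congr esum; apply/seteqP; split.
by apply: is_cvg_nneseries.
Qed.

HB.instance Definition _ := isMeasure.Build _ _ _
  atomic atomic0 atomic_ge0 atomic_sigma_additive.

Lemma atomic_pball x s : 0 < s <= r x -> atomic (pball x s) = (a x)%:R%:E.
Proof.
move=> /andP[s0 sr].
rewrite /atomic (esumID [set x])//.
rewrite [X in (_ + X)%E]esum1 ?adde0; last first.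
  move=> w [/= xw wx]; rewrite (@atom_isolated x w)//; last exact: lt_le_trans sr.
  by apply: pdist_neq => xw'; apply: wx.
rewrite (_ : _ `&` _ = [set x]) ?esum_set1//.
by apply/seteqP; split => [w [_]|w ->]//; split => //=; rewrite pdistzz.
Qed.

(** With half radii, the tent [r x - pdist x w] of a covering centre is at least [r x / 2] at the
    covered point. *)
Lemma bdd_pball_cover (A : set X) : bdd A ->
  exists s : seq X, forall w, A w -> exists2 x, x \in s & pdist x w < r x / 2.
Proof.
move=> [/(_ lcK)[V AV [cV _]] _].
move: cV; rewrite compact_cover => /(_ X setT (fun x => pball x (r x / 2))).
case.
- by move=> x _; exact: open_pball.
- by move=> w _; exists w => //=; rewrite pdistzz divr_gt0.
move=> D _ VD; exists (enum_fset D) => w /AV/VD[x /= xD xw].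
by exists x.
Qed.

Lemma atomic_fin (A : set (borel X)) : measurable A -> bdd A -> (atomic A < +oo)%E.
Proof.
move=> mA /bdd_pball_cover[s As].
apply: (@le_lt_trans _ _ (\sum_(x <- s) atomic (pball x (r x)))%E).
  apply: (@le_measure_seq R _ (borel X) atomic) => //.
    by move=> x; exact: measurable_pball.
  move=> w /As[x xs xw]; exists x => //=.
  by rewrite (lt_trans xw)// gtr_pMr// invf_lt1// ltr1n.
apply: lte_sum_pinfty => x _; rewrite atomic_pball ?ltry// r_gt0 lexx//.
Qed.

Definition atomic_limit : M := to_bfmeasure atomic_fin.

Lemma atomic_limit_pball x s : 0 < s <= r x ->
  atomic_limit (pball x s) = (a x)%:R%:E.
Proof.
move=> sr; rewrite /= mborelE; last exact: measurable_pball.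
exact: atomic_pball.
Qed.

(* Outside the small ball [f] is not controlled, but [mu] has no mass there. *)
Lemma test_int_pball mu f x (s e : R) (n : nat) : test_fun f ->
  (forall w, f w != 0 -> pdist x w < r x) -> 0 < s <= r x ->
  (forall w, pdist x w < s -> `|f w - f x| <= e) ->
  mu (pball x s) = n%:R%:E -> mu (pball x (r x)) = n%:R%:E ->
  `|\int[mu]_z f z - f x * n%:R| <= e * n%:R.
Proof.
move=> tf fsupp /andP[s0 sr] fe mus mur; have [_ f0 _ _] := tf.
have e0 : 0 <= e by apply: le_trans (fe x _); rewrite ?pdistzz.
have [B /ltW B0 fB] := test_fun_bound tf.
have ms := measurable_pball x s; have mr := measurable_pball x (r x).
pose D := pball x (r x) `\` pball x s.
have mD : measurable (D : set (borel X)) by exact: measurableD.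
have muD : mu D = 0%E.
  have mufin : (mu (pball x (r x)) < +oo)%E by rewrite mur ltry.
  have -> : mu D = (mu (pball x (r x)) - mu (pball x s))%E.
    apply: etrans (measureD mr ms mufin) _; congr (_ - mu _)%E.
    by apply/seteqP; split=> [w []//|w /= ws]; split => //=; exact: lt_le_trans sr.
  by rewrite mur mus subee.
have intc (c : R) (A : set (borel X)) : 0 <= c -> measurable A ->
    (\int[mu]_z (c * \1_A z)%:E = c%:E * mu A)%E.
  move=> c0 mA; under eq_integral do rewrite EFinM.
  rewrite ge0_integralZl//; first by rewrite integral_indic// setIT.
  by apply/measurable_EFinP; exact: measurable_indic.
have mc (c : R) (A : set (borel X)) : measurable A ->
    measurable_fun setT (fun z : borel X => (c * \1_A z)%:E).
  by move=> mA; apply/measurable_EFinP; apply: measurable_funM => //; exact: measurable_indic.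
have mf : measurable_fun setT (fun z : borel X => (f z)%:E).
  by apply/measurable_EFinP; exact: measurable_test.
have up : \int[mu]_z f z <= (f x + e) * n%:R.
  rewrite -lee_fin -test_intE//.
  apply: (@le_trans _ _ (\int[mu]_z ((f x + e) * \1_(pball x s) z)%:E +
      \int[mu]_z (B * \1_D z)%:E)%E); last first.
    by rewrite !intc ?addr_ge0// mus muD mule0 adde0 EFinM.
  rewrite -ge0_integralD//; last 4 first.
  - by move=> z _; rewrite lee_fin mulr_ge0 ?addr_ge0 ?indicE.
  - exact: mc.
  - by move=> z _; rewrite lee_fin mulr_ge0 ?indicE.
  - exact: mc.
  apply: ge0_le_integral => //.
  - by move=> z _; rewrite lee_fin.
  - by apply: emeasurable_funD; exact: mc.
  move=> z _; rewrite -EFinD lee_fin !indicE.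
  have [/set_mem/= zs|/negP zs] := boolP (z \in pball x s).
    rewrite mulr1 ler_wpDr ?mulr_ge0//.
    by have := fe _ zs; rewrite ler_norml => /andP[]; lra.
  rewrite mulr0 add0r; have [zD|/negP zD] := boolP (z \in D); first by rewrite mulr1.
  rewrite mulr0; have [->//|/fsupp zr] := eqVneq (f z) 0.
  by exfalso; apply: zD; apply/mem_set; split => // zs'; apply: zs; exact/mem_set.
have down : (f x - e) * n%:R <= \int[mu]_z f z.
  apply: (@le_trans _ _ (Num.max 0 (f x - e) * n%:R)).
    by rewrite ler_wpM2r// le_max lexx orbT.
  rewrite -lee_fin -test_intE// EFinM -mus -intc//; last by rewrite le_max lexx.
  apply: ge0_le_integral => //.
  - by move=> z _; rewrite lee_fin mulr_ge0 ?indicE// le_max lexx.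
  - exact: mc.
  move=> z _; rewrite lee_fin indicE.
  have [/set_mem/= zs|_] := boolP (z \in pball x s); last by rewrite mulr0.
  rewrite mulr1 ge_max f0/=.
  by have := fe _ zs; rewrite ler_norml => /andP[]; lra.
by move: up down; rewrite ler_norml; move: (Rintegral _ _ _) => I *; apply/andP; split; lra.
Qed.

Lemma cvg_test_int_pball f x : test_fun f ->
  (forall w, f w != 0 -> pdist x w < r x) ->
  \int[bfm mu]_z f z @[mu --> U] --> \int[atomic_limit]_z f z.
Proof.
move=> tf fsupp; apply/cvgrPdist_le => e e0.
(* The error occurs once for [mu] and once for the limit, hence the 2; the added 1 allows
   [a x = 0]. *)
pose e' := e / (2 * ((a x)%:R + 1)).
have a1 : 0 < (a x)%:R + 1 :> R by rewrite ltr_wpDl.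
have e'0 : 0 < e' by rewrite divr_gt0// mulr_gt0.
have [cf _ _ _] := tf.
have /cvgrPdist_le/(_ _ e'0)/nbhs_pdist[s0 s00 fs] := cf x.
pose s := Num.min s0 (r x).
have sr : 0 < s <= r x by rewrite lt_min s00 r_gt0 ge_min lexx orbT.
have fe w : pdist x w < s -> `|f w - f x| <= e'.
  by rewrite lt_min => /andP[ws _]; rewrite distrC; apply: fs.
have rr : 0 < r x <= r x by rewrite r_gt0 lexx.
have h1 := test_int_pball tf fsupp sr fe (atomic_limit_pball sr) (atomic_limit_pball rr).
have e'e : 2 * (e' * (a x)%:R) <= e.
  have h1' : 2 * (e' * ((a x)%:R + 1)) = e by rewrite /e'; field; rewrite lt0r_neq0.
  have h2' : e' * (a x)%:R <= e' * ((a x)%:R + 1) by rewrite ler_wpM2l ?lerDl// ltW.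
  by move: h1' h2'; move: (e' * _) (e' * _) => u v *; lra.
near=> mu.
have mu1 : mu (pball x s) = (a x)%:R%:E by near: mu; exact: atomP.
have mu2 : mu (pball x (r x)) = (a x)%:R%:E by near: mu; exact: atomP.
have h2 := test_int_pball tf fsupp sr fe mu1 mu2.
move: h1 h2 e'e; rewrite !ler_norml.
move: (Rintegral _ _ _) (Rintegral _ _ _) (f x * _) (e' * _) => I1 I2 c c' *.
by apply/andP; split; lra.
Unshelve. all: by end_near.
Qed.

(* Riesz decomposition in place of a partition of unity: the part of [f] below the
   first tent is split off, and the rest is dominated by the remaining tents. *)
Lemma cvg_test_int_sum (s : seq X) (c : X -> R) f : test_fun f ->
  (forall x, 0 <= c x) ->
  (forall w, f w <= \sum_(x <- s) c x * Num.max 0 (r x - pdist x w)) ->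
  \int[bfm mu]_z f z @[mu --> U] --> \int[atomic_limit]_z f z.
Proof.
move=> + c0; elim: s f => [|x s ih] f tf fc; have [cf f0 _ _] := tf.
  (* An empty sum forces [f = 0], and any centre will do. *)
  apply: (@cvg_test_int_pball f point) => // w fw.
  by move: (fc w); rewrite big_nil leNgt lt_neqAle eq_sym fw f0.
pose T w := c x * Num.max 0 (r x - pdist x w).
have tT : test_fun T by apply: test_funZ => //; exact: test_fun_pball.
have [cT T0 _ _] := tT.
pose g w := Num.min (f w) (T w).
have tg : test_fun g.
  apply: (test_fun_le _ _ _ tT) => [|w|w].
  - exact: continuous_minr.
  - by rewrite le_min f0 T0.
  - by rewrite ge_min lexx orbT.
have gf w : g w <= f w by rewrite ge_min lexx.
have tfg : test_fun (fun w => f w - g w) by exact: test_funB.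
have sum mu : \int[mu]_z f z = \int[mu]_z g z + \int[mu]_z (f z - g z).
  rewrite -test_RintD//; congr Rintegral; apply/funext => z.
  by rewrite addrC subrK.
rewrite sum; under eq_fun do rewrite sum.
apply: cvgD.
  apply: (@cvg_test_int_pball g x) => // w; apply: contraNT; rewrite -leNgt => xw.
  by rewrite /g /T max_l ?subr_le0// mulr0 min_r.
apply: ih => // w; have := fc w; rewrite big_cons -/(T w) /g.
have S0 : 0 <= \sum_(x <- s) c x * Num.max 0 (r x - pdist x w).
  by apply: sumr_ge0 => y _; rewrite mulr_ge0// le_max lexx.
by have [fT|fT] := leP (f w) (T w); rewrite ?subrr// lerBlDl.
Qed.

Lemma cvg_atomic_limit : U --> atomic_limit.
Proof.
apply/cvg_vagueP => f tf; have [_ f0 _ sf] := tf.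
have [s sfs] := bdd_pball_cover sf.
have [B /ltW B0 fB] := test_fun_bound tf.
(* This factor lifts the height [r x / 2], guaranteed by the half radii, to the bound [B] of [f]. *)
have c0 x : 0 <= 2 * B / r x by rewrite divr_ge0 ?mulr_ge0// ltW.
have T0 x w : 0 <= 2 * B / r x * Num.max 0 (r x - pdist x w).
  by rewrite mulr_ge0// le_max lexx.
apply: (@cvg_test_int_sum s (fun x => 2 * B / r x)) => // w.
have [->|fw] := eqVneq (f w) 0; first by apply: sumr_ge0 => x _.
have cw : closure [set z | f z != 0] w by apply: subset_closure; exact: fw.
have [x xs xw] := sfs w cw.
rewrite (big_rem x)//=; apply: ler_wpDr; first by apply: sumr_ge0.
apply: le_trans (fB w) _.
have h : r x / 2 <= Num.max 0 (r x - pdist x w).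
  by rewrite le_max; apply/orP; right; lra.
apply: le_trans (ler_wpM2l (c0 x) h).
suff -> : 2 * B / r x * (r x / 2) = B by [].
by field; rewrite lt0r_neq0.
Qed.

End atoms.

Lemma ultrafilter_limit : exists nu : M, U --> nu.
Proof.
have /choice[p pP] := atom_exists.
have p1 x : 0 < (p x).2 by have [] := pP x.
have p2 x : bdd [set w : X | pdist x w <= (p x).2] by have [] := pP x.
have p3 x s : 0 < s <= (p x).2 -> \forall mu \near U, bfm mu (pball x s) = (p x).1%:R%:E.
  by have [_ _] := pP x; apply.
by exists (atomic_limit p1 p3); exact: cvg_atomic_limit.
Qed.

End ultrafilter_limit.

(** * Uniform mass bounds and tightness *)

Section tightness.
Context {R : realType} {d : nat} {K : completeMetricType R}.

Local Notation E := 'rV[R]_d.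
Local Notation X := ('rV[R]_d * K)%type.
Local Notation M := (bfmeasure d K).
Local Notation law := (probability (borel M) R).
Implicit Types (f g : X -> R) (mu : M) (P : law).

Hypothesis hK : separable K.

(** The constant depends on [f] only: [f] is at most [B] times the indicator of a ball in position
    with free marks, whose mean mass is bounded uniformly over stationary laws. *)
Lemma mean_test_bounded f : test_fun f -> exists2 c : R, 0 <= c &
  forall P, stationary P -> (\int[P]_mu (\int[bfm mu]_z f z)%:E <= c%:E * intensity P)%E.
Proof.
move=> tf; have [_ f0 _ sf] := tf.
have [B B0 fB] := test_fun_bound tf.
have [N [Nr fN]] := bdd_fst sf.
have [n hn] := mean_bounded (d := d) hK (N + 1).
exists (B * n%:R) => [|P sP]; first by rewrite mulr_ge0// ltW.
have mV : measurable ([set z : X | `|z.1| <= N + 1] : set (borel X)).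
  by apply: closed_borel; exact: closed_fst_le.
apply: (@le_trans _ _ (\int[P]_mu (B%:E * bfm mu [set z : X | `|z.1| <= N + 1]%R))%E).
  apply: ge0_le_integral => //.
  - by move=> mu _; rewrite lee_fin test_Rint_ge0.
  - apply/measurable_EFinP; apply: continuous_measurable_real.
    exact: continuous_test_int.
  - by apply: measurable_funeM; exact: measurable_eval.
  - move=> mu _; rewrite -test_intE// -[X in (_ <= _ * bfm mu X)%E]setIT.
    rewrite -(@integral_indic _ _ R mu setT)// -ge0_integralZl//; last 2 first.
    + by apply/measurable_EFinP; exact: measurable_indic.
    + by rewrite lee_fin ltW.
    apply: ge0_le_integral => //.
    + by move=> z _; rewrite lee_fin.
    + by apply/measurable_EFinP; exact: measurable_test.
    + by apply: measurable_funeM; apply/measurable_EFinP; exact: measurable_indic.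
    + move=> z _; rewrite -EFinM lee_fin indicE.
      have [->|fz] := eqVneq (f z) 0; first by rewrite mulr_ge0// ltW.
      rewrite mem_set ?mulr1//; apply: (fN (N + 1)); first by rewrite ltrDl.
      by exists z => //; apply: subset_closure; exact: fz.
rewrite ge0_integralZl//; last 2 first.
- exact: measurable_eval.
- by rewrite lee_fin ltW.
by rewrite EFinM -muleA lee_wpmul2l ?lee_fin ?(ltW B0)//; exact: hn.
Qed.

(** Dini's argument: once [b n z] exceeds 1/2, continuity keeps it so near [z], and monotonicity for
    all larger indices. *)
Lemma exhaustion_gt_half (b : nat -> X -> R) (V : set X) :
  locally_compact [set: K] -> (forall n, continuous (b n)) ->
  (forall z, {homo b ^~ z : m n / (m <= n)%N >-> m <= n}) ->
  (forall z, b n z @[n --> \oo] --> (1 : R)) -> bdd V ->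
  exists n, forall z, V z -> 1 / 2 < b n z.
Proof.
move=> lcK cb ndb b1 [/(_ lcK)[W VW [cW _]] _].
move/compact_near_coveringP : cW => /(_ nat \oo (fun n z => 1 / 2 < b n z)).
case=> [z _|n _ Wb]; last by exists n => z /VW; exact: Wb n (leqnn n) z.
have [n _ /(_ n (leqnn n)) /= zn] : \forall n \near \oo, 1 / 2 < b n z.
  by apply: (cvgr_gt (1 : R)) => //; lra.
have near_z : \forall w \near z, 1 / 2 < b n w by exact: (cvgr_gt _ (cb n z)).
exists ([set w | 1 / 2 < b n w], [set m | (n <= m)%N]) => /=.
  by split => //; exists n.
by move=> [w m] [/= bw nm]; rewrite (lt_le_trans bw)//; exact: ndb.
Qed.

Lemma compact_integer_valued (b : nat -> X -> R) (c : nat -> R) :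
  locally_compact [set: K] -> (forall n, test_fun (b n)) ->
  (forall z, {homo b ^~ z : m n / (m <= n)%N >-> m <= n}) ->
  (forall z, b n z @[n --> \oo] --> (1 : R)) ->
  compact ([set mu : M | integer_valued mu] `&`
           \bigcap_n [set mu : M | \int[bfm mu]_z b n z <= c n]).
Proof.
move=> lcK tb ndb b1; rewrite compact_ultra => U UU UC.
have UF : ProperFilter U by exact: ultra_proper.
have [nu Unu] : exists nu : M, U --> nu.
  apply: ultrafilter_limit => //; first by apply: filterS UC => mu [].
  move=> V mV bV.
  have cb n : continuous (b n) by have [] := tb n.
  have [n bn] := exhaustion_gt_half lcK cb ndb b1 bV.
  (* The indicator of [V] is at most [2 * b n], so that [mu V] is at most [2 * c n]. *)
  exists (Num.truncn (2 * c n)).+1; apply: filterS UC => mu [_ /(_ n I) /= muc].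
  have tb2 : test_fun (fun z => 2 * b n z) by exact: test_funZ.
  apply: (@le_trans _ _ (\int[bfm mu]_z (2 * b n z))%:E).
    apply: measure_le_test => //; apply: indic_le => z; first by have [] := tb2.
    by move=> /bn; lra.
  rewrite lee_fin test_RintZ//.
  apply: (@le_trans _ _ (2 * c n)); first by rewrite ler_wpM2l.
  by apply: ltW; exact: truncnS_gt.
exists nu; split => //.
have closedC : closed ([set mu : M | integer_valued mu] `&`
           \bigcap_n [set mu : M | \int[bfm mu]_z b n z <= c n]).
  apply: closedI; first exact: closed_integer_valued.
  apply: closed_bigI => n _.
  rewrite (_ : [set mu : M | _] =
    (fun mu : M => \int[bfm mu]_z b n z) @^-1` [set y | y <= c n])//.
  apply: closed_comp; last exact: closed_le.
  by move=> mu _; exact: continuous_test_int.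
apply: closedC => W /Unu UW; apply: (@filter_ex _ U).
exact: filterI UC UW.
Qed.

Lemma tight_stationary_mpp_le (lambda0 : R) :
  locally_compact [set: K] -> tight (@stationary_mpp_le R d K lambda0).
Proof.
move=> lcK eps eps0.
have [b [tb ndb _ b1]] := test_exhaustion (d := d) hK.
have /choice[B] : forall n, exists B : R, 0 <= B /\
    forall P, stationary P -> (\int[P]_mu (\int[bfm mu]_z b n z)%:E <= B%:E * intensity P)%E.
  by move=> n; have [c c0 hc] := mean_test_bounded (tb n); exists c.
move=> BP.
(* The share of [eps] allotted to the bound on [b n]; the shares add up to [eps]. *)
pose e n := eps / (2 ^ n.+1)%:R.
have e0 n : 0 < e n by rewrite divr_gt0// ltr0n expn_gt0.
(* The threshold for Markov's inequality; the absolute value and the added 1 keep it positive. *)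
pose c n := (`|B n * lambda0| + 1) / e n.
have c0 n : 0 < c n by rewrite divr_gt0// ltr_wpDl.
exists ([set mu : M | integer_valued mu] `&`
           \bigcap_n [set mu : M | \int[bfm mu]_z b n z <= c n]).
  exact: compact_integer_valued.
move=> P [[intP _] sP Pl].
pose A n := [set mu : M | c n < \int[bfm mu]_z b n z].
have mA n : measurable (A n : set (borel M)).
  apply: open_borel.
  rewrite (_ : A n = (fun mu : M => \int[bfm mu]_z b n z) @^-1` [set y | c n < y])//.
  apply: open_comp; last exact: open_gt.
  by move=> mu _; exact: continuous_test_int.
pose N := ~` [set mu : M | integer_valued mu].
have mN : measurable (N : set (borel M)).
  by apply: open_borel; rewrite openC; exact: closed_integer_valued.
have PN : P N = 0%E.
  apply/eqP; rewrite eq_le measure_ge0 andbT.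
  by have [D [mD <- ND]] := intP; apply: le_measure => //; exact/mem_set.
rewrite (_ : ~` _ = N `|` \bigcup_n A n); last first.
  rewrite setCI setC_bigcap; congr (_ `|` _).
  by apply: eq_bigcupr => n _; apply/seteqP; split=> mu /=; rewrite /A/= ltNge => /negP.
have mUA : measurable (\bigcup_n A n : set (borel M)) by exact: bigcupT_measurable.
apply: le_trans (measureU2 _ mN mUA) _.
rewrite [X in (X + _)%E]PN add0e.
apply: (@le_trans _ _ (\sum_(n <oo) P (A n))%E).
  exact: (@measure_sigma_subadditive _ _ _ P (\bigcup_n A n) A mA mUA).

apply: le_trans (epsilon_trick0 xpredT (ltW eps0)).
apply: lee_nneseries => // n _.
rewrite -(@lee_pmul2l _ (c n)%:E)// ?lte_fin//.
have mb : measurable_fun setT ((fun mu : M => \int[bfm mu]_z b n z) : borel M -> R).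
  by apply: continuous_measurable_real; exact: continuous_test_int.
apply: (@le_trans _ _ (\int[P]_mu (\int[bfm mu]_z b n z)%:E)%E).
  rewrite -[X in (_ * P X)%E]setIT -(@integral_indic _ _ R P setT)//.
  rewrite -ge0_integralZl//; last 2 first.
  - by apply/measurable_EFinP; exact: measurable_indic.
  - by rewrite lee_fin ltW.
  apply: ge0_le_integral => //.
  - by move=> mu _; rewrite -EFinM lee_fin mulr_ge0 ?indicE// ltW.
  - by apply: measurable_funeM; apply/measurable_EFinP; exact: measurable_indic.
  - exact/measurable_EFinP.
  - move=> mu _; rewrite -EFinM lee_fin indicE.
    have [/set_mem/= /ltW|_] := boolP (mu \in A n); first by rewrite mulr1.
    by rewrite mulr0 test_Rint_ge0.
have [Bn0 /(_ P sP) hB] := BP n.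
apply: le_trans hB _; apply: (@le_trans _ _ ((B n)%:E * lambda0%:E)%E).
  by rewrite lee_wpmul2l// lee_fin.
rewrite -!EFinM lee_fin -/(e n) /c divfK ?lt0r_neq0//.
by rewrite (le_trans (ler_norm _))// lerDl.
Qed.

End tightness.

Theorem lemmaA1 (R : realType) (d : nat) (hd : (0 < d)%N)
    (K : completeMetricType R) (hK : separable K) (lambda0 : R) :
  [/\ locally_compact [set: K] -> tight (@stationary_mpp_le R d K lambda0),
      closed_in_law (@stationary_mpp_le R d K lambda0) &
      forall (P_ : nat -> probability (borel (bfmeasure d K)) R)
             (P : probability (borel (bfmeasure d K)) R),
        (forall n, stationary_mpp_le lambda0 (P_ n)) ->
        cvg_in_law P_ P ->
        (forall n, 0 < intensity (P_ n))%E -> (0 < intensity P)%E ->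
        intensity (P_ n) @[n --> \oo] --> intensity P ->
        cvg_in_law (fun n => palm (P_ n)) (palm P)].
Proof.
split.
- exact: tight_stationary_mpp_le.
- exact: stationary_mpp_le_closed.
- move=> P_ P FP PP P0 PI0 IP.
  have [_ sP PI] := stationary_mpp_le_closed hK FP PP.
  apply: palm_cvg_in_law => //; last by apply: le_lt_trans PI _; rewrite ltry.
  by move=> n; have [_ _ /le_lt_trans] := FP n; apply; rewrite ltry.
Qed.
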